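(* Let $\Sigma$ be a smoothly embedded hypersurface in a conformal manifold $(M,\boldsymbol c)$ of dimension $d\ge 3$. There is an obstruction to solving, smoothly and to all orders, the problem of finding a smooth defining density $\bar\sigma$ for $\Sigma$ with $S(\bar\sigma)=1+\bar\sigma^{\ell}A_\ell$, $A_\ell\in\Gamma(\mathcal E[-\ell])$, with $\ell$ as high as possible. This obstruction is a conformal density $\mathcal B\in\Gamma(\mathcal E\Sigma[-d])$ (the obstruction density) that is determined entirely by the data $(M,\boldsymbol c,\Sigma)$ of the conformal embedding. That is, a smooth formal solution (a smooth solution with $\ell=\infty$) exists if and only if $\mathcal B=0$.
   Context: $(M,\boldsymbol c)$ is a smooth connected oriented $d$-manifold, $d\ge3$, with a conformal class $\boldsymbol c$ of Riemannian metrics ($\hat g\sim g$ iff $\hat g=\Omega^2g$, $0<\Omega\in C^\infty(M)$). $\mathcal E[w]=\mathcal EM[w]$ is the line bundle of conformal densities of weight $w\in\mathbb R$, the oriented $\frac{w}{2d}$-th root of $(\Lambda^dTM)^2$; a metric $g\in\boldsymbol c$ trivialises it, and a section is represented by functions $f_g$ with $f_{\Omega^2g}=\Omega^wf_g$. $\mathcal E\Sigma[w]$ denotes weight $w$ densities on $\Sigma$ with its induced conformal structure, identified with $\mathcal EM[w]|_\Sigma$. $\Gamma$ denotes smooth sections. $\boldsymbol g\in\Gamma(\odot^2T^*M\otimes\mathcal E[2])$ is the conformal metric, used to raise and lower indices. A positive $\tau\in\Gamma(\mathcal E[1])$ corresponds to the metric $\tau^{-2}\boldsymbol g\in\boldsymbol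 c$. For $g\in\boldsymbol c$, $\nabla$ is its Levi-Civita connection, $\Delta=\boldsymbol g^{ab}\nabla_a\nabla_b$, and $\mathrm{Sc}$ is its scalar curvature. For $\sigma\in\Gamma(\mathcal E[1])$ set $$S(\sigma):=\boldsymbol g^{ab}(\nabla_a\sigma)(\nabla_b\sigma)-\tfrac2d\,\sigma\Big(\Delta+\tfrac{\mathrm{Sc}}{2(d-1)}\Big)\sigma,$$ which is independent of $g\in\boldsymbol c$. A hypersurface is a smoothly embedded codimension-1 submanifold. A defining density for $\Sigma$ is a section $\sigma\in\Gamma(\mathcal E[1])$ with zero locus exactly $\Sigma$ and $\nabla\sigma$ nowhere zero along $\Sigma$. All considerations are local near $\Sigma$ and formal along $\Sigma$; all defining densities for a given $\Sigma$ are taken to be compatibly oriented (their ratios are positive). For $\ell=\infty$ the equation means $S(\bar\sigma)-1$ vanishes to infinite order along $\Sigma$. The obstruction density is $\mathcal B:=B_{\bar\sigma}|_\Sigma$, where $\bar\sigma$ is any smooth defining density with $S(\bar\sigma)=1+\bar\sigma^dB_{\bar\sigma}$ for a smooth $B_{\bar\sigma}\in\Gamma(\mathcal E[-d])$ (such $\bar\sigma$ exist). *)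

(* Defs.v *)
From HB Require Import structures.
From mathcomp Require Import all_boot all_order all_algebra.
From mathcomp Require Import all_classical all_reals all_analysis.

Set Implicit Arguments.
Unset Strict Implicit.
Unset Printing Implicit Defensive.
Import Order.TTheory GRing.Theory Num.Theory.
Import numFieldNormedType.Exports.
Local Open Scope classical_set_scope.
Local Open Scope ring_scope.

(** * Smooth functions on open subsets of R^d *)

Section Calculus.
Variables (R : realType) (d : nat).
Implicit Types (f u : 'rV[R]_d -> R) (O : set 'rV[R]_d) (x : 'rV[R]_d).

Definition pderiv (i : 'I_d) f x : R := 'D_(delta_mx 0 i) f x.

Definition pderivs (s : seq 'I_d) f : 'rV[R]_d -> R := foldr pderiv f s.

(* C^oo on O (meant for open O): every iterated partial derivative exists and
   is Frechet differentiable, hence continuous, at every point of O. *)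
Definition smooth_on O f :=
  forall (s : seq 'I_d) x, O x -> differentiable (pderivs s f) x.

Definition smooth_map_on (e : nat) O (F : 'rV[R]_d -> 'rV[R]_e) :=
  forall j : 'I_e, smooth_on O (fun x => F x 0 j).

(** ** Riemannian geometry in coordinates; [G x] is the matrix (g_ij(x)) *)

Implicit Types G : 'rV[R]_d -> 'M[R]_d.

Definition christoffel G (k i j : 'I_d) x : R :=
  2^-1 * \sum_(l < d) invmx (G x) k l *
    (pderiv i (fun y => G y j l) x + pderiv j (fun y => G y i l) x
     - pderiv l (fun y => G y i j) x).

(* The sign convention makes the scalar curvature of round spheres positive. *)
Definition ricci G (i j : 'I_d) x : R :=
  \sum_(k < d) (pderiv k (christoffel G k i j) x
                - pderiv j (christoffel G k i k) x)
  + \sum_(k < d) \sum_(l < d)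
      (christoffel G k k l x * christoffel G l i j x
       - christoffel G k j l x * christoffel G l i k x).

Definition scalar_curvature G x : R :=
  \sum_(i < d) \sum_(j < d) invmx (G x) i j * ricci G i j x.

Definition hessian G u (i j : 'I_d) x : R :=
  pderiv i (pderiv j u) x
  - \sum_(k < d) christoffel G k i j x * pderiv k u x.

Definition laplacian G u x : R :=
  \sum_(i < d) \sum_(j < d) invmx (G x) i j * hessian G u i j x.

Definition grad_sqnorm G u x : R :=
  \sum_(i < d) \sum_(j < d) invmx (G x) i j * (pderiv i u x * pderiv j u x).

(* [u] is the coordinate expression, in the scale of the metric [G], of a
   density sigma of weight 1. *)
Definition S_curvature G u x : R :=
  grad_sqnorm G u x
  - 2 / d%:R * u x *
    (laplacian G u x + scalar_curvature G x / (2 * (d%:R - 1)) * u x).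

End Calculus.

(** * Smooth oriented manifolds *)

(* [cmap] is only relevant on [dom], and [cinv] only on [cmap @` dom]. *)
Record chart (R : realType) (d : nat) (M : topologicalType) := Chart {
  dom : set M;
  cmap : M -> 'rV[R]_d;
  cinv : 'rV[R]_d -> M }.

Section Manifold.
Variables (R : realType) (d : nat) (M : topologicalType).
Local Notation chart := (chart R d M).
Implicit Types (a b phi : chart) (atl : set chart) (U Sigma P : set M).

Definition cod a : set 'rV[R]_d := cmap a @` dom a.

Record is_chart a : Prop := IsChart {
  chart_open_dom : open (dom a);
  chart_open_cod : open (cod a);
  chart_cancel : forall p, dom a p -> cinv a (cmap a p) = p;
  chart_continuous : {within dom a, continuous (cmap a)};
  chart_continuous_inv : {within cod a, continuous (cinv a)} }.

Definition transition a b : 'rV[R]_d -> 'rV[R]_d := cmap b \o cinv a.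

Definition smooth_transition a b :=
  smooth_map_on (cmap a @` (dom a `&` dom b)) (transition a b).

Record oriented_manifold atl : Prop := OrientedManifold {
  manifold_hausdorff : hausdorff_space M;
  manifold_second_countable : @second_countable M;
  manifold_connected : connected [set: M];
  atlas_cover : forall p, exists2 a, atl a & dom a p;
  atlas_chart : forall a, atl a -> is_chart a;
  atlas_smooth : forall a b, atl a -> atl b -> smooth_transition a b;
  atlas_oriented : forall a b p, atl a -> atl b -> dom a p -> dom b p ->
    0 < \det (jacobian (transition a b) (cmap a p)) }.

Definition smooth_fun atl U (f : M -> R) :=
  forall a, atl a -> smooth_on (cmap a @` (dom a `&` U)) (f \o cinv a).

(** ** Conformal structures *)

(* A metric is given by its matrix of components in each chart. *)
Definition metric_field := chart -> 'rV[R]_d -> 'M[R]_d.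

(* With row vectors, [jacobian F x i j] is the derivative of the j-th component
   of F in the i-th direction. *)
Record is_metric atl (g : metric_field) : Prop := IsMetric {
  metric_smooth : forall a, atl a ->
    forall i j : 'I_d, smooth_on (cod a) (fun x => g a x i j);
  metric_sym : forall a x, atl a -> cod a x -> (g a x)^T = g a x;
  metric_posdef : forall a x, atl a -> cod a x ->
    forall v : 'rV[R]_d, v != 0 -> 0 < (v *m g a x *m v^T) 0 0;
  metric_tensor : forall a b p, atl a -> atl b -> dom a p -> dom b p ->
    let J := jacobian (transition a b) (cmap a p) in
    g a (cmap a p) = J *m g b (cmap b p) *m J^T }.

(* h = Omega^2 g with Omega smooth and positive *)
Definition conformal_change atl (Omega : M -> R) (g h : metric_field) :=
  [/\ smooth_fun atl setT Omega, (forall p, 0 < Omega p)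
    & forall a p, atl a -> dom a p ->
        h a (cmap a p) = Omega p ^+ 2 *: g a (cmap a p)].

Definition is_conformal_class atl (c : set metric_field) :=
  exists2 g0, is_metric atl g0 &
    c = [set h | is_metric atl h /\
                 exists Omega, conformal_change atl Omega g0 h].

(** ** Densities: one function for each scale [g] in the conformal class *)

Definition density := metric_field -> M -> R.

(* a smooth section of E[w] over the open set U *)
Definition is_density atl (c : set metric_field) U (w : R) (f : density) :=
  (forall g, c g -> smooth_fun atl U (f g)) /\
  (forall g h Omega, c g -> c h -> conformal_change atl Omega g h ->
     forall p, U p -> f h p = Omega p `^ w * f g p).

(** ** Hypersurfaces *)

(* [phi] belongs to the maximal smooth atlas (it may reverse orientation) and
   flattens [Sigma] to the hyperplane x_k = 0. *)
Definition slice_chart atl Sigma phi (k : 'I_d) :=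
  [/\ is_chart phi,
      (forall a, atl a -> smooth_transition a phi /\ smooth_transition phi a)
    & forall q, dom phi q -> (Sigma q <-> cmap phi q 0 k = 0)].

Definition embedded_hypersurface atl Sigma :=
  forall p, Sigma p ->
    exists phi k, slice_chart atl Sigma phi k /\ dom phi p.

(* A co-orientation of [Sigma], given by its positive side: near [Sigma], the
   set [P] is one of the two sides x_k > 0 of [Sigma]. Defining densities are
   compatibly oriented when they are positive on the same side. *)
Definition positive_side atl Sigma P :=
  forall p, Sigma p ->
    exists phi k, [/\ slice_chart atl Sigma phi k, dom phi p
      & forall q, dom phi q -> (P q <-> 0 < cmap phi q 0 k)].

(* smoothness of a function on [Sigma]; values outside [Sigma] are irrelevant *)
Definition smooth_along atl Sigma (f : M -> R) :=
  forall p, Sigma p -> exists V F,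
    [/\ open V, V p, smooth_fun atl V F
      & forall q, V q -> Sigma q -> f q = F q].

(* a smooth section over [Sigma] of ESigma[w] = EM[w]|_Sigma *)
Definition is_density_along atl (c : set metric_field) Sigma (w : R)
    (f : density) :=
  (forall g, c g -> smooth_along atl Sigma (f g)) /\
  (forall g h Omega, c g -> c h -> conformal_change atl Omega g h ->
     forall p, Sigma p -> f h p = Omega p `^ w * f g p).

(* [sigma] is defined on the open neighbourhood [U] of [Sigma]. *)
Record defining_density atl (c : set metric_field) Sigma P U
    (sigma : density) : Prop := DefiningDensity {
  defining_open : open U;
  defining_nbhd : Sigma `<=` U;
  defining_weight : is_density atl c U 1 sigma;
  defining_zero : forall g p, c g -> U p -> (sigma g p = 0 <-> Sigma p);
  defining_grad : forall g a p, c g -> atl a -> dom a p -> Sigma p ->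
    exists i : 'I_d, pderiv i (sigma g \o cinv a) (cmap a p) != 0;
  defining_oriented : forall g p, c g -> U p -> (0 < sigma g p <-> P p) }.

(** ** The equation S(sigma) = 1 + sigma^l A_l *)

(* S(sigma), in the coordinates of the chart [a], computed in the scale [g] *)
Definition S_density (sigma : density) (g : metric_field) a :
    'rV[R]_d -> R :=
  S_curvature (g a) (sigma g \o cinv a).

Record solves_to_order atl (c : set metric_field) Sigma P (l : nat) U
    (sigma A : density) : Prop := SolvesToOrder {
  solves_defining : defining_density atl c Sigma P U sigma;
  solves_remainder : is_density atl c U (- l%:R) A;
  solves_eq : forall g a p, c g -> atl a -> dom a p -> U p ->
    S_density sigma g a (cmap a p) = 1 + sigma g p ^+ l * A g p }.

(* the case l = oo: S(sigma) - 1 vanishes to infinite order along Sigma *)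
Record solves_to_infinite_order atl (c : set metric_field) Sigma P U
    (sigma : density) : Prop := SolvesToInfiniteOrder {
  formal_defining : defining_density atl c Sigma P U sigma;
  formal_eq : forall g a p, c g -> atl a -> dom a p -> Sigma p ->
    forall s : seq 'I_d,
      pderivs s (fun x => S_density sigma g a x - 1) (cmap a p) = 0 }.

(* B is the restriction to Sigma of the remainder of one, and of every,
   solution to order d. Only the values of B on Sigma matter, and these are
   thereby uniquely determined. *)
Definition is_obstruction_density atl (c : set metric_field) Sigma P
    (B : density) :=
  (exists U sigma A, solves_to_order atl c Sigma P d U sigma A) /\
  (forall U sigma A, solves_to_order atl c Sigma P d U sigma A ->
     forall g p, c g -> Sigma p -> A g p = B g p).

End Manifold.

(* Main.v *)
Require Import Defs.
From HB Require Import structures.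
From mathcomp Require Import all_boot all_order all_algebra.
From mathcomp Require Import all_classical all_reals all_analysis.
From mathcomp Require Import ring lra zify.
Set Implicit Arguments.
Unset Strict Implicit.
Unset Printing Implicit Defensive.
Import Order.TTheory GRing.Theory Num.Theory.
Import numFieldNormedType.Exports.
Local Open Scope classical_set_scope.
Local Open Scope ring_scope.

(** In one scale [g], S(u) = |grad u|^2 + u * (...) is independent of the chart
    (transformation law of the Christoffel symbols, whose integrability gives
    that of the Ricci tensor) and, for weight 1 densities, of the scale, so the
    theorem is about functions on M. If |grad s|^2 = 1 + O(s), v = s + O(s^2) and
    k >= 2, then
      S(v + s^k f) = S(v) + (2 k (d + 1 - k) / d) f s^(k-1) + O(s^k).
    Starting from s with S(s) = 1 + O(s), obtained by dividing any defining
    function by the square root of its S, one removes the error terms of order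
    1, ..., d - 1 successively. The step k = d + 1 fails: the coefficient
    vanishes, so the remainder A restricted to Sigma cannot be altered; and a
    second solution differs from the first by O(s^(d+1)), by the same formula,
    so A|Sigma depends on nothing but the data. If A|Sigma = 0 the steps
    k >= d + 2 succeed again, and Borel's lemma sums the corrections; a solution
    to infinite order is conversely one of order d with A|Sigma = 0.

    Functions vanishing on Sigma are divided by s with Hadamard's lemma in slice
    charts. The local quotients agree because s^m h = 0 near p in Sigma gives
    m! (d_i s)^m h = 0 at p on taking m derivatives. *)

(** * Partial derivatives and smooth functions *)

(** S is nonlinear, so local solutions cannot be glued, yet a solution is wanted on a neighbourhood
    of all of Sigma. Partitions of unity are therefore used only where the conditions are convex:
    for a first defining function with prescribed sign, and for a Borel sum with prescribed
    coefficients. Remainders and cofactors are instead defined by equations F = s^m h; since h is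
    unique along the regular zero set, existence near each point already gives a global h.

    The coefficient 2k(d+1-k)/d is 2k, from twice the product of grad v with grad(s^k f), minus
    2k(k-1)/d, from s times the Laplacian of s^k f. Scalar curvature only enters the error term
    there; its role is to make S independent of the scale.

    Smoothness speaks of all iterated partial derivatives, so the regularity of a quotient, a cutoff
    or an infinite sum is obtained each time from a family of functions closed under
    differentiation: [quot], [flat] and [borel_term]. *)

Section Gradient.
Variables (R : realType) (d : nat).
Implicit Types (f g u : 'rV[R]_d -> R) (O : set 'rV[R]_d) (x y : 'rV[R]_d).

(** Frechet differentiability with a prescribed gradient, as a plain inequality, so that the
    estimates of [C1_differentiable] and [has_grad_perturb] can establish it directly. *)
Definition has_grad f x (c : 'I_d -> R) :=
  forall e : R, 0 < e ->
    \forall y \near x, `|f y - f x - \sum_i c i * (y - x) 0 i| <= e * `|y - x|.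

Lemma differentiable_bigsum (I : Type) (r : seq I) (P : pred I) (F : I -> 'rV[R]_d -> R) x :
  (forall j, P j -> differentiable (F j) x) ->
  differentiable (fun y => \sum_(j <- r | P j) F j y) x.
Proof.
move=> dF; elim: r => [|a r IH].
  rewrite (_ : (fun _ => _) = cst 0) //.
  by apply/funext => y; rewrite big_nil.
case Pa : (P a); last first.
  by under eq_fun do rewrite big_cons Pa.
under eq_fun do rewrite big_cons Pa.
by apply: differentiableD => //; exact: dF.
Qed.

Lemma diff_pderiv f x v : differentiable f x ->
  'd f x v = \sum_i v 0 i * pderiv i f x.
Proof.
move=> df; rewrite {1}[v]row_sum_delta linear_sum; apply: eq_bigr => i _.
by rewrite linearZ /= /pderiv deriveE.
Qed.

Lemma differentiable_has_grad f x :
  differentiable f x -> has_grad f x (fun i => pderiv i f x).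
Proof.
move=> df e e0; have /diff_locallyP [_] := df.
move/eqaddoP => /(_ e e0) H; rewrite (near_shift 0 x) /=.
apply: filterS H => y /=.
rewrite !fctE /= subr0 addrK /cst /= opprD addrA diff_pderiv//.
by rewrite (eq_bigr (fun i => pderiv i f x * y 0 i))// => i _; rewrite mulrC.
Qed.

(** The sum is packaged as a continuous linear map; uniqueness of the differential then identifies
    it, and its values on basis vectors are the partial derivatives. *)
Lemma has_grad_differentiable f x c :
  has_grad f x c -> differentiable f x /\ forall i, pderiv i f x = c i.
Proof.
move=> fc.
have lin_l : linear (fun v : 'rV[R]_d => \sum_i c i * v 0 i : R).
  move=> k u v; rewrite scaler_sumr -big_split; apply: eq_bigr => i _ /=.
  by rewrite !mxE mulrDr mulrCA.
pose lM := GRing.isLinear.Build _ _ _ _ _ lin_l.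
pose l : {linear 'rV[R]_d -> R} := HB.pack (fun v : 'rV[R]_d => \sum_i c i * v 0 i : R) lM.
have lc : continuous l.
  have -> : (l : _ -> _) = (fun v : 'rV[R]_d => \sum_i c i * v 0 i : R) by [].
  move=> v; apply: differentiable_continuous; apply: differentiable_bigsum => i _.
  apply: differentiableM => //; exact: differentiable_coord.
have fl : f \o shift x = cst (f x) + l +o_ (nbhs (0 : 'rV[R]_d)) id.
  apply/eqaddoP => e e0; have := fc e e0.
  rewrite (near_shift 0 x) /=; apply: filterS => y /=.
  by rewrite !fctE /= subr0 addrK opprD addrA.
have dl := diff_unique lc fl.
have df : differentiable f x.
  by apply/diff_locallyP; rewrite dl.
split=> // i; rewrite /pderiv deriveE// dl /=.
rewrite (bigD1 i)//= big1 ?addr0 ?mxE ?eqxx ?mulr1// => j ji.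
by rewrite mxE eqxx /= (negbTE ji) mulr0.
Qed.

Lemma has_grad_near f g x c :
  (\forall y \near x, f y = g y) -> has_grad f x c -> has_grad g x c.
Proof.
move=> fg fc e e0; have gx := nbhs_singleton fg.
by have := fc e e0; apply: filterS2 fg => y ->; rewrite gx.
Qed.

Lemma near_eq_differentiable f g x :
  (\forall y \near x, f y = g y) -> differentiable f x -> differentiable g x.
Proof.
by move=> fg /differentiable_has_grad/(has_grad_near fg)/has_grad_differentiable[].
Qed.

Lemma near_eq_pderiv f g x i :
  (\forall y \near x, f y = g y) -> pderiv i f x = pderiv i g x.
Proof. exact: near_eq_derive. Qed.

Lemma near_eq_near (P : 'rV[R]_d -> Prop) x :
  (\forall y \near x, P y) -> \forall y \near x, \forall z \near y, P z.
Proof. by move=> H; apply: nbhs_interior. Qed.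

Lemma near_eq_pderivs s f g x :
  (\forall y \near x, f y = g y) ->
  \forall y \near x, pderivs s f y = pderivs s g y.
Proof.
move=> fg; elim: s => [//|i s IH] /=.
have := near_eq_near IH.
by apply: filterS => y; exact: near_eq_pderiv.
Qed.

Lemma pderivs_near s f g x :
  (\forall y \near x, f y = g y) -> pderivs s f x = pderivs s g x.
Proof. by move=> /(near_eq_pderivs s) /nbhs_singleton. Qed.

Lemma pderivs_rcons s i f : pderivs (rcons s i) f = pderivs s (pderiv i f).
Proof. by rewrite /pderivs foldr_rcons. Qed.

Lemma pderiv_cst i (k : R) x : pderiv i (fun=> k) x = 0.
Proof. exact: derive_cst. Qed.

Lemma pderivD i f g x : differentiable f x -> differentiable g x ->
  pderiv i (fun y => f y + g y) x = pderiv i f x + pderiv i g x.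
Proof. by move=> df dg; apply: deriveD; exact: diff_derivable. Qed.

Lemma pderivB i f g x : differentiable f x -> differentiable g x ->
  pderiv i (fun y => f y - g y) x = pderiv i f x - pderiv i g x.
Proof. by move=> df dg; apply: deriveB; exact: diff_derivable. Qed.

Lemma pderivM i f g x : differentiable f x -> differentiable g x ->
  pderiv i (fun y => f y * g y) x = pderiv i f x * g x + f x * pderiv i g x.
Proof.
move=> df dg; rewrite [LHS](@deriveM _ _ f g)//; try exact: diff_derivable.
by rewrite addrC mulrC.
Qed.

Lemma pderivZ i (k : R) f x : differentiable f x ->
  pderiv i (fun y => k * f y) x = k * pderiv i f x.
Proof. by move=> df; rewrite pderivM// pderiv_cst mul0r add0r. Qed.

Lemma pderivV i f x : differentiable f x -> f x != 0 ->
  pderiv i (fun y => (f y)^-1) x = - (pderiv i f x / f x ^+ 2).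
Proof.
move=> df fx; rewrite [LHS](@deriveV _ _ f)//; try exact: diff_derivable.
by rewrite [LHS]mulNr mulrC.
Qed.

Lemma pderiv_bigsum i (I : Type) (r : seq I) (P : pred I) (F : I -> 'rV[R]_d -> R) x :
  (forall j, P j -> differentiable (F j) x) ->
  pderiv i (fun y => \sum_(j <- r | P j) F j y) x = \sum_(j <- r | P j) pderiv i (F j) x.
Proof.
move=> dF; elim: r => [|a r IH].
  rewrite big_nil -[RHS](pderiv_cst i 0 x); congr pderiv.
  by apply/funext => y; rewrite big_nil.
rewrite big_cons; case: ifPn => Pa; last first.
  by rewrite -IH; congr pderiv; apply/funext => y; rewrite big_cons (negbTE Pa).
rewrite -IH -pderivD; [|exact: dF|exact: differentiable_bigsum].
by congr pderiv; apply/funext => y; rewrite big_cons Pa.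
Qed.

Lemma differentiable_exp f n x : differentiable f x ->
  differentiable (fun y => f y ^+ n) x.
Proof.
move=> df; elim: n => [|n IH]; first exact: differentiable_cst.
by under eq_fun do rewrite exprS; exact: differentiableM.
Qed.

Lemma pderivX i f n x : differentiable f x ->
  pderiv i (fun y => f y ^+ n) x = n%:R * f x ^+ n.-1 * pderiv i f x.
Proof.
move=> df; elim: n => [|n IH].
  by rewrite !mul0r -[RHS](pderiv_cst i 1 x).
rewrite (_ : (fun _ => _) = (fun y => f y * f y ^+ n)); last first.
  by apply/funext => y; rewrite exprS.
rewrite pderivM//; last exact: differentiable_exp.
rewrite IH; case: n {IH} => [|n] /=; first by rewrite !mul0r mulr0 expr0; ring.
by rewrite !exprS -(natr1 n.+1); ring.
Qed.

Lemma pderiv_coord i j x : pderiv i (fun y : 'rV[R]_d => y 0 j) x = (i == j)%:R.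
Proof.
rewrite /pderiv deriveE; last exact: differentiable_coord.
have @f : {linear 'rV[R]_d -> R}.
  by exists (fun N : 'rV[R]_d => N 0 j); do 2![eexists]; do ?[constructor];
     rewrite ?mxE// => ? *; rewrite ?mxE//; move=> ?; rewrite !mxE.
rewrite (_ : (fun y : 'rV[R]_d => y 0 j) = f) //.
by rewrite diff_lin; [rewrite /= mxE eqxx eq_sym|exact: coord_continuous].
Qed.

End Gradient.

Lemma differentiable_row (R : realType) (V : normedModType R) (e : nat)
    (F : V -> 'rV[R]_e) x :
  (forall j, differentiable (fun y => F y 0 j) x) -> differentiable F x.
Proof.
move=> dF.
rewrite (_ : F = (fun y => \sum_j F y 0 j *: (delta_mx 0 j : 'rV[R]_e))); last first.
  by apply/funext => y; rewrite -row_sum_delta.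
have := @differentiable_sum _ _ _ e (fun j y => F y 0 j *: (delta_mx 0 j : 'rV[R]_e)) x.
rewrite (_ : \sum_(i < e) _ = (fun y => \sum_j F y 0 j *: (delta_mx 0 j : 'rV[R]_e))).
  by apply => j; apply: differentiableZl.
by apply/funext => y; rewrite fct_sumE.
Qed.

Lemma diff_coord (R : realType) (V : normedModType R) (e : nat)
    (F : V -> 'rV[R]_e) x v j : differentiable F x ->
  'd (fun y => F y 0 j) x v = ('d F x v) 0 j.
Proof.
move=> dF.
have @c : {linear 'rV[R]_e -> R}.
  by exists (fun N : 'rV[R]_e => N 0 j); do 2![eexists]; do ?[constructor];
     rewrite ?mxE// => ? *; rewrite ?mxE//; move=> ?; rewrite !mxE.
have dc : differentiable c (F x) by exact: differentiable_coord.
have := @diff_comp _ _ _ _ F c x dF dc.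
have -> : 'd c (F x) = c :> (_ -> _) by apply: diff_lin; exact: coord_continuous.
by move=> /(congr1 (fun f => f v)).
Qed.

Section Chain.
Variables (R : realType) (d e : nat).

Lemma differentiable_chain (f : 'rV[R]_e -> R) (F : 'rV[R]_d -> 'rV[R]_e) x :
  (forall j, differentiable (fun y => F y 0 j) x) -> differentiable f (F x) ->
  differentiable (fun y => f (F y)) x.
Proof.
by move=> dF df; apply: (@differentiable_comp _ _ _ _ F f) => //; exact: differentiable_row.
Qed.

Lemma pderiv_chain i (f : 'rV[R]_e -> R) (F : 'rV[R]_d -> 'rV[R]_e) x :
  (forall j, differentiable (fun y => F y 0 j) x) -> differentiable f (F x) ->
  pderiv i (fun y => f (F y)) x =
  \sum_j pderiv i (fun y => F y 0 j) x * pderiv j f (F x).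
Proof.
move=> dF df; have dF' := differentiable_row dF.
rewrite {1}/pderiv deriveE; last exact: differentiable_chain.
rewrite (@diff_comp _ _ _ _ F f)//= diff_pderiv//; apply: eq_bigr => j _; congr (_ * _).
rewrite /pderiv deriveE ?diff_coord//; exact: (dF j).
Qed.

Lemma jacobianE (F : 'rV[R]_d -> 'rV[R]_e) x i j : differentiable F x ->
  jacobian F x i j = pderiv i (fun y => F y 0 j) x.
Proof.
move=> dF.
rewrite /jacobian mxE /pderiv deriveE ?diff_coord//.
apply: (@differentiable_comp _ _ _ _ F (fun y : 'rV[R]_e => y 0 j)) => //.
exact: differentiable_coord.
Qed.

End Chain.

(** * Smooth functions and their closure properties *)

Section Smooth.
Variables (R : realType) (d : nat).
Implicit Types (i : 'I_d) (f g u : 'rV[R]_d -> R) (O : set 'rV[R]_d) (x y : 'rV[R]_d).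

(** A grading of [smooth_on] by order. The derivative of a product, an inverse or a root is an
    expression in functions of the same kind, so closure properties go through by induction on the
    order, whereas a fixed list of derivatives would not reproduce itself. *)
Fixpoint Cn (n : nat) O f : Prop :=
  (forall x, O x -> differentiable f x) /\
  (if n is m.+1 then forall i, Cn m O (pderiv i f) else True).

Lemma Cn_differentiable n O f x : Cn n O f -> O x -> differentiable f x.
Proof. by case: n => [|n] [df _]; exact: df. Qed.

Lemma CnW n O f : Cn n.+1 O f -> Cn n O f.
Proof.
elim: n f => [|n IH] f [df dpf]; split=> // i.
exact/IH/dpf.
Qed.

Lemma Cn_pderiv n O f i : Cn n.+1 O f -> Cn n O (pderiv i f).
Proof. by case=> _; apply. Qed.

Lemma smooth_onP O f : smooth_on O f <-> forall n, Cn n O f.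
Proof.
split=> [sf n|Cf s x Ox].
  elim: n f sf => [|n IH] f sf; split=> //; try exact: (sf [::]).
  by move=> i; apply: IH => s x Ox; rewrite -pderivs_rcons; exact: sf.
elim/last_ind: s f Cf => [|s i IH] f Cf; first exact: (Cn_differentiable (Cf 0%N)).
by rewrite pderivs_rcons; apply: IH => n; apply: Cn_pderiv.
Qed.

Lemma smooth_onS O f : smooth_on O f <->
  (forall x, O x -> differentiable f x) /\ forall i, smooth_on O (pderiv i f).
Proof.
split=> [sf|[df sf]].
  by split=> [|i s x Ox]; [exact: (sf [::])|rewrite -pderivs_rcons; exact: sf].
move=> s; elim/last_ind: s => [//|s i _] x Ox; rewrite pderivs_rcons; exact: sf.
Qed.

Lemma smooth_on_diff O f x : smooth_on O f -> O x -> differentiable f x.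
Proof. by move=> /(_ [::]); apply. Qed.

Lemma smooth_on_pderiv O f i : smooth_on O f -> smooth_on O (pderiv i f).
Proof. by move=> /smooth_onS[]. Qed.

Lemma smooth_on_pderivs O f s : smooth_on O f -> smooth_on O (pderivs s f).
Proof. by move=> sf; elim: s => [//|i s IH]; exact: smooth_on_pderiv. Qed.

Lemma smooth_onW O O' f : O' `<=` O -> smooth_on O f -> smooth_on O' f.
Proof. by move=> sO sf s x /sO; exact: sf. Qed.

Lemma pderiv_eq O f g : open O -> {in O, f =1 g} ->
  forall i, {in O, pderiv i f =1 pderiv i g}.
Proof.
move=> oO fg i x; rewrite inE => Ox; apply: near_eq_pderiv.
by have := open_nbhs_nbhs (conj oO Ox); apply: filterS => y Oy; apply: fg; rewrite inE.
Qed.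

Lemma pderivs_eq O f g : open O -> {in O, f =1 g} ->
  forall s, {in O, pderivs s f =1 pderivs s g}.
Proof. by move=> oO fg; elim=> [//|i s IH] /=; exact: pderiv_eq. Qed.

Lemma smooth_on_eq O f g : open O -> {in O, f =1 g} -> smooth_on O f -> smooth_on O g.
Proof.
move=> oO fg sf s x Ox; apply: near_eq_differentiable (sf s x Ox).
have := open_nbhs_nbhs (conj oO Ox); apply: filterS => y Oy.
by apply: (pderivs_eq oO) => //; rewrite inE.
Qed.

Lemma smooth_on_local O f :
  (forall x, O x -> exists2 O', open O' /\ O' x & smooth_on O' f) -> smooth_on O f.
Proof. by move=> H s x /H [V [_ Vx] sV]; exact: sV. Qed.

Lemma Cn_eq n O f g : open O -> {in O, f =1 g} -> Cn n O f -> Cn n O g.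
Proof.
move=> oO; elim: n f g => [|n IH] f g fg [df dpf]; split=> //.
- move=> x Ox; apply: near_eq_differentiable (df x Ox).
  by have := open_nbhs_nbhs (conj oO Ox); apply: filterS => y Oy; apply: fg; rewrite inE.
- move=> x Ox; apply: near_eq_differentiable (df x Ox).
  by have := open_nbhs_nbhs (conj oO Ox); apply: filterS => y Oy; apply: fg; rewrite inE.
- by move=> i; apply: IH (dpf i); exact: pderiv_eq.
Qed.

Lemma Cn_cst n O (k : R) : Cn n O (fun=> k).
Proof.
elim: n k => [|n IH] k; split=> //; try by move=> x _; exact: differentiable_cst.
move=> i; rewrite (_ : pderiv i _ = fun=> 0)//.
by apply/funext => x; rewrite pderiv_cst.
Qed.

Lemma CnD n O f g : open O -> Cn n O f -> Cn n O g -> Cn n O (fun x => f x + g x).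
Proof.
move=> oO; elim: n f g => [|n IH] f g Cf Cg; split=> //.
- by move=> x Ox; apply: differentiableD; [exact: (Cn_differentiable Cf)|exact: (Cn_differentiable Cg)].
- by move=> x Ox; apply: differentiableD; [exact: (Cn_differentiable Cf)|exact: (Cn_differentiable Cg)].
move=> i; apply: (Cn_eq oO _ (IH _ _ (Cn_pderiv i Cf) (Cn_pderiv i Cg))).
move=> x; rewrite inE => Ox /=; rewrite pderivD//.
  exact: (Cn_differentiable Cf).
exact: (Cn_differentiable Cg).
Qed.

Lemma CnM n O f g : open O -> Cn n O f -> Cn n O g -> Cn n O (fun x => f x * g x).
Proof.
move=> oO; elim: n f g => [|n IH] f g Cf Cg; split=> //.
- by move=> x Ox; apply: differentiableM; [exact: (Cn_differentiable Cf)|exact: (Cn_differentiable Cg)].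
- by move=> x Ox; apply: differentiableM; [exact: (Cn_differentiable Cf)|exact: (Cn_differentiable Cg)].
move=> i.
have H := CnD oO (IH _ _ (Cn_pderiv i Cf) (CnW Cg)) (IH _ _ (CnW Cf) (Cn_pderiv i Cg)).
apply: (Cn_eq oO _ H).
move=> x; rewrite inE => Ox /=; rewrite pderivM//.
  exact: (Cn_differentiable Cf).
exact: (Cn_differentiable Cg).
Qed.

Lemma Cn_inv n O f : open O -> Cn n O f -> (forall x, O x -> f x != 0) ->
  Cn n O (fun x => (f x)^-1).
Proof.
move=> oO; elim: n f => [|n IH] f Cf f0; split=> //.
- by move=> x Ox; apply: differentiableV; [exact: (Cn_differentiable Cf)|exact: f0].
- by move=> x Ox; apply: differentiableV; [exact: (Cn_differentiable Cf)|exact: f0].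
move=> i; have H := IH _ (CnW Cf) f0.
have := CnM oO (CnM oO (Cn_cst n O (-1)) (Cn_pderiv i Cf)) (CnM oO H H).
apply: Cn_eq => // x; rewrite inE => Ox /=.
rewrite pderivV; [|exact: (Cn_differentiable Cf)|exact: f0].
by rewrite mulN1r mulNr -invfM -expr2.
Qed.

Lemma smooth_on_cst O (k : R) : smooth_on O (fun=> k).
Proof. by apply/smooth_onP => n; exact: Cn_cst. Qed.

Lemma smooth_onD O f g : open O -> smooth_on O f -> smooth_on O g ->
  smooth_on O (fun x => f x + g x).
Proof. by move=> oO /smooth_onP Cf /smooth_onP Cg; apply/smooth_onP => n; exact: CnD. Qed.

Lemma smooth_onM O f g : open O -> smooth_on O f -> smooth_on O g ->
  smooth_on O (fun x => f x * g x).
Proof. by move=> oO /smooth_onP Cf /smooth_onP Cg; apply/smooth_onP => n; exact: CnM. Qed.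

Lemma smooth_onV O f : open O -> smooth_on O f -> (forall x, O x -> f x != 0) ->
  smooth_on O (fun x => (f x)^-1).
Proof. by move=> oO /smooth_onP Cf f0; apply/smooth_onP => n; exact: Cn_inv. Qed.

Lemma smooth_onN O f : open O -> smooth_on O f -> smooth_on O (fun x => - f x).
Proof.
move=> oO sf; have := smooth_onM oO (smooth_on_cst (O := O) (-1)) sf.
by apply: smooth_on_eq => // x _; rewrite mulN1r.
Qed.

Lemma smooth_onB O f g : open O -> smooth_on O f -> smooth_on O g ->
  smooth_on O (fun x => f x - g x).
Proof. by move=> oO sf sg; apply: smooth_onD => //; exact: smooth_onN. Qed.

Lemma smooth_onX O f n : open O -> smooth_on O f -> smooth_on O (fun x => f x ^+ n).
Proof.
move=> oO sf; elim: n => [|n IH]; first exact: smooth_on_cst.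
by under eq_fun do rewrite exprS; exact: smooth_onM.
Qed.

Lemma smooth_on_div O f g : open O -> smooth_on O f -> smooth_on O g ->
  (forall x, O x -> g x != 0) -> smooth_on O (fun x => f x / g x).
Proof. by move=> oO sf sg g0; apply: smooth_onM => //; exact: smooth_onV. Qed.

Lemma smooth_on_sum O (I : Type) (r : seq I) (P : pred I) (F : I -> 'rV[R]_d -> R) :
  open O -> (forall j, P j -> smooth_on O (F j)) ->
  smooth_on O (fun x => \sum_(j <- r | P j) F j x).
Proof.
move=> oO sF; elim: r => [|a r IH].
  by under eq_fun do rewrite big_nil; exact: smooth_on_cst.
case Pa : (P a); last by under eq_fun do rewrite big_cons Pa.
by under eq_fun do rewrite big_cons Pa; apply: smooth_onD => //; exact: sF.
Qed.

Lemma smooth_on_prod O (I : Type) (r : seq I) (P : pred I) (F : I -> 'rV[R]_d -> R) :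
  open O -> (forall j, P j -> smooth_on O (F j)) ->
  smooth_on O (fun x => \prod_(j <- r | P j) F j x).
Proof.
move=> oO sF; elim: r => [|a r IH].
  by under eq_fun do rewrite big_nil; exact: smooth_on_cst.
case Pa : (P a); last by under eq_fun do rewrite big_cons Pa.
by under eq_fun do rewrite big_cons Pa; apply: smooth_onM => //; exact: sF.
Qed.

Lemma smooth_on_coord O j : open O -> smooth_on O (fun x : 'rV[R]_d => x 0 j).
Proof.
move=> oO; apply/smooth_onS; split=> [x _|i]; first exact: differentiable_coord.
have := smooth_on_cst (O := O) ((i == j)%:R : R); apply: smooth_on_eq => // x _.
by rewrite pderiv_coord.
Qed.

Lemma Cn_sum n O (I : Type) (r : seq I) (F : I -> 'rV[R]_d -> R) :
  open O -> (forall j, Cn n O (F j)) ->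
  Cn n O (fun x => \sum_(j <- r) F j x).
Proof.
move=> oO sF; elim: r => [|a r IH].
  by under eq_fun do rewrite big_nil; exact: Cn_cst.
by under eq_fun do rewrite big_cons; apply: CnD.
Qed.

Lemma Cn_sqrt n O f : open O -> Cn n O f -> (forall x, O x -> 0 < f x) ->
  Cn n O (fun x => Num.sqrt (f x)).
Proof.
move=> oO Cf f0.
have dsqrt (t : R) : 0 < t -> differentiable Num.sqrt t.
  by move=> t0; apply/derivable1_diffP; case: (is_derive1_sqrt t0).
have dq x : O x -> differentiable (fun x => Num.sqrt (f x)) x.
  move=> Ox; apply: (@differentiable_comp _ _ _ _ f Num.sqrt).
    exact: (Cn_differentiable Cf).
  exact/dsqrt/f0.
elim: n Cf => [|n IH] Cf; split=> // i.
have s0 x : O x -> Num.sqrt (f x) != 0 by move=> Ox; rewrite gt_eqF// sqrtr_gt0 f0.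
have := CnM oO (CnM oO (Cn_cst n O 2^-1) (Cn_pderiv i Cf)) (Cn_inv oO (IH (CnW Cf)) s0).
apply: Cn_eq => // x; rewrite inE => Ox.
(* The derivative of the root is read off by differentiating the square of the root. *)
have fE : pderiv i f x = pderiv i (fun y => Num.sqrt (f y) * Num.sqrt (f y)) x.
  apply: near_eq_pderiv; have := open_nbhs_nbhs (conj oO Ox); apply: filterS => y Oy.
  by rewrite -expr2 sqr_sqrtr// ltW// f0.
rewrite fE pderivM; [|exact: dq|exact: dq].
by have := s0 x Ox; set a := Num.sqrt _ => a0; field.
Qed.

Lemma smooth_on_sqrt O f : open O -> smooth_on O f -> (forall x, O x -> 0 < f x) ->
  smooth_on O (fun x => Num.sqrt (f x)).
Proof. by move=> oO /smooth_onP Cf f0; apply/smooth_onP => n; exact: Cn_sqrt. Qed.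

End Smooth.

(** Induction on the order: by the chain rule, a partial derivative of the composite is a sum of
    products of a derivative of [F] and a composite of the same kind. *)
Lemma smooth_on_comp (R : realType) (d e : nat) (O : set 'rV[R]_d) (O' : set 'rV[R]_e)
    (f : 'rV[R]_e -> R) (F : 'rV[R]_d -> 'rV[R]_e) :
  open O -> smooth_map_on O F -> smooth_on O' f -> (forall x, O x -> O' (F x)) ->
  smooth_on O (fun x => f (F x)).
Proof.
move=> oO sF /smooth_onP Cf OO'; apply/smooth_onP => n.
elim: n f Cf => [|n IH] f Cf; split=> //.
- move=> x Ox; apply: differentiable_chain => [j|].
    exact: (smooth_on_diff (sF j)).
  by apply: (Cn_differentiable (Cf 0%N)); exact: OO'.
- move=> x Ox; apply: differentiable_chain => [j|].
    exact: (smooth_on_diff (sF j)).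
  by apply: (Cn_differentiable (Cf 0%N)); exact: OO'.
move=> i.
have H : Cn n O (fun x => \sum_j pderiv i (fun y => F y 0 j) x * pderiv j f (F x)).
  apply: Cn_sum => // j; apply: CnM => //.
    by have /smooth_onP := smooth_on_pderiv i (sF j); apply.
  by apply: IH => m; apply: Cn_pderiv.
apply: (Cn_eq oO _ H) => x; rewrite inE => Ox; rewrite pderiv_chain// => [j|].
  exact: (smooth_on_diff (sF j)).
by apply: (Cn_differentiable (Cf 0%N)); exact: OO'.
Qed.

(** Bounds by absolute values treat increments of both signs at once, which spares later proofs the
    case distinction. *)
Lemma mean_value0 (R : realType) (F dF : R -> R) (h : R) :
  (forall t : R, `|t| <= `|h| -> is_derive t 1 F (dF t)) ->
  exists2 t : R, `|t| <= `|h| & F h - F 0 = dF t * h.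
Proof.
move=> dl.
have cl (t : R) : `|t| <= `|h| -> {for t, continuous F}.
  by move=> th; apply: differentiable_continuous; apply/derivable1_diffP; case: (dl t th).
case: (leP 0 h) => h0.
  have [||c ch E] := @MVT_segment R F dF 0 h h0.
  - by move=> t; rewrite in_itv /= => /andP[t0 th]; apply: dl; rewrite !ger0_norm// ltW.
  - apply: continuous_in_subspaceT => t; rewrite inE /= in_itv /= => /andP[t0 th].
    by apply: cl; rewrite !ger0_norm.
  move: ch; rewrite in_itv /= => /andP[c0 ch]; exists c; first by rewrite !ger0_norm.
  by rewrite E subr0.
have [||c ch E] := @MVT_segment R F dF h 0 (ltW h0).
- move=> t; rewrite in_itv /= => /andP[t0 th]; apply: dl.
  by rewrite !ltr0_norm// lerN2 ltW.
- apply: continuous_in_subspaceT => t; rewrite inE /= in_itv /= => /andP[t0 th].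
  by apply: cl; rewrite (ler0_norm th) (ltr0_norm h0) lerN2.
move: ch; rewrite in_itv /= => /andP[c0 ch]; exists c.
  by rewrite (ler0_norm ch) (ltr0_norm h0) lerN2.
by rewrite -opprB E sub0r mulrN opprK.
Qed.

Section Mean.
Variables (R : realType) (d : nat).
Implicit Types (f g u : 'rV[R]_d -> R) (O : set 'rV[R]_d) (x y : 'rV[R]_d).

Lemma line_is_derive f x (i : 'I_d) (t : R) : differentiable f (x + t *: delta_mx 0 i) ->
  is_derive t 1 (fun t : R => f (x + t *: delta_mx 0 i)) (pderiv i f (x + t *: delta_mx 0 i)).
Proof.
move=> df; split.
  apply/derivable1P => /=.
  have /derivable1P := diff_derivable (v := delta_mx 0 i) df.
  apply: near_eq_derivable.
  near=> h; congr f; rewrite scalerDl [_%:A]mulr1.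
  by rewrite addrCA.
rewrite /pderiv /derive; set q1 := (fun h : R => h^-1 *: _); set q2 := (fun h : R => h^-1 *: _).
suff -> : q1 = q2 by [].
apply/funext => h; rewrite /q1 /q2 /=; congr (_ *: (f _ - _)).
by rewrite [_%:A]mulr1 scalerDl addrCA.
Unshelve. all: by end_near.
Qed.

Lemma mean_value_line f x (i : 'I_d) (h : R) :
  (forall t : R, `|t| <= `|h| -> differentiable f (x + t *: delta_mx 0 i)) ->
  exists2 t : R, `|t| <= `|h| &
    f (x + h *: delta_mx 0 i) - f x = pderiv i f (x + t *: delta_mx 0 i) * h.
Proof.
move=> df.
have [|t th E] := @mean_value0 R (fun t : R => f (x + t *: delta_mx 0 i))
    (fun t => pderiv i f (x + t *: delta_mx 0 i)) h.
  by move=> t th; apply: line_is_derive; exact: df.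
by exists t => //; move: E; rewrite scale0r addr0.
Qed.

End Mean.

(** * Continuous partial derivatives imply differentiability *)

Section C1.
Variables (R : realType) (d : nat).
Implicit Types (i j : 'I_d) (f g u : 'rV[R]_d -> R) (O : set 'rV[R]_d) (x y v : 'rV[R]_d).

(** For [k] from 0 to [d], the points [x + trunc k v] are the corners of a path of coordinate edges
    from [x] to [x + v]. *)
Definition trunc (k : nat) v : 'rV[R]_d := \row_j (if (j < k)%N then v 0 j else 0).

Lemma truncS (k : nat) v (kd : (k < d)%N) :
  trunc k.+1 v = trunc k v + v 0 (Ordinal kd) *: delta_mx 0 (Ordinal kd).
Proof.
apply/rowP => j; rewrite !mxE eqxx /= ltnS leq_eqVlt.
have [->|jk] := eqVneq j (Ordinal kd); first by rewrite /= eqxx ltnn mulr1 add0r.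
have -> : (nat_of_ord j == k) = false by apply/negbTE; rewrite -val_eqE in jk.
by rewrite mulr0 addr0.
Qed.

Lemma trunc0 v : trunc 0 v = 0.
Proof. by apply/rowP => j; rewrite !mxE. Qed.

Lemma truncd v : trunc d v = v.
Proof. by apply/rowP => j; rewrite !mxE ltn_ord. Qed.

Lemma norm_row_le v (M : R) : 0 <= M -> (forall j, `|v 0 j| <= M) -> `|v| <= M.
Proof.
move=> M0 vM; rewrite /Num.Def.normr /= mx_normrE; apply/bigmax_leP; split=> //.
by case=> a j _ /=; rewrite ord1.
Qed.

Lemma norm_coord_le v j : `|v 0 j| <= `|v|.
Proof.
rewrite {2}/Num.Def.normr /= mx_normrE.
by apply: (le_bigmax _ (fun ij : 'I_1 * 'I_d => `|v ij.1 ij.2|) (0, j)).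
Qed.

Lemma near_forall_ord (n : nat) (P : 'I_n -> 'rV[R]_d -> Prop) x :
  (forall k : 'I_n, \forall y \near x, P k y) ->
  \forall y \near x, forall k : 'I_n, P k y.
Proof. exact: (@filter_forall _ _ (fun k => [set y | P k y]) (nbhs x) _). Qed.

Lemma near_gt f x (b : R) : {for x, continuous f} -> b < f x -> \forall y \near x, b < f y.
Proof. by move=> c bf; apply: (cvgr_gt _ c). Qed.

Lemma near_lt f x (b : R) : {for x, continuous f} -> f x < b -> \forall y \near x, f y < b.
Proof. by move=> c bf; apply: (cvgr_lt _ c). Qed.

Lemma ball_row x (e : R) y : ball x e y = (`|x - y| < e) :> Prop.
Proof. by rewrite -ball_normE. Qed.

(* The increment of [f] is telescoped along the edges of a box, with the mean value theorem on each edge. *)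
Lemma C1_differentiable O f (g : 'I_d -> 'rV[R]_d -> R) :
  open O ->
  (forall i y, O y -> is_derive (0 : R) (1 : R) (fun t : R => f (y + t *: delta_mx 0 i)) (g i y)) ->
  (forall i y, O y -> {for y, continuous (g i)}) ->
  forall x, O x -> has_grad f x (fun i => g i x).
Proof.
move=> oO fg cg x Ox e e0.
have [r r0 xrO] : exists2 r : R, 0 < r & ball x r `<=` O.
  by have /nbhs_ballP[r r0 H] := open_nbhs_nbhs (conj oO Ox); exists r.
(* One share of the error for each of the [d] edges; the added 1 keeps the divisor positive when
   [d = 0]. *)
pose e' := e / (d%:R + 1).
have d1 : 0 < d%:R + 1 :> R by rewrite ltr_wpDl.
have e'0 : 0 < e' by rewrite divr_gt0.
have [r' r'0 H] : exists2 r', 0 < r' & forall i y, ball x r' y -> `|g i y - g i x| <= e'.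
  have : \forall y \near x, forall i, `|g i y - g i x| <= e'.
    apply: near_forall_ord => i.
    by have /cvgrPdist_le/(_ _ e'0) := cg i x Ox; apply: filterS => y; rewrite distrC.
  by move/nbhs_ballP => [r' r'0 H]; exists r' => // i y /H.
near=> y.
have yx : `|y - x| < Num.min r r'.
  rewrite distrC -ball_row; near: y; apply/nbhs_ballP; exists (Num.min r r') => //=.
  by rewrite lt_min r0 r'0.
set v := y - x in yx *.
have seg k (kd : (k < d)%N) :
  `|f (x + trunc k.+1 v) - f (x + trunc k v) - g (Ordinal kd) x * v 0 (Ordinal kd)|
   <= e' * `|v|.
  set i := Ordinal kd.
  have inb (t : R) : `|t| <= `|v 0 i| -> `|(trunc k v + t *: delta_mx 0 i)| <= `|v|.
    move=> tv; apply: norm_row_le => // j; rewrite !mxE eqxx /=.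
    case: ifPn => jk.
      have -> : (j == i) = false by apply/negbTE; rewrite -val_eqE /= neq_ltn jk.
      by rewrite mulr0 addr0; have := norm_coord_le v j; rewrite !mxE.
    rewrite add0r; case: eqP => [_|_]; rewrite ?mulr1 ?mulr0 ?normr0//.
    exact: (le_trans tv (norm_coord_le _ _)).
  have inball (t : R) : `|t| <= `|v 0 i| ->
      ball x (Num.min r r') (x + trunc k v + t *: delta_mx 0 i).
    move=> tv; rewrite ball_row -addrA opprD addNKr normrN.
    exact: (le_lt_trans (inb t tv)).
  pose F (t : R) := f (x + trunc k v + t *: delta_mx 0 i).
  have dF (t : R) : `|t| <= `|v 0 i| ->
      is_derive t 1 F (g i (x + trunc k v + t *: delta_mx 0 i)).
    move=> tv; have Oy : O (x + trunc k v + t *: delta_mx 0 i).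
      by apply: xrO; apply: le_ball (inball t tv); rewrite ge_min lexx.
    have [D E] := fg i _ Oy.
    split; first (apply/derivable1P => /=; apply: (near_eq_derivable _ D)).
      by near=> h; rewrite /F scalerDl [_%:A]mulr1 [h *: _ + _]addrC addrA.
    rewrite -E /derive; set q1 := (fun h : R => h^-1 *: _); set q2 := (fun h : R => h^-1 *: _).
    suff -> : q1 = q2 by [].
    apply/funext => h; rewrite /q1 /q2 /F /= addr0 scale0r addr0; congr (_ *: (f _ - _)).
    by rewrite [_%:A]mulr1 scalerDl [h *: _ + _]addrC addrA.
  have [t tv E] := mean_value0 dF.
  rewrite truncS addrA -[f (_ + v 0 _ *: _)]/(F _).
  have -> : f (x + trunc k v) = F 0 by rewrite /F scale0r addr0.
  rewrite E -mulrBl normrM ler_pM//; last exact: norm_coord_le.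
  by apply: H; apply: le_ball (inball t tv); rewrite ge_min lexx orbT.
have tel k (kd : (k <= d)%N) :
  `|f (x + trunc k v) - f x - \sum_(j < d | (j < k)%N) g j x * v 0 j| <= k%:R * e' * `|v|.
  elim: k kd => [|k IH] kd.
    by rewrite trunc0 addr0 subrr big1 ?subr0 ?normr0 ?mul0r.
  have := lerD (seg k kd) (IH (ltnW kd)).
  rewrite -mulrDl -{1}[e']mul1r -mulrDl nat1r; apply: le_trans.
  apply: le_trans (ler_normD _ _); rewrite le_eqVlt; apply/orP; left; apply/eqP; congr (`|_|).
  rewrite (bigD1 (Ordinal kd))//=.
  rewrite (eq_bigl (fun j : 'I_d => (j < k)%N)); first by ring.
  move=> j /=; rewrite ltnS leq_eqVlt -val_eqE /=.
  by case: eqP => [->|] /=; rewrite ?ltnn ?andbT ?andbF.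
have := tel d (leqnn d).
rewrite truncd {1}/v [x + _]addrC subrK => /le_trans; rewrite (eq_bigl xpredT); last first.
  by move=> j; rewrite ltn_ord.
apply; rewrite ler_wpM2r//.
by rewrite /e' mulrCA ler_piMr ?(ltW e0)// ler_pdivrMr// mul1r lerDl.
Unshelve. all: by end_near.
Qed.

End C1.

(** * Symmetry of second derivatives *)

Section Schwarz.
Variables (R : realType) (d : nat).
Implicit Types (i j : 'I_d) (f g u : 'rV[R]_d -> R) (O : set 'rV[R]_d) (x y v w : 'rV[R]_d).

Lemma differentiable_translate f w x : differentiable f (x + w) ->
  differentiable (fun y => f (y + w)) x.
Proof.
move=> df; apply: (@differentiable_comp _ _ _ _ (fun y => y + w) f) => //.
Qed.

Lemma pderiv_translate f w x i : pderiv i (fun y => f (y + w)) x = pderiv i f (x + w).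
Proof.
rewrite /pderiv /derive; set q1 := (fun h : R => h^-1 *: _); set q2 := (fun h : R => h^-1 *: _).
suff -> : q1 = q2 by [].
by apply/funext => h; rewrite /q1 /q2 /= -addrA.
Qed.

(** The mean value theorem is applied along [i] to the difference [G] in direction [j], then along
    [j] to [pderiv i f]. The left side of the equation is symmetric in [i] and [j], the right side
    is not: this asymmetry yields Schwarz's theorem. *)
Lemma second_difference f x i j (h : R) :
  (forall t s : R, `|t| <= `|h| -> `|s| <= `|h| ->
     differentiable f (x + t *: delta_mx 0 i + s *: delta_mx 0 j) /\
     differentiable (pderiv i f) (x + t *: delta_mx 0 i + s *: delta_mx 0 j)) ->
  exists t s : R, [/\ `|t| <= `|h|, `|s| <= `|h| &
    f (x + h *: delta_mx 0 i + h *: delta_mx 0 j) - f (x + h *: delta_mx 0 i)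
     - f (x + h *: delta_mx 0 j) + f x
    = pderiv j (pderiv i f) (x + t *: delta_mx 0 i + s *: delta_mx 0 j) * h ^+ 2].
Proof.
move=> df.
pose G y := f (y + h *: delta_mx 0 j) - f y.
have df1 (t : R) : `|t| <= `|h| -> differentiable f (x + t *: delta_mx 0 i).
  by move=> th; have [] := df t 0 th; rewrite ?normr0// scale0r addr0.
have df2 (t : R) : `|t| <= `|h| ->
    differentiable (fun y => f (y + h *: delta_mx 0 j)) (x + t *: delta_mx 0 i).
  by move=> th; apply: differentiable_translate; have [] := df t h th (lexx _).
have [t th Et] : exists2 t : R, `|t| <= `|h| &
    G (x + h *: delta_mx 0 i) - G x = pderiv i G (x + t *: delta_mx 0 i) * h.
  by apply: mean_value_line => t th; apply: differentiableB; [exact: df2|exact: df1].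
have [s sh Es] : exists2 s : R, `|s| <= `|h| &
    pderiv i f (x + t *: delta_mx 0 i + h *: delta_mx 0 j) - pderiv i f (x + t *: delta_mx 0 i) =
    pderiv j (pderiv i f) (x + t *: delta_mx 0 i + s *: delta_mx 0 j) * h.
  by apply: mean_value_line => s sh; have [] := df t s th sh.
exists t, s; split=> //.
rewrite expr2 mulrA -Es -(pderiv_translate f) -pderivB; [|exact: df2|exact: df1].
rewrite -Et /G [x + _ + _ *: delta_mx 0 j]addrAC; ring.
Qed.

Lemma near_continuous2 O f g x (e : R) : open O -> O x ->
  {for x, continuous f} -> {for x, continuous g} -> 0 < e ->
  exists2 r : R, 0 < r & forall y, ball x r y ->
    [/\ O y, `|f x - f y| <= e & `|g x - g y| <= e].
Proof.
move=> oO Ox /cvgrPdist_le cf /cvgrPdist_le cg e0.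
have /nbhs_ballP[r /= r0 xr] : nbhs x (O `&` ([set y | `|f x - f y| <= e]
    `&` [set y | `|g x - g y| <= e])).
  by apply: filterI; [exact: open_nbhs_nbhs|apply: filterI; [exact: cf|exact: cg]].
by exists r => // y /xr[? []].
Qed.

(** The same second difference is a value of either mixed derivative at some point near [x]; by
    continuity the two mixed derivatives at [x] differ by less than any [e]. *)
Lemma pderivC O f i j x : open O -> smooth_on O f -> O x ->
  pderiv i (pderiv j f) x = pderiv j (pderiv i f) x.
Proof.
move=> oO sf Ox; apply/eqP; rewrite -subr_eq0 -normr_le0; apply/ler_addgt0Pr => e e0.
rewrite add0r.
have e2 : 0 < e / 2 by rewrite divr_gt0.
have cF : {for x, continuous (pderiv i (pderiv j f))}.
  by apply: differentiable_continuous; exact: (sf [:: i; j]).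
have cG : {for x, continuous (pderiv j (pderiv i f))}.
  by apply: differentiable_continuous; exact: (sf [:: j; i]).
have [r r0 H] := near_continuous2 oO Ox cF cG e2.
(* Two steps of length [h] stay inside the ball of radius [r]. *)
pose h := r / 3.
have h0 : 0 < h by rewrite divr_gt0.
have inb a b (t s : R) : `|t| <= `|h| -> `|s| <= `|h| ->
    ball x r (x + t *: delta_mx 0 a + s *: delta_mx 0 b).
  move=> th sh; rewrite ball_row -addrA opprD addNKr normrN.
  apply: (le_lt_trans (ler_normD _ _)); rewrite !normrZ.
  have D (k : 'I_d) : `|delta_mx 0 k : 'rV[R]_d| <= 1.
    by apply: norm_row_le => // l; rewrite mxE eqxx /=; case: eqP; rewrite ?normr0 ?normr1.
  apply: (@le_lt_trans _ _ (h + h)); last by rewrite /h; lra.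
  by apply: lerD; (apply: le_trans (ler_pM _ _ _ (D _)) _; last by rewrite mulr1 -(gtr0_norm h0)) => //; rewrite gtr0_norm in th sh.
have [|t [s [th sh E]]] := @second_difference f x i j h.
  move=> t s th sh; have [Oy _ _] := H _ (inb i j t s th sh).
  by split; [exact: (sf [::])|exact: (sf [:: i])].
have [|t' [s' [th' sh' E']]] := @second_difference f x j i h.
  move=> t' s' th' sh'; have [Oy _ _] := H _ (inb j i t' s' th' sh').
  by split; [exact: (sf [::])|exact: (sf [:: j])].
have E3 : f (x + h *: delta_mx 0 j + h *: delta_mx 0 i) - f (x + h *: delta_mx 0 j)
    - f (x + h *: delta_mx 0 i) + f x =
  f (x + h *: delta_mx 0 i + h *: delta_mx 0 j) - f (x + h *: delta_mx 0 i)
    - f (x + h *: delta_mx 0 j) + f x.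
  have -> : x + h *: delta_mx 0 j + h *: delta_mx 0 i =
            x + h *: delta_mx 0 i + h *: delta_mx 0 j :> 'rV[R]_d by rewrite addrAC.
  by rewrite [X in X + f x = _]addrAC.
have h2 : h ^+ 2 != 0 by rewrite expf_neq0// gt_eqF.
have EE := mulIf h2 (etrans (etrans (esym E') E3) E).
have [_ HF _] := H _ (inb j i t' s' th' sh'); have [_ _ HG] := H _ (inb i j t s th sh).
rewrite -EE in HG; move: HF HG; clear.
set a := pderiv i _ x; set b := pderiv j _ x; set m := pderiv i _ _.
move: a b m => a b m HF HG.
have -> : a - b = (a - m) - (b - m) by ring.
apply: (le_trans (ler_normB _ _)); lra.
Qed.

End Schwarz.

(** One mean value theorem per order. The factor 1/n! of Taylor's formula is given up, which does
    not matter where [e] is arbitrarily small. *)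
Lemma taylor_bound (R : realType) (n : nat) (g : nat -> R -> R) (a e : R) :
  (forall j (t : R), (j < n)%N -> `|t| <= a -> is_derive t 1 (g j) (g j.+1 t)) ->
  (forall j, (j < n)%N -> g j 0 = 0) ->
  (forall t, `|t| <= a -> `|g n t| <= e) ->
  forall t, `|t| <= a -> `|g 0%N t| <= e * `|t| ^+ n.
Proof.
elim: n g => [|n IH] g dg g0 gn t ta; first by rewrite expr0 mulr1 gn.
have H s : `|s| <= a -> `|g 1%N s| <= e * `|s| ^+ n.
  apply: (IH (fun j => g j.+1)) => // [j u jn ua|j jn]; first exact: dg.
  exact: g0.
have [s st E] : exists2 s : R, `|s| <= `|t| & g 0%N t - g 0%N 0 = g 1%N s * t.
  by apply: mean_value0 => s st; apply: dg => //; exact: le_trans st ta.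
rewrite g0// subr0 in E; rewrite E normrM exprSr mulrA ler_wpM2r//.
apply: (le_trans (H s (le_trans st ta))).
have e0 : 0 <= e by apply: le_trans (gn t ta).
by rewrite ler_wpM2l// lerXn2r// nnegrE.
Qed.

(** * Division by a coordinate *)

Section Hadamard.
Variables (R : realType) (d : nat) (k : 'I_d).
Implicit Types (i j : 'I_d) (f g : 'rV[R]_d -> R) (O : set 'rV[R]_d) (x y z : 'rV[R]_d).

Definition foot x : 'rV[R]_d := x - x 0 k *: delta_mx 0 k.

(* [quot n f] is [x_k ^- n] times the remainder of order [n] of the Taylor expansion of [f] in the variable [x_k]. *)
Fixpoint quot (n : nat) f x : R :=
  if n is m.+1 then
    if x 0 k == 0 then pderivs (nseq n k) f x / n`!%:R
    else (quot m f x - pderivs (nseq m k) f (foot x) / m`!%:R) / x 0 k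
  else f x.

Lemma foot_coord x i : foot x 0 i = if i == k then 0 else x 0 i.
Proof.
rewrite !mxE eqxx /=; case: (eqVneq i k) => [->|ik]; first by rewrite mulr1 subrr.
by rewrite mulr0 subr0.
Qed.

Lemma foot_coord_diff i x : differentiable (fun y => foot y 0 i) x.
Proof.
under eq_fun do rewrite foot_coord.
by case: eqP => _; [exact: differentiable_cst|exact: differentiable_coord].
Qed.

Lemma pderiv_foot f x j : differentiable f (foot x) ->
  pderiv j (fun y => f (foot y)) x = if j == k then 0 else pderiv j f (foot x).
Proof.
move=> df; rewrite pderiv_chain//; last by move=> i; exact: foot_coord_diff.
have E i : pderiv j (fun y => foot y 0 i) x = if i == k then 0 else (j == i)%:R.
  under eq_fun do rewrite foot_coord.
  by case: eqP => _; [rewrite pderiv_cst|rewrite pderiv_coord].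
rewrite (bigD1 j)//= big1 ?addr0; last first.
  by move=> i ij; rewrite E (eq_sym j) (negbTE ij) if_same mul0r.
by rewrite E eqxx; case: eqP; rewrite ?mul0r ?mul1r.
Qed.

Lemma pderivs_comm_nseq O f n i x : open O -> smooth_on O f -> O x ->
  pderiv i (pderivs (nseq n k) f) x = pderivs (nseq n k) (pderiv i f) x.
Proof.
move=> oO sf; elim: n x => [//|n IH] x Ox /=.
rewrite (pderivC _ _ oO _ Ox); last exact: smooth_on_pderivs.
by apply: (pderiv_eq oO); rewrite ?inE// => y; rewrite inE; exact: IH.
Qed.

Lemma pderivs_nseqSr n f x : pderivs (nseq n k) (pderiv k f) x = pderivs (nseq n.+1 k) f x.
Proof. by rewrite -pderivs_rcons; congr (pderivs _ f x); elim: n => //= n ->. Qed.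

Section Fixed.
Variable O : set 'rV[R]_d.
Hypothesis oO : open O.
Hypothesis footO : forall x, O x -> O (foot x).

(** The gradient of [quot n f]. In direction [k] the product rule applied to [x_k ^- n] times the
    remainder gives two terms, and the Taylor coefficients of order [n] cancel between them. The
    family of all [quot n f] is thus closed under derivation. *)
Definition quot_grad n f i : 'rV[R]_d -> R :=
  if i == k then fun x => quot n (pderiv k f) x - n%:R * quot n.+1 f x
  else quot n (pderiv i f).

Lemma near_coord_neq0 x : x 0 k != 0 -> \forall y \near x, (y : 'rV[R]_d) 0 k != 0.
Proof.
move=> xk; have c : {for x, continuous (fun y : 'rV[R]_d => y 0 k)}.
  by apply: differentiable_continuous; exact: differentiable_coord.
by apply: (cvgr_neq0 _ c).
Qed.

Lemma quot_off n f x : smooth_on O f -> O x -> x 0 k != 0 ->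
  differentiable (quot n f) x /\ forall i, pderiv i (quot n f) x = quot_grad n f i x.
Proof.
move=> sf Ox xk; elim: n => [|n [dn pn]].
  split=> [|i]; first exact: (smooth_on_diff sf).
  by rewrite /quot_grad; case: eqP => [->|//]; rewrite mul0r subr0.
have sfn m : smooth_on O (pderivs (nseq m k) f) by exact: smooth_on_pderivs.
have da : differentiable (pderivs (nseq n k) f) (foot x).
  by apply: (smooth_on_diff (sfn n)); exact: footO.
pose A y := pderivs (nseq n k) f (foot y).
have dA : differentiable A x.
  by apply: differentiable_chain => // i; exact: foot_coord_diff.
pose c := (n`!%:R : R)^-1.
pose E y := (quot n f y - c * A y) * (y 0 k)^-1.
have EH : \forall y \near x, E y = quot n.+1 f y.
  by have := near_coord_neq0 xk; apply: filterS => y yk /=; rewrite (negbTE yk) /E /A mulrC [c * _]mulrC mulrC.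
have dk : differentiable (fun y : 'rV[R]_d => y 0 k) x by exact: differentiable_coord.
have dV : differentiable (fun y : 'rV[R]_d => (y 0 k)^-1) x by exact: differentiableV.
have dcA : differentiable (fun y => c * A y) x by apply: differentiableM => //; exact: differentiable_cst.
have dN : differentiable (fun y => quot n f y - c * A y) x by exact: differentiableB.
split; first by apply: near_eq_differentiable EH _; exact: differentiableM.
move=> i; rewrite -(near_eq_pderiv i EH) /E pderivM// pderivB// pderivZ//.
rewrite pderivV// pderiv_coord pn pderiv_foot//.
rewrite /quot_grad; case: (eqVneq i k) => [_|ik].
  rewrite /= (negbTE xk) /= -/(A x) -/c.
  rewrite !pderivs_nseqSr /=.
  rewrite -!natr1 factS natrM -natr1 [(_ * n`!%:R)^-1]invfM -/c.
  have n1 : n%:R + 1 != 0 :> R by rewrite natr1 pnatr_eq0.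
  set q1 := quot n _ x; set q2 := quot n f x; set a1 := pderiv k _ _; set a := A x.
  by field; rewrite xk n1.
rewrite /= (negbTE xk) (pderivs_comm_nseq _ _ oO)//; last exact: footO.
by rewrite /c; field; rewrite xk pnatr_eq0 -lt0n fact_gt0.
Qed.

Lemma quot_on n f x : x 0 k = 0 -> quot n f x = pderivs (nseq n k) f x / n`!%:R.
Proof. by move=> xk; case: n => [|n] /=; rewrite ?divr1// xk eqxx. Qed.

Lemma quot_taylor n f x : x 0 k != 0 ->
  f x = x 0 k ^+ n * quot n f x
     + (\poly_(m < n) (pderivs (nseq m k) f (foot x) / m`!%:R)).[x 0 k].
Proof.
move=> xk; elim: n => [|n IH].
  by rewrite poly_def big_ord0 horner0 addr0 mul1r.
pose F m := pderivs (nseq m k) f (foot x) / m`!%:R.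
have -> : (\poly_(m < n.+1) F m).[x 0 k] =
    (\poly_(m < n) F m).[x 0 k] + F n * x 0 k ^+ n.
  by rewrite !poly_def big_ord_recr hornerD hornerZ hornerXn.
rewrite {1}IH /= (negbTE xk) -/(F n) exprS -/F.
set P := (\poly_(_ < _) _).[_]; set q := quot n f x; move: (F n) => a.
by field.
Qed.

Lemma norm_foot_line x y (t : R) : x 0 k = 0 -> `|t| <= `|y 0 k| ->
  `|foot y + t *: delta_mx 0 k - x| <= `|y - x|.
Proof.
move=> xk ty; apply: norm_row_le => // i.
rewrite !mxE eqxx /=; case: (eqVneq i k) => [->|ik].
  rewrite !mulr1 subrr add0r xk oppr0 addr0 (le_trans ty)//.
  by have := norm_coord_le (y - x) k; rewrite !mxE xk subr0.
by rewrite !mulr0 addr0 subr0; have := norm_coord_le (y - x) i; rewrite !mxE.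
Qed.

(** On the line through [y] normal to the hyperplane, [f] is compared with its Taylor polynomial at
    the foot of [y], except that the coefficient of degree [n] is taken at [x]. All derivatives of
    the difference below order [n] vanish at the foot and the [n]-th is small, so [taylor_bound]
    applies. *)
Lemma quot_on_continuous n f x : smooth_on O f -> O x -> x 0 k = 0 ->
  {for x, continuous (quot n f)}.
Proof.
move=> sf Ox xk; apply/(@cvgrPdist_le _ _ _ (nbhs x) _) => e e0.
have sfn m : smooth_on O (pderivs (nseq m k) f) by exact: smooth_on_pderivs.
set an := pderivs (nseq n k) f.
have can : {for x, continuous an}.
  by apply: differentiable_continuous; exact: (smooth_on_diff (sfn n)).
have [r r0 H] := near_continuous2 oO Ox can can e0.
have f1 : 1 <= n`!%:R :> R by rewrite ler1n fact_gt0.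
have f0 : 0 < n`!%:R :> R by rewrite ltr0n fact_gt0.
apply/nbhs_ballP; exists r => //= y xy.
rewrite (quot_on _ _ xk) -/an.
case: (eqVneq (y 0 k) 0) => yk.
  rewrite (quot_on _ _ yk) -/an -mulrBl normrM normfV (gtr0_norm f0).
  have [_ h _] := H y xy; rewrite ler_pdivrMr//; apply: (le_trans h).
  by rewrite ler_peMr// ltW.
have inb (t : R) : `|t| <= `|y 0 k| -> ball x r (foot y + t *: delta_mx 0 k).
  move=> ty; move: xy; rewrite !ball_row ![`|x - _|]distrC; apply: le_lt_trans.
  exact: norm_foot_line.
pose p := \poly_(m < n) (pderivs (nseq m k) f (foot y) / m`!%:R)
          + (an x / n`!%:R) *: 'X^n.
have pE m : p`_m = if (m < n)%N then pderivs (nseq m k) f (foot y) / m`!%:R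
                   else if m == n then an x / n`!%:R else 0.
  rewrite /p coefD coef_poly coefZ coefXn.
  case: ltngtP => // mn; rewrite ?mulr0 ?addr0 ?mulr1 ?add0r//.
pose g m (t : R) := pderivs (nseq m k) f (foot y + t *: delta_mx 0 k) - p^`(m).[t].
have := @taylor_bound R n g `|y 0 k| e _ _ _ (y 0 k) (lexx _).
have -> : g 0%N (y 0 k) = y 0 k ^+ n * (quot n f y - an x / n`!%:R).
  have -> : g 0%N (y 0 k) = f (foot y + y 0 k *: delta_mx 0 k) - p.[y 0 k] by [].
  rewrite {1}/foot subrK /p hornerD hornerZ hornerXn {1}(quot_taylor n f yk).
  by set P := (\poly_(_ < _) _).[_]; ring.
rewrite normrM normrX mulrC.
have yk0 : 0 < `|y 0 k| ^+ n by rewrite exprn_gt0// normr_gt0.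
rewrite ler_pM2r// distrC; apply.
- move=> m t mn ty; rewrite /g.
  have [Ot _ _] := H _ (inb t ty).
  have d1 := line_is_derive (smooth_on_diff (sfn m) Ot).
  have d2 : is_derive t 1 (horner p^`(m)) p^`(m.+1).[t].
    by split; [exact: derivable_horner|rewrite -derive1E -derivE derivnS].
  exact: (is_deriveB d1 d2).
- move=> m mn; rewrite /g scale0r addr0 horner_coef0 coef_derivn addn0 pE mn ffactnn.
  by rewrite -[X in _ - X]mulr_natr divfK ?subrr// pnatr_eq0 -lt0n fact_gt0.
move=> t ty; have [_ h _] := H _ (inb t ty).
have pn : p^`(n).[t] = an x.
  rewrite (_ : p^`(n) = (an x)%:P) ?hornerC//; apply/polyP => m.
  rewrite coef_derivn pE coefC ltnNge leq_addr /=.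
  case: m => [|m]; last by rewrite -{2}[n]addn0 eqn_add2l /= mul0rn.
  by rewrite addn0 !eqxx ffactnn -[LHS]mulr_natr divfK// pnatr_eq0 -lt0n fact_gt0.
by rewrite /g pn distrC; exact: h.
Qed.

Lemma quot_continuous n f x : smooth_on O f -> O x -> {for x, continuous (quot n f)}.
Proof.
move=> sf Ox; have [xk|xk] := eqVneq (x 0 k) 0; first exact: quot_on_continuous.
by apply: differentiable_continuous; case: (quot_off n sf Ox xk).
Qed.

(** On the hyperplane, the difference quotient of [quot n f] in direction [k] is by definition
    [quot n.+1 f] at the displaced point, so its limit exists by continuity. In the other directions
    the line stays in the hyperplane, where [quot n f] is a multiple of a derivative of [f]. *)
Lemma quot_is_derive n f i x : smooth_on O f -> O x ->
  is_derive (0 : R) (1 : R) (fun t : R => quot n f (x + t *: delta_mx 0 i)) (quot_grad n f i x).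
Proof.
move=> sf Ox; have [xk|xk] := eqVneq (x 0 k) 0; last first.
  have [df <-] := quot_off n sf Ox xk.
  have := @line_is_derive _ _ (quot n f) x i 0; rewrite scale0r addr0; exact.
have sfn m : smooth_on O (pderivs (nseq m k) f) by exact: smooth_on_pderivs.
rewrite /quot_grad; case: (eqVneq i k) => [->|ik].
  set F := fun t : R => _.
  (* With a = [pderivs (nseq n.+1 k) f x], this is a/n! - n a/(n+1)! = a/(n+1)!. *)
  have -> : quot n (pderiv k f) x - n%:R * quot n.+1 f x = quot n.+1 f x.
    rewrite !(quot_on _ _ xk) pderivs_nseqSr factS natrM invfM.
    have n1 : n.+1%:R != 0 :> R by rewrite pnatr_eq0.
    have f0 : n`!%:R != 0 :> R by rewrite pnatr_eq0 -lt0n fact_gt0.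
    by move: n1; rewrite -natr1 => n1; field; rewrite f0 n1.
  suff C : (fun h : R => h^-1 *: ((F \o shift 0) h%:A - F 0)) @ 0^' --> quot n.+1 f x.
    by split; [apply/cvg_ex; exists (quot n.+1 f x)|exact: cvg_lim].
  have C : (fun h : R => quot n.+1 f (x + h *: delta_mx 0 k)) @ 0^' --> quot n.+1 f x.
    apply: cvg_within_filter.
    have c1 : {for (0 : R), continuous (fun h : R => x + h *: delta_mx 0 k)}.
      by apply: cvgD; [exact: cvg_cst|apply: cvgZr_tmp; exact: cvg_id].
    have c2 : {for x + (0 : R) *: delta_mx 0 k, continuous (quot n.+1 f)}.
      by rewrite scale0r addr0; exact: quot_continuous.
    have : (quot n.+1 f \o (fun h : R => x + h *: delta_mx 0 k)) @ (0 : R) -->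
      quot n.+1 f (x + (0 : R) *: delta_mx 0 k) := continuous_comp c1 c2.
    by rewrite scale0r addr0.
  apply: cvg_trans C; apply: near_eq_cvg; rewrite near_withinE; near=> h => h0.
  rewrite /F /= addr0 [h%:A]mulr1 scale0r addr0.
  rewrite [in LHS]mxE xk add0r !mxE !eqxx mulr1 (negbTE h0).
  have -> : foot (x + h *: delta_mx 0 k) = x.
    by rewrite /foot !mxE !eqxx xk add0r mulr1 addrK.
  by rewrite (quot_on _ _ xk) /= mulrC.
have -> : (fun t : R => quot n f (x + t *: delta_mx 0 i)) =
          (fun t : R => pderivs (nseq n k) f (x + t *: delta_mx 0 i) * n`!%:R^-1).
  apply/funext => t; rewrite quot_on// !mxE xk eqxx /= eq_sym (negbTE ik) mulr0 addr0//.
rewrite (quot_on _ _ xk) -(pderivs_comm_nseq _ _ oO)//.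
have := @line_is_derive _ _ (fun y => pderivs (nseq n k) f y * n`!%:R^-1) x i 0.
have dn : differentiable (pderivs (nseq n k) f) x by exact: (smooth_on_diff (sfn n)).
have -> : x + (0 : R) *: delta_mx 0 i = x by rewrite scale0r addr0.
rewrite pderivM// pderiv_cst mulr0 addr0.
by apply; apply: differentiableM => //; exact: differentiable_cst.
Unshelve. all: by end_near.
Qed.

Lemma quot_grad_continuous n f i x : smooth_on O f -> O x ->
  {for x, continuous (quot_grad n f i)}.
Proof.
move=> sf Ox; rewrite /quot_grad; case: eqP => _; last first.
  by apply: quot_continuous => //; exact: smooth_on_pderiv.
have c1 : {for x, continuous (quot n (pderiv k f))}.
  by apply: quot_continuous => //; exact: smooth_on_pderiv.
have c3 : {for x, continuous (quot n.+1 f)} by exact: quot_continuous.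
have c2 := continuousM (@cst_continuous _ _ (n%:R : R) x) c3.
exact: (continuousB c1 c2).
Qed.

Lemma quot_diff n f x : smooth_on O f -> O x ->
  differentiable (quot n f) x /\ forall i, pderiv i (quot n f) x = quot_grad n f i x.
Proof.
move=> sf Ox; apply: has_grad_differentiable.
apply: (@C1_differentiable _ _ O (quot n f) (quot_grad n f)) => // i y Oy.
  exact: quot_is_derive.
exact: quot_grad_continuous.
Qed.

Lemma quot_smooth n f : smooth_on O f -> smooth_on O (quot n f).
Proof.
move=> sf; apply/smooth_onP => r; elim: r n f sf => [|r IH] n f sf; split=> //.
- by move=> x Ox; case: (quot_diff n sf Ox).
- by move=> x Ox; case: (quot_diff n sf Ox).
move=> i; suff : Cn r O (quot_grad n f i).
  by apply: Cn_eq => // x; rewrite inE => Ox; case: (quot_diff n sf Ox).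
rewrite /quot_grad; case: eqP => _; last by apply: IH; exact: smooth_on_pderiv.
have := CnD oO (IH n _ (smooth_on_pderiv k sf))
  (CnM oO (Cn_cst r O (- n%:R)) (IH n.+1 _ sf)).
by apply: Cn_eq => // x _; rewrite mulNr.
Qed.

End Fixed.

Lemma hadamard_hyperplane O f x : open O -> O x -> x 0 k = 0 -> smooth_on O f ->
  (forall y, O y -> y 0 k = 0 -> f y = 0) ->
  exists V h, [/\ open V, V x, V `<=` O, smooth_on V h &
    forall y, V y -> f y = y 0 k * h y].
Proof.
move=> oO Ox xk sf f0.
have /nbhs_ballP[r /= r0 xr] := open_nbhs_nbhs (conj oO Ox).
(* A ball for the maximum norm centred on the hyperplane is stable under [foot], as the smoothness
   of [quot] requires. *)
exists (ball x r), (quot 1 f).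
have footb y : ball x r y -> ball x r (foot y).
  rewrite !ball_row ![`|x - _|]distrC; apply: le_lt_trans.
  have := @norm_foot_line x y 0 xk; by rewrite scale0r addr0 normr0; apply.
split=> //; [exact: ball_open|exact: ballxx| |].
  by apply: quot_smooth => //; [exact: ball_open|exact: smooth_onW sf].
move=> y xy; have [yk|yk] := eqVneq (y 0 k) 0.
  by rewrite yk mul0r f0//; exact: xr.
rewrite (quot_taylor 1 f yk) expr1 poly_def big_ord1 /= expr0 alg_polyC hornerC.
rewrite (f0 (foot y)) ?mul0r ?addr0//; first exact/xr/footb.
by rewrite foot_coord eqxx.
Qed.

End Hadamard.

(** * Cutoffs and Borel's lemma *)

Section Flat.
Variable R : realType.
Implicit Types (t h : R) (m n : nat).

(* The family [t ^- m * exp (- 1 / t)], extended by 0 to [t <= 0], is closed under derivation. *)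
Definition flat m t : R := if t <= 0 then 0 else (t ^+ m)^-1 * expR (- t^-1).

Lemma flat_le0 m t : t <= 0 -> flat m t = 0.
Proof. by rewrite /flat => ->. Qed.

Lemma flat_gt0E m t : 0 < t -> flat m t = (t ^+ m)^-1 * expR (- t^-1).
Proof. by rewrite /flat leNgt => ->. Qed.

Lemma flat_gt0 m t : 0 < t -> 0 < flat m t.
Proof. by move=> t0; rewrite flat_gt0E// mulr_gt0 ?expR_gt0// invr_gt0 exprn_gt0. Qed.

Lemma flat_ge0 m t : 0 <= flat m t.
Proof. by have [t0|t0] := leP t 0; [rewrite flat_le0|rewrite ltW// flat_gt0]. Qed.

(** The exponential series bounds [expR t^-1] below by its term of degree m+2. The two powers of [t]
    left over make the difference quotient at 0 tend to 0. *)
Lemma flat_bound m t : `|flat m t| <= (m.+2)`!%:R * t ^+ 2.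
Proof.
have [t0|t0] := leP t 0; first by rewrite flat_le0// normr0 mulr_ge0// sqr_ge0.
rewrite flat_gt0E// ger0_norm; last by rewrite mulr_ge0 ?expR_ge0// invr_ge0 exprn_ge0// ltW.
have f0 : 0 < (m.+2)`!%:R :> R by rewrite ltr0n fact_gt0.
have tm : 0 < t ^+ m.+2 by rewrite exprn_gt0.
rewrite expRN -invfM.
have E : (m.+2)`!%:R * t ^+ 2 = (t ^+ m * ((t ^+ m.+2)^-1 / (m.+2)`!%:R))^-1.
  rewrite -addn2 exprD; field.
  by rewrite !gt_eqF ?exprn_gt0// addn2.
rewrite E lef_pV2 ?posrE; last 2 first.
- by rewrite mulr_gt0 ?exprn_gt0// expR_gt0.
- by rewrite mulr_gt0 ?exprn_gt0// divr_gt0// invr_gt0.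
rewrite ler_pM2l ?exprn_gt0//.
have := @expR_ge1Dxn R t^-1 m.+1 (ltW _); rewrite invr_gt0 => /(_ t0).
by rewrite exprVn; apply: le_trans; rewrite lerDr.
Qed.

Lemma flat_is_derive m t : is_derive t 1 (flat m) (flat m.+2 t - m%:R * flat m.+1 t).
Proof.
have [t0|t0|->] := ltgtP t 0.
- rewrite !flat_le0 ?(ltW t0)// mulr0 subr0.
  apply: (@near_eq_is_derive _ _ _ (cst (0 : R)) (flat m) t 1 0).
  near=> s; rewrite flat_le0//; apply: ltW; near: s.
  exact: lt_nbhsl.
- have tn0 : t != 0 by rewrite gt_eqF.
  pose F s : R := (s ^+ m)^-1 * expR (- s^-1).
  apply: (@near_eq_is_derive _ _ _ F (flat m) t 1).
    by near=> s; rewrite flat_gt0E//; near: s; exact: lt_nbhsr.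
  have d1 : is_derive t 1 (fun s : R => (s ^+ m)^-1) (- (t ^+ m) ^- 2 *: (m%:R *: t ^+ m.-1)).
    apply: is_deriveV; first by rewrite expf_neq0.
    by split; [exact: exprn_derivable|rewrite exp_derive// [_ *: 1]mulr1].
  have d2 : is_derive t 1 (fun s : R => - s^-1) (- (- t ^- 2 *: 1)).
    by apply: is_deriveN; apply: is_deriveV.
  have d3 : is_derive t 1 (fun s : R => expR (- s^-1)) (expR (- t^-1) * (t ^- 2)).
    split.
      apply/derivable1_diffP; apply: (@differentiable_comp _ _ _ _ (fun s : R => - s^-1) expR).
        by apply/derivable1_diffP; case: d2.
      exact/derivable1_diffP.
    rewrite -derive1E (@derive1_comp _ (fun s : R => - s^-1) expR)//.
      have -> : (fun s : R => - s^-1)^`()%classic t = t ^- 2.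
        by rewrite derive1E; case: d2 => _ ->; rewrite scaleNr opprK [_ *: 1]mulr1.
      have dE := congr1 (fun g : R -> R => g (- t^-1)) (@derive_expR R).
      by rewrite derive1E [X in X / _]dE.
  apply: (@is_derive_eq _ _ _ F t 1 _ _ (is_deriveM d1 d3)).
  rewrite !flat_gt0E//=.
  case: m {F d1} => [|m]; rewrite /= ?scale0r ?scaler0 ?mul0r ?subr0 ?addr0 /GRing.scale /=.
    by rewrite expr0 invr1; ring.
  have tm : t ^+ m != 0 by rewrite expf_neq0.
  by rewrite !exprS; field; rewrite ?tn0 ?tm.
rewrite !flat_le0// mulr0 subr0.
have f00 : flat m 0 = 0 by rewrite flat_le0.
suff C : (fun h : R => h^-1 *: ((flat m \o shift 0) h%:A - flat m 0)) @ 0^' --> (0 : R).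
  by split; [apply/cvg_ex; exists 0|exact: cvg_lim].
apply/cvgrPdist_le => e e0; rewrite near_withinE.
pose c : R := (m.+2)`!%:R.
have c0 : 0 < c by rewrite ltr0n fact_gt0.
apply/nbhs_ballP; exists (e / c); first by rewrite /= divr_gt0.
move=> h /=; rewrite /ball /= sub0r normrN => he h0.
rewrite addr0 [h%:A]mulr1 f00 subr0 sub0r normrN normrM normfV.
rewrite ler_pdivrMl ?normr_gt0//; apply: (le_trans (flat_bound m h)).
rewrite -/c -[h ^+ 2]ger0_norm ?sqr_ge0// normrX expr2 mulrCA.
by rewrite ler_wpM2l// mulrC -ler_pdivlMr// ltW.
Unshelve. all: by end_near.
Qed.

Lemma flat_derivable m t : derivable (flat m) t 1.
Proof. by case: (flat_is_derive m t). Qed.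

End Flat.

Lemma pderiv_comp1 (R : realType) (d : nat) (i : 'I_d) (f : R -> R) (u : 'rV[R]_d -> R) x a :
  is_derive (u x) 1 f a -> differentiable u x ->
  differentiable (fun y => f (u y)) x /\ pderiv i (fun y => f (u y)) x = a * pderiv i u x.
Proof.
move=> df du.
have dff : differentiable f (u x) by apply/derivable1_diffP; case: df.
split; first exact: (@differentiable_comp _ _ _ _ u f).
rewrite /pderiv !deriveE//; last exact: (@differentiable_comp _ _ _ _ u f).
rewrite (@diff_comp _ _ _ _ u f)//= -[X in 'd f _ X]mulr1 [LHS]linearZ /= mulrC.
by case: df => _ <-; rewrite deriveE.
Qed.

Section Cutoff.
Variables (R : realType) (d : nat).
Implicit Types (O : set 'rV[R]_d) (u v : 'rV[R]_d -> R) (x y : 'rV[R]_d).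

Lemma smooth_on_flat O u m : open O -> smooth_on O u -> smooth_on O (fun x => flat m (u x)).
Proof.
move=> oO su; apply/smooth_onP => n; elim: n m => [|n IH] m.
  split=> // x Ox; have du := smooth_on_diff su Ox.
  by apply: (@differentiable_comp _ _ _ _ u (flat m)) => //; apply/derivable1_diffP; exact: flat_derivable.
have dm x : O x -> differentiable (fun x => flat m (u x)) x.
  move=> Ox; apply: (@differentiable_comp _ _ _ _ u (flat m)) => //; first exact: (smooth_on_diff su).
  by apply/derivable1_diffP; exact: flat_derivable.
split=> // i.
have /smooth_onP/(_ n) Cu := smooth_on_pderiv i su.
have := CnM oO (CnD oO (IH m.+2) (CnM oO (Cn_cst n O (- m%:R)) (IH m.+1))) Cu.
apply: Cn_eq => // x; rewrite inE => Ox.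
have [_ ->] := pderiv_comp1 i (flat_is_derive m (u x)) (smooth_on_diff su Ox).
by rewrite mulNr.
Qed.

(** A smooth step: 0 when [a <= 0], and 1 when [b <= 0 < a]. If [0 < a + b], the two terms of the
    denominator cannot vanish together. *)
Definition ramp (a b : R) : R := flat 0 a / (flat 0 a + flat 0 b).

Lemma ramp_ge0 a b : 0 <= ramp a b.
Proof. by rewrite divr_ge0 ?addr_ge0// flat_ge0. Qed.

Lemma ramp_le1 a b : ramp a b <= 1.
Proof.
have h : 0 <= flat 0 a + flat 0 b by rewrite addr_ge0 ?flat_ge0.
rewrite /ramp; move: h; rewrite le_eqVlt => /orP[/eqP<-|h]; first by rewrite invr0 mulr0.
by rewrite ler_pdivrMr// mul1r lerDl flat_ge0.
Qed.

Lemma ramp_out a b : a <= 0 -> ramp a b = 0.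
Proof. by move=> a0; rewrite /ramp (flat_le0 0 a0) mul0r. Qed.

Lemma ramp_in a b : 0 < a -> b <= 0 -> ramp a b = 1.
Proof.
by move=> a0 b0; rewrite /ramp (flat_le0 0 b0) addr0 divff// gt_eqF// flat_gt0.
Qed.

Lemma smooth_on_ramp O u v : open O -> smooth_on O u -> smooth_on O v ->
  (forall x, O x -> 0 < u x + v x) -> smooth_on O (fun x => ramp (u x) (v x)).
Proof.
move=> oO su sv uv; apply: smooth_on_div => //; try exact: smooth_on_flat.
  by apply: smooth_onD => //; exact: smooth_on_flat.
move=> x Ox; rewrite gt_eqF//.
have [u0|u0] := leP (u x) 0.
  by rewrite ltr_wpDl ?flat_ge0// flat_gt0//; have := uv x Ox; lra.
by rewrite ltr_pwDl ?flat_ge0// flat_gt0.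
Qed.

(** The norm of row vectors is the maximum norm, which is not smooth; the Euclidean distance
    replaces it and dominates it by [sqdist_ge]. *)
Definition sqdist x y : R := \sum_i (y 0 i - x 0 i) ^+ 2.

Lemma smooth_sqdist O x : open O -> smooth_on O (sqdist x).
Proof.
move=> oO; apply: smooth_on_sum => // i _; apply: smooth_onX => //.
by apply: smooth_onB => //; [exact: smooth_on_coord|exact: smooth_on_cst].
Qed.

Lemma sqdist_ge x y : `|y - x| ^+ 2 <= sqdist x y.
Proof.
have s0 : 0 <= sqdist x y by apply: sumr_ge0 => i _; rewrite sqr_ge0.
rewrite -[leRHS]sqr_sqrtr// lerXn2r ?nnegrE ?sqrtr_ge0//.
apply: norm_row_le; first exact: sqrtr_ge0.
move=> j; rewrite -(@ler_pXn2r _ 2) ?nnegrE ?sqrtr_ge0// sqr_sqrtr// -normrX ger0_norm ?sqr_ge0//.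
rewrite !mxE /sqdist (bigD1 j)//= lerDl sumr_ge0// => i _; exact: sqr_ge0.
Qed.

Definition bump x (r : R) y : R := ramp (r ^+ 2 - sqdist x y) (sqdist x y - (r / 2) ^+ 2).

Lemma smooth_bump O x r : open O -> 0 < r -> smooth_on O (bump x r).
Proof.
move=> oO r0; apply: smooth_on_ramp => //.
- by apply: smooth_onB => //; [exact: smooth_on_cst|exact: smooth_sqdist].
- by apply: smooth_onB => //; [exact: smooth_sqdist|exact: smooth_on_cst].
by move=> y _; rewrite addrA subrK; nra.
Qed.

Lemma bump_out x r y : 0 < r -> r <= `|y - x| -> bump x r y = 0.
Proof.
move=> r0 ry; apply: ramp_out; rewrite subr_le0 (le_trans _ (sqdist_ge _ _))//.
by rewrite lerXn2r ?nnegrE// ltW.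
Qed.

Lemma bump_in x r : 0 < r -> \forall y \near x, bump x r y = 1.
Proof.
move=> r0; have c : {for x, continuous (sqdist x)}.
  apply: differentiable_continuous.
  by apply: (smooth_on_diff (@smooth_sqdist setT x openT)).
have xx : sqdist x x = 0 by rewrite /sqdist big1// => i _; rewrite subrr expr0n.
have /cvgrPdist_lt/(_ ((r / 2) ^+ 2)) := c; rewrite exprn_gt0 ?divr_gt0// => /(_ isT).
apply: filterS => y; rewrite xx sub0r normrN => H.
have := le_lt_trans (ler_norm _) H => H'.
by apply: ramp_in; [nra|rewrite subr_le0 ltW].
Qed.

End Cutoff.

(** * Derivatives of multiples of a power of a function *)

Section PderivsAlgebra.
Variables (R : realType) (d : nat).
Implicit Types (i : 'I_d) (f g s u w q : 'rV[R]_d -> R) (O : set 'rV[R]_d) (x y : 'rV[R]_d).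

Lemma pderivsD O f g a x : open O -> smooth_on O f -> smooth_on O g -> O x ->
  pderivs a (fun y => f y + g y) x = pderivs a f x + pderivs a g x.
Proof.
move=> oO sf sg; elim: a x => [//|i a IH] x Ox /=.
rewrite (pderiv_eq oO (g := fun y => pderivs a f y + pderivs a g y)) ?inE//; last first.
  by move=> y; rewrite inE; exact: IH.
by rewrite pderivD//; apply: smooth_on_diff Ox; exact: smooth_on_pderivs.
Qed.

Lemma pderivs_cst a (c : R) x : a != [::] -> pderivs a (fun=> c) x = 0.
Proof.
elim/last_ind: a => [//|a i _] _; rewrite pderivs_rcons.
rewrite (_ : pderiv i _ = fun=> 0); last by apply/funext => y; rewrite pderiv_cst.
elim: a x => [//|j a IH] x /=.
by rewrite (_ : pderivs a _ = fun=> 0) ?pderiv_cst//; apply/funext.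
Qed.

Lemma pderivs_sum O (n m : nat) (F : nat -> 'rV[R]_d -> R) a x :
  open O -> (forall j, smooth_on O (F j)) -> O x ->
  pderivs a (fun y => \sum_(n <= j < m) F j y) x = \sum_(n <= j < m) pderivs a (F j) x.
Proof.
move=> oO sF; elim: a x => [//|i a IH] x Ox /=.
rewrite (pderiv_eq oO (g := fun y => \sum_(n <= j < m) pderivs a (F j) y)) ?inE//; last first.
  by move=> y; rewrite inE; exact: IH.
by rewrite pderiv_bigsum// => j _; apply: smooth_on_diff Ox; exact: smooth_on_pderivs.
Qed.

Lemma pderiv_pow_mul O s f m i x : smooth_on O s -> smooth_on O f -> O x ->
  pderiv i (fun y => s y ^+ m.+1 * f y) x =
  s x ^+ m * (m.+1%:R * pderiv i s x * f x + s x * pderiv i f x).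
Proof.
move=> ss sf Ox; have ds := smooth_on_diff ss Ox.
rewrite pderivM//; [|exact: differentiable_exp|exact: (smooth_on_diff sf)].
by rewrite pderivX// [m.+1.-1]/= exprS; ring.
Qed.

(** Each derivative removes at most one factor [s]. *)
Lemma pderivs_pow_mul0 O s f m a x : open O -> smooth_on O s -> smooth_on O f -> O x ->
  s x = 0 -> (size a < m)%N -> pderivs a (fun y => s y ^+ m * f y) x = 0.
Proof.
move=> oO ss sf Ox sx0; elim/last_ind: a m f sf => [|a i IH] m f sf.
  by case: m => // m _; rewrite /= sx0 exprS !mul0r.
rewrite size_rcons; case: m => // m am; rewrite pderivs_rcons.
pose g y := m.+1%:R * pderiv i s y * f y + s y * pderiv i f y.
have sg : smooth_on O g.
  apply: smooth_onD => //; apply: smooth_onM => //; try exact: smooth_on_pderiv.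
  by apply: smooth_onM => //; [exact: smooth_on_cst|exact: smooth_on_pderiv].
rewrite (pderivs_eq oO (g := fun y => s y ^+ m * g y)) ?inE//; first exact: IH.
by move=> y; rewrite inE => Oy; rewrite (pderiv_pow_mul _ _ ss sf Oy).
Qed.

(** At a zero of [s], only the terms survive in which every derivative falls on its own factor [s].
    This recovers [f] on the zero set from [s ^+ m * f] wherever [s] is regular. *)
Lemma pderivs_pow_mul_top O s f m i x : open O -> smooth_on O s -> smooth_on O f -> O x ->
  s x = 0 -> pderivs (nseq m i) (fun y => s y ^+ m * f y) x = m`!%:R * pderiv i s x ^+ m * f x.
Proof.
move=> oO ss sf Ox sx0; elim: m f sf => [|m IH] f sf; first by rewrite /= expr0 !mul1r.
have -> : nseq m.+1 i = rcons (nseq m i) i by elim: (m) => //= n ->.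
rewrite pderivs_rcons; pose g y := m.+1%:R * pderiv i s y * f y + s y * pderiv i f y.
have sg : smooth_on O g.
  apply: smooth_onD => //; apply: smooth_onM => //; try exact: smooth_on_pderiv.
  by apply: smooth_onM => //; [exact: smooth_on_cst|exact: smooth_on_pderiv].
rewrite (pderivs_eq oO (g := fun y => s y ^+ m * g y)) ?inE//; last first.
  by move=> y; rewrite inE => Oy; rewrite (pderiv_pow_mul _ _ ss sf Oy).
by rewrite IH// /g sx0 mul0r addr0 factS natrM exprS; ring.
Qed.

(** As [s] vanishes at [x] and is Lipschitz there, an error of size [s ^+ 2] is negligible against
    the distance to [x]. This makes the derivatives of a Borel sum differentiable on the zero set of
    [s]. *)
Lemma has_grad_perturb w q s x (c : 'I_d -> R) (C : R) :
  has_grad q x c -> differentiable s x -> s x = 0 ->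
  (\forall y \near x, `|w y - q y| <= C * s y ^+ 2) -> has_grad w x c.
Proof.
move=> qc ds sx0 wq e e0.
have wx : w x = q x.
  have := nbhs_singleton wq; rewrite sx0 expr0n mulr0 normr_le0 subr_eq0 => /eqP; exact.
have Lip : exists2 L : R, 0 < L & \forall y \near x, `|s y| <= L * `|y - x|.
  pose L := 1 + \sum_i `|pderiv i s x|.
  have L0 : 0 < L by rewrite ltr_wpDr// sumr_ge0.
  exists L => //; have := differentiable_has_grad ds ltr01; apply: filterS => y.
  rewrite sx0 subr0 mul1r => H.
  have -> : s y = (s y - \sum_i pderiv i s x * (y - x) 0 i) + \sum_i pderiv i s x * (y - x) 0 i.
    by rewrite subrK.
  apply: (le_trans (ler_normD _ _)); rewrite /L mulrDl mul1r lerD//.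
  apply: (le_trans (ler_norm_sum _ _ _)); rewrite mulr_suml; apply: ler_sum => i _.
  by rewrite normrM ler_wpM2l// norm_coord_le.
have [L L0 Ls] := Lip.
have e2 : 0 < e / 2 by rewrite divr_gt0.
pose K := `|C| * L ^+ 2 + 1.
have K0 : 0 < K by rewrite ltr_wpDl// mulr_ge0// sqr_ge0.
have near_small : \forall y \near x, `|y - x| <= e / 2 / K.
  apply/nbhs_ballP; exists (e / 2 / K); first by rewrite /= divr_gt0.
  by move=> y; rewrite ball_row distrC => /ltW.
near=> y.
have H1 : `|w y - q y| <= C * s y ^+ 2 by near: y.
have H2 : `|s y| <= L * `|y - x| by near: y.
have H3 : `|y - x| <= e / 2 / K by near: y.
have H4 : `|q y - q x - \sum_i c i * (y - x) 0 i| <= e / 2 * `|y - x|.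
  by near: y; exact: qc.
rewrite wx; move: H1 H2 H3 H4; set S := \sum_i _; set r := `|y - x| => H1 H2 H3 H4.
have -> : w y - q x - S = (q y - q x - S) + (w y - q y) by ring.
apply: (le_trans (ler_normD _ _)).
have r0 : 0 <= r by rewrite /r.
have H5 : `|w y - q y| <= K * r * r.
  apply: (le_trans H1); apply: (@le_trans _ _ (`|C| * (L * r) ^+ 2)).
    apply: (@le_trans _ _ (`|C| * s y ^+ 2)).
      by rewrite ler_wpM2r ?sqr_ge0// ler_norm.
    rewrite ler_wpM2l// -[s y ^+ 2]ger0_norm ?sqr_ge0// normrX.
    by rewrite lerXn2r ?nnegrE// mulr_ge0// ltW.
  have -> : `|C| * (L * r) ^+ 2 = (`|C| * L ^+ 2) * r * r by ring.
  by rewrite /K; have := mulr_ge0 r0 r0; nra.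
have H6 : K * r <= e / 2 by rewrite mulrC -ler_pdivlMr.
have := ler_wpM2r r0 H6; lra.
Unshelve. all: by end_near.
Qed.

End PderivsAlgebra.

(** * The terms of a Borel sum and their estimate *)

Section Borel.
Variables (R : realType) (d : nat).
Implicit Types (f g s u : 'rV[R]_d -> R) (O : set 'rV[R]_d) (x y : 'rV[R]_d).

Definition pt1 (t : R) : 'rV[R]_1 := const_mx t.

(** A cutoff of one real variable, equal to 1 up to 1/2 and to 0 beyond 1. It lives on row vectors
    of length one so that the calculus of [smooth_on] applies; [cut i] is its [i]-th derivative. *)
Definition cut0 (y : 'rV[R]_1) : R := ramp (1 - y 0 0 ^+ 2) (y 0 0 ^+ 2 - 4^-1).

Definition cut (i : nat) (t : R) : R := pderivs (nseq i 0) cut0 (pt1 t).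

Lemma smooth_cut0 : smooth_on setT cut0.
Proof.
have s1 : smooth_on setT (fun y : 'rV[R]_1 => y 0 0) by apply: smooth_on_coord; exact: openT.
apply: smooth_on_ramp; first exact: openT.
- apply: smooth_onB; first exact: openT.
    exact: smooth_on_cst.
  by apply: smooth_onX => //; exact: openT.
- apply: smooth_onB; first exact: openT.
    by apply: smooth_onX => //; exact: openT.
  exact: smooth_on_cst.
by move=> y _; rewrite addrA subrK; lra.
Qed.

Lemma cut_in (t : R) : `|t| <= 2^-1 -> cut 0 t = 1.
Proof.
move=> t2; have t4 : t ^+ 2 <= 4^-1.
  rewrite -[t ^+ 2]ger0_norm ?sqr_ge0// normrX.
  have -> : 4^-1 = 2^-1 ^+ 2 :> R by rewrite exprVn -natrX.
  by rewrite lerXn2r ?nnegrE.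
rewrite /cut /= /cut0 mxE; apply: ramp_in; first lra.
by rewrite subr_le0.
Qed.

Lemma cut_out i (t : R) : 1 < `|t| -> cut i t = 0.
Proof.
move=> t1; rewrite /cut -[RHS](_ : pderivs (nseq i 0) (fun=> 0) (pt1 t) = 0).
  apply: pderivs_near.
  have c : {for pt1 t, continuous (fun y : 'rV[R]_1 => `|y 0 0|)}.
    apply: continuous_comp; last exact: norm_continuous.
    exact: coord_continuous.
  have t1' : 1 < `|pt1 t 0 0| by rewrite mxE.
  have := near_gt c t1'.
  apply: filterS => y y1; apply: ramp_out; rewrite subr_le0.
  by rewrite -[leRHS]ger0_norm ?sqr_ge0// normrX exprn_ege1// ltW.
elim: i (pt1 t) => [//|i IH] y /=.
by rewrite (_ : pderivs _ _ = fun=> 0) ?pderiv_cst//; apply/funext.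
Qed.

Lemma cut_bounded i : exists C : R, forall t, `|cut i t| <= C.
Proof.
pose K := [set y : 'rV[R]_1 | `|y| <= 1].
have cK : compact K.
  apply: bounded_closed_compact.
    by exists 1; split=> // M M1 y /= yK; exact: le_trans yK (ltW M1).
  rewrite (_ : K = (fun y : 'rV[R]_1 => `|y|) @^-1` [set z | z <= 1])//.
  by apply: closed_comp; [move=> y _; exact: norm_continuous|exact: closed_le].
pose g := pderivs (nseq i 0) cut0.
have cg : continuous g.
  by move=> y; apply: differentiable_continuous; exact: smooth_cut0.
have : bounded_set (g @` K).
  by apply: compact_bounded; apply: continuous_compact => //; exact: continuous_subspaceT.
move=> /ex_strict_bound_gt0[C _ HC]; exists (Num.max C 0) => t.
have [t1|t1] := ltP 1 `|t|; first by rewrite cut_out// normr0 le_max lexx orbT.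
rewrite le_max; apply/orP; left; apply/ltW/HC; exists (pt1 t) => //=.
by apply: norm_row_le => // j; rewrite mxE.
Qed.

Lemma cut_chain O s i (c : R) (j : 'I_d) x : smooth_on O s -> O x ->
  differentiable (fun y => cut i (c * s y)) x /\
  pderiv j (fun y => cut i (c * s y)) x = cut i.+1 (c * s x) * (c * pderiv j s x).
Proof.
move=> ss Ox; have ds := smooth_on_diff ss Ox.
have dF : forall k, differentiable (fun y => pt1 (c * s y) 0 k) x.
  move=> k; under eq_fun do rewrite mxE.
  by apply: differentiableM => //; exact: differentiable_cst.
have dg : differentiable (pderivs (nseq i 0) cut0) (pt1 (c * s x)) by exact: smooth_cut0.
split; first exact: (differentiable_chain dF dg).
rewrite /cut (pderiv_chain _ dF dg) big_ord1 mulrC; congr (_ * _).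
by under [X in pderiv j X]eq_fun do rewrite mxE; rewrite pderivZ.
Qed.

Lemma smooth_cut_comp O s i (c : R) : open O -> smooth_on O s ->
  smooth_on O (fun y => cut i (c * s y)).
Proof.
move=> oO ss; apply: (@smooth_on_comp R d 1 O setT _ (fun y => pt1 (c * s y))) => //.
  move=> j; rewrite (_ : (fun x => _) = fun x => c * s x).
    by apply: smooth_onM => //; exact: smooth_on_cst.
  by apply/funext => y; rewrite mxE.
exact: smooth_on_pderivs smooth_cut0.
Qed.

(** The shape of every term in the derivatives of [s ^+ m * cut 0 (e^-1 * s) * f]. A derivative
    lowers [m], raises [i] or falls on [f], so [m - i] drops by at most one. *)
Definition borel_term s f m i (e : R) y := s y ^+ m * (e ^+ i)^-1 * cut i (e^-1 * s y) * f y.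

Lemma smooth_borel_term O s f m i (e : R) : open O -> smooth_on O s -> smooth_on O f ->
  smooth_on O (borel_term s f m i e).
Proof.
move=> oO ss sf; apply: smooth_onM => //; apply: smooth_onM => //; last exact: smooth_cut_comp.
by apply: smooth_onM => //; [exact: smooth_onX|exact: smooth_on_cst].
Qed.

Lemma pderiv_borel_term O s f m i (e : R) j x : open O -> smooth_on O s -> smooth_on O f -> O x ->
  pderiv j (borel_term s f m.+1 i e) x =
  borel_term s (fun y => m.+1%:R * pderiv j s y * f y) m i e x
  + (borel_term s (fun y => pderiv j s y * f y) m.+1 i.+1 e x
  + borel_term s (pderiv j f) m.+1 i e x).
Proof.
move=> oO ss sf Ox; have ds := smooth_on_diff ss Ox; have df := smooth_on_diff sf Ox.
have [dc pc] := cut_chain i e^-1 j ss Ox.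
have dX : differentiable (fun y => s y ^+ m.+1) x by exact: differentiable_exp.
have dk : differentiable (fun y => s y ^+ m.+1 * (e ^+ i)^-1) x.
  by apply: differentiableM => //; exact: differentiable_cst.
have dl : differentiable (fun y => s y ^+ m.+1 * (e ^+ i)^-1 * cut i (e^-1 * s y)) x.
  by apply: differentiableM.
rewrite /borel_term pderivM// pderivM// pderivM//.
rewrite pderiv_cst pc pderivX// [m.+1.-1]/=.
rewrite [e ^+ i.+1]exprS invfM exprS; ring.
Qed.

(** The cutoff vanishes unless the absolute value of [s] is at most [e], so surplus powers of [s]
    can be traded for powers of [e]. The budget for [m] is one power for each derivative, [i]
    against [e ^- i], two for the factor [s ^+ 2] and one for the factor [e]; compactness of [K]
    bounds the rest. *)
Lemma borel_estimate O K s f m i (a : seq 'I_d) : open O -> K `<=` O -> compact K ->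
  smooth_on O s -> smooth_on O f -> (size a + i + 3 <= m)%N ->
  exists2 C : R, 0 <= C & forall e x, 0 < e -> e <= 1 -> K x ->
    `|pderivs a (borel_term s f m i e) x| <= C * e * s x ^+ 2.
Proof.
move=> oO KO cK ss; elim/last_ind: a m i f => [|a j IH] m i f sf am.
  have [C HC] := cut_bounded i.
  have [C' HC'] : exists C' : R, forall x, K x -> `|f x| <= C'.
    have : bounded_set (f @` K).
      apply: compact_bounded; apply: continuous_compact => //.
      apply: continuous_in_subspaceT => x; rewrite inE => /KO Ox.
      by apply: differentiable_continuous; exact: (smooth_on_diff sf).
    by move=> /ex_strict_bound_gt0[C' _ HC']; exists C' => x Kx; apply/ltW/HC'; exists x.
  exists (`|C| * `|C'|) => [|e x e0 e1 Kx]; first by rewrite mulr_ge0.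
  rewrite /= /borel_term.
  have [es|es] := ltP e `|s x|.
    rewrite cut_out ?mulr0 ?mul0r ?normr0; last first.
      by rewrite normrM normfV (gtr0_norm e0) ltr_pdivlMl// mulr1.
    by apply: mulr_ge0; [rewrite !mulr_ge0// ltW|exact: sqr_ge0].
  have c1 : `|cut i (e^-1 * s x)| <= `|C| by apply: le_trans (ler_norm C).
  have c2 : `|f x| <= `|C'| by apply: le_trans (HC' x Kx) (ler_norm C').
  have c3 : `|s x ^+ m * (e ^+ i)^-1| <= e * s x ^+ 2.
    have ei : 0 < e ^+ i by rewrite exprn_gt0.
    rewrite normrM normfV (gtr0_norm ei) ler_pdivrMr// normrX.
    (* Two powers of [s] are kept, the next i+1 are bounded by the same power of [e], and the
       remaining [n] by 1. *)
    have [n ->] : exists n, m = (2 + i.+1 + n)%N by exists (m - (2 + i.+1))%N; lia.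
    rewrite 2!exprD -[s x ^+ 2]ger0_norm ?sqr_ge0// normrX.
    have -> : e * `|s x| ^+ 2 * e ^+ i = `|s x| ^+ 2 * e ^+ i.+1 * 1 by rewrite (exprS e i); ring.
    apply: ler_pM; rewrite ?mulr_ge0 ?exprn_ge0//; last first.
      by rewrite exprn_ile1// (le_trans es).
    by rewrite ler_wpM2l ?exprn_ge0// lerXn2r// nnegrE// ltW.
  rewrite normrM [X in X * _]normrM.
  have -> : `|C| * `|C'| * e * s x ^+ 2 = e * s x ^+ 2 * `|C| * `|C'| by ring.
  by apply: ler_pM => //; apply: ler_pM.
rewrite size_rcons in am; case: m am => [|m] am; first by rewrite addn3 in am.
have sj := smooth_on_pderiv j ss.
have sf1 : smooth_on O (fun y => m.+1%:R * pderiv j s y * f y).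
  by apply: smooth_onM => //; apply: smooth_onM => //; exact: smooth_on_cst.
have sf2 : smooth_on O (fun y => pderiv j s y * f y) by exact: smooth_onM.
have sf3 := smooth_on_pderiv j sf.
have [|C1 C10 H1] := IH m i _ sf1; first lia.
have [|C2 C20 H2] := IH m.+1 i.+1 _ sf2; first lia.
have [|C3 C30 H3] := IH m.+1 i _ sf3; first lia.
exists (C1 + (C2 + C3)) => [|e x e0 e1 Kx]; first by rewrite !addr_ge0.
have Ox := KO x Kx; rewrite pderivs_rcons.
rewrite (pderivs_eq oO (g := fun x =>
  borel_term s (fun y => m.+1%:R * pderiv j s y * f y) m i e x
  + (borel_term s (fun y => pderiv j s y * f y) m.+1 i.+1 e x
  + borel_term s (pderiv j f) m.+1 i e x))) ?inE//; last first.
  by move=> y; rewrite inE; exact: pderiv_borel_term.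
have st g n k : smooth_on O g -> smooth_on O (borel_term s g n k e) by exact: smooth_borel_term.
rewrite (pderivsD _ oO)//; [|exact: st|by apply: smooth_onD => //; exact: st].
rewrite (pderivsD _ oO)//; [|exact: st|exact: st].
rewrite -mulrA mulrDl; apply: (le_trans (ler_normD _ _)).
apply: lerD; first by rewrite mulrA; exact: H1.
rewrite mulrDl; apply: (le_trans (ler_normD _ _)).
by apply: lerD; rewrite mulrA; [exact: H2|exact: H3].
Qed.

End Borel.

Lemma sum_stable (R : realType) (F : nat -> R) (N M M' : nat) :
  (N <= M)%N -> (N <= M')%N -> (forall j, (M <= j)%N -> F j = 0) ->
  (forall j, (M' <= j)%N -> F j = 0) ->
  \sum_(N <= j < M) F j = \sum_(N <= j < M') F j.
Proof.
move=> NM NM' F0 F0'; wlog MM' : M M' NM NM' F0 F0' / (M <= M')%N => [H|].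
  by have [/H->//|/ltnW /H ->] := leqP M M'.
rewrite [RHS](big_cat_nat NM MM')/= [X in _ + X]big_nat_cond [X in _ + X]big1 ?addr0// => j.
by case/andP=> /andP[/F0].
Qed.

Lemma geometric_half (R : realType) (K M : nat) :
  \sum_(K <= j < M) 2^-1 ^+ j <= 2 :> R.
Proof.
have [KM|MK] := leqP K M; last by rewrite big_geq ?(ltnW MK).
have E : \sum_(0 <= j < M) 2^-1 ^+ j + 2 * 2^-1 ^+ M = 2 :> R.
  elim: (M) => [|m IH]; first by rewrite big_geq// add0r expr0 mulr1.
  by rewrite big_nat_recr//= exprS; lra.
have p n : 0 <= 2^-1 ^+ n :> R by rewrite exprn_ge0.
have : \sum_(K <= j < M) 2^-1 ^+ j <= \sum_(0 <= j < M) 2^-1 ^+ j :> R.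
  by rewrite [leRHS](big_cat_nat (leq0n K) KM)/= lerDr sumr_ge0.
by have := p M; lra.
Qed.

(** * Convergence, smoothness and expansion of a Borel sum *)

Section BorelSum.
Variables (R : realType) (d : nat) (V : set 'rV[R]_d) (s : 'rV[R]_d -> R).
Variables (f : nat -> 'rV[R]_d -> R) (eps : nat -> R).
Hypotheses (oV : open V) (ss : smooth_on V s) (sf : forall j, smooth_on V (f j)).
Hypotheses (eps_gt0 : forall j, 0 < eps j) (eps_le : forall j, eps j <= j.+1%:R^-1).
Implicit Types (i : 'I_d) (x y : 'rV[R]_d) (N M K : nat).

Definition term N j := borel_term s (f j) (j - N) 0 (eps j).

Hypothesis est : forall j N (a : seq 'I_d) x, (size a + N + 3 <= j)%N -> V x ->
  `|pderivs a (term N j) x| <= 2^-1 ^+ j * s x ^+ 2.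

(** The infinite sum of the terms from [N] on, with [s ^+ N] divided out. At each point it is
    finite: as [eps j <= j.+1%:R^-1], the terms beyond the inverse of the absolute value of [s x]
    are cut off. Where [s x = 0] only the term [j = N] can survive, whence the bound [N.+1]. *)
Definition tail N x := \sum_(N <= j < maxn N.+1 (Num.bound `|s x|^-1)) term N j x.

Definition partial N K x := \sum_(N <= j < K) s x ^+ (j - N) * f j x.

Lemma smooth_term N j : smooth_on V (term N j).
Proof. exact: smooth_borel_term. Qed.

Lemma smooth_partial N K : smooth_on V (partial N K).
Proof. by apply: smooth_on_sum => // j _; apply: smooth_onM => //; exact: smooth_onX. Qed.

Lemma term_far N j x : (eps j < `|s x|) -> term N j x = 0.
Proof.
move=> h; rewrite /term /borel_term cut_out ?mulr0 ?mul0r//.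
by rewrite normrM normfV (gtr0_norm (eps_gt0 j)) ltr_pdivlMl// mulr1.
Qed.

Lemma term_near N j x : `|s x| <= eps j / 2 -> term N j x = s x ^+ (j - N) * f j x.
Proof.
move=> h; rewrite /term /borel_term cut_in ?expr0 ?invr1 ?mulr1//.
by rewrite normrM normfV (gtr0_norm (eps_gt0 j)) ler_pdivrMl.
Qed.

Lemma term_zero N j x : s x = 0 -> (N < j)%N -> term N j x = 0.
Proof.
by move=> sx Nj; rewrite /term /borel_term sx expr0n subn_eq0 leqNgt Nj !mul0r.
Qed.

Lemma term_bound N M x (b : R) : 0 < b -> b <= `|s x| -> b^-1 < M%:R ->
  forall j, (M <= j)%N -> term N j x = 0.
Proof.
move=> b0 bs bM j Mj; apply: term_far; apply: (lt_le_trans _ bs).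
apply: (le_lt_trans (eps_le j)); rewrite invf_plt ?posrE//.
by apply: (lt_le_trans bM); rewrite ler_nat (leq_trans Mj).
Qed.

Lemma tailE N M x : (N <= M)%N -> (forall j, (M <= j)%N -> term N j x = 0) ->
  tail N x = \sum_(N <= j < M) term N j x.
Proof.
move=> NM H; apply: sum_stable => //; first by rewrite leq_max leqnSn.
move=> j; rewrite geq_max => /andP[Nj bj].
have [sx|sx] := eqVneq (s x) 0; first exact: term_zero.
have sx0 : 0 < `|s x| by rewrite normr_gt0.
apply: (@term_bound N _ x `|s x| sx0 (lexx _) _ j bj).
by rewrite archi_boundP// invr_ge0.
Qed.

(** Near [x] the absolute value of [s] stays above half its value at [x], so one range of summation
    serves a whole neighbourhood and derivatives can be taken termwise. *)
Lemma tail_off N K x : V x -> s x != 0 -> exists2 M, (K <= M)%N & (N <= M)%N /\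
  \forall y \near x, tail N y = \sum_(N <= j < M) term N j y.
Proof.
move=> Vx sx; pose b := `|s x| / 2.
have b0 : 0 < b by rewrite divr_gt0// normr_gt0.
exists (maxn (maxn K N) (Num.bound b^-1)); first by rewrite !leq_max leqnn.
split; first by rewrite !leq_max leqnn orbT.
have c : {for x, continuous (fun y => `|s y|)}.
  apply: continuous_comp; last exact: norm_continuous.
  by apply: differentiable_continuous; exact: (smooth_on_diff ss).
have bx : b < `|s x| by have : 0 < `|s x| by [rewrite normr_gt0]; rewrite /b; lra.
have := near_gt c bx; apply: filterS => y bsy.
apply: tailE; first by rewrite !leq_max leqnn orbT.
move=> j; rewrite geq_max => /andP[_]; apply: (@term_bound N _ y b b0 (ltW bsy)).
by rewrite archi_boundP// invr_ge0 ltW.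
Qed.

Lemma near_zero K x : V x -> s x = 0 ->
  \forall y \near x, V y /\ forall j, (j < K)%N -> `|s y| <= eps j / 2.
Proof.
move=> Vx sx.
have c : {for x, continuous (fun y => `|s y|)}.
  apply: continuous_comp; last exact: norm_continuous.
  by apply: differentiable_continuous; exact: (smooth_on_diff ss).
elim: K => [|K IH].
  by have := open_nbhs_nbhs (conj oV Vx); apply: filterS => y Vy; split.
have e0 : `|s x| < eps K / 2 by rewrite sx normr0 divr_gt0.
have := near_lt c e0; apply: filterS2 IH => y [Vy H] sy; split=> // j.
by rewrite ltnS leq_eqVlt => /orP[/eqP->|/H//]; exact: ltW.
Qed.

Lemma tail_split N K M x : (N <= K)%N -> (K <= M)%N ->
  (forall j, (j < K)%N -> `|s x| <= eps j / 2) ->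
  \sum_(N <= j < M) term N j x = partial N K x + \sum_(K <= j < M) term N j x.
Proof.
move=> NK KM H; rewrite (big_cat_nat NK KM)/=; congr (_ + _).
rewrite /partial !big_nat; apply: eq_bigr => j /andP[_ jK].
by rewrite term_near// H.
Qed.

(** Near a zero of [s] the first cutoffs equal 1 and produce [partial]; the other terms add up to a
    geometric series times [s ^+ 2]. Points with [s y = 0] are left out because the sum is not known
    to be locally finite there. *)
Lemma tail_diff N a x : V x -> s x = 0 ->
  \forall y \near x, V y /\ (s y != 0 ->
    `|pderivs a (tail N) y - pderivs a (partial N (size a + N + 3)) y| <= 2 * s y ^+ 2).
Proof.
move=> Vx sx; set K := (size a + N + 3)%N.
have NK : (N <= K)%N by rewrite /K -addnA addnCA leq_addr.
have := near_eq_near (near_zero K Vx sx); apply: filterS => y Hy.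
have [Vy _] := nbhs_singleton Hy; split=> // sy.
have [M KM [NM HM]] := tail_off N K Vy sy.
pose rest z := \sum_(K <= j < M) term N j z.
have E : \forall z \near y, tail N z = partial N K z + rest z.
  by apply: filterS2 Hy HM => z [_ Hz] ->; exact: tail_split.
rewrite (pderivs_near a E).
have sr : smooth_on V rest by apply: smooth_on_sum => // j _; exact: smooth_term.
rewrite (pderivsD _ oV (smooth_partial N K) sr Vy) addrC addKr /rest.
rewrite (pderivs_sum _ _ _ oV _ Vy); last by move=> j; exact: smooth_term.
apply: (le_trans (ler_norm_sum _ _ _)).
apply: (@le_trans _ _ (\sum_(K <= j < M) 2^-1 ^+ j * s y ^+ 2)).
  rewrite !big_nat; apply: ler_sum => j /andP[Kj _]; exact: est.
by rewrite -mulr_suml ler_wpM2r ?sqr_ge0// geometric_half.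
Qed.

(** Induction on [a]: the hypothesis and [tail_diff] bound the error by [2 * s ^+ 2] at all points
    near [x], and [has_grad_perturb] passes to one more derivative. *)
Lemma tail_zero N a x : V x -> s x = 0 ->
  pderivs a (tail N) x = pderivs a (partial N (size a + N + 3)) x.
Proof.
elim: a x => [|i a IH] x Vx sx.
  rewrite /= add0n (@tailE N (N + 3)) ?leq_addr//; last first.
    by move=> j Nj; apply: term_zero => //; apply: leq_trans Nj; rewrite addn3 ltnW.
  apply: eq_bigr => j _; apply: term_near; rewrite sx normr0 ltW// divr_gt0//.
have sK := smooth_on_pderivs a (smooth_partial N (size a + N + 3)).
have := differentiable_has_grad (smooth_on_diff sK Vx).
move/(@has_grad_perturb _ _ (pderivs a (tail N)) _ _ _ _ 2)/(_ (smooth_on_diff ss Vx) sx).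
case/(_ _)/has_grad_differentiable.
  have := tail_diff N a Vx sx; apply: filterS => y [Vy H].
  have [sy|] := eqVneq (s y) 0; last exact: H.
  by rewrite IH// subrr normr0 sy expr0n mulr0.
move=> _ /(_ i) /= ->; rewrite addSn addSn.
rewrite -[pderiv i (pderivs a _) x]/(pderivs (i :: a) _ x).
set K := (size a + N + 3)%N.
rewrite -[pderiv i (pderivs a _) x]/(pderivs (i :: a) _ x).
have NK : (N <= K)%N by rewrite /K -addnA addnCA leq_addr.
(* The additional term has the factor [s] to the power [size a + 3], more than the number of
   derivatives taken. *)
have -> : partial N K.+1 = fun y => partial N K y + s y ^+ (K - N) * f K y.
  by apply/funext => y; rewrite /partial big_nat_recr.
rewrite (pderivsD _ oV (smooth_partial N K) _ Vx); last first.
  by apply: smooth_onM => //; exact: smooth_onX.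
rewrite (pderivs_pow_mul0 oV ss (sf K) Vx sx) ?addr0//=.
by rewrite /K -addnA addnCA addnC addnK addn3 ltnS ltnW.
Qed.

Lemma smooth_tail N : smooth_on V (tail N).
Proof.
move=> a x Vx; have [sx|sx] := eqVneq (s x) 0; last first.
  have [M _ [_ HM]] := tail_off N 0 Vx sx.
  have E : \forall y \near x, \sum_(N <= j < M) term N j y = tail N y.
    by apply: filterS HM => y ->.
  apply: (near_eq_differentiable (near_eq_pderivs a E)).
  have st : smooth_on V (fun y => \sum_(N <= j < M) term N j y).
    by apply: smooth_on_sum => // j _; exact: smooth_term.
  exact: (st a x Vx).
have sK := smooth_on_pderivs a (smooth_partial N (size a + N + 3)).
have := differentiable_has_grad (smooth_on_diff sK Vx).
move/(@has_grad_perturb _ _ (pderivs a (tail N)) _ _ _ _ 2)/(_ (smooth_on_diff ss Vx) sx).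
case/(_ _)/has_grad_differentiable => //.
have := tail_diff N a Vx sx; apply: filterS => y [Vy H].
have [sy|] := eqVneq (s y) 0; last exact: H.
by rewrite tail_zero// subrr normr0 sy expr0n mulr0.
Qed.

(** Near a zero of [s] the first [N] cutoffs equal 1, and all later terms share the factor
    [s ^+ N]. *)
Lemma tail_expand N x : V x -> s x = 0 ->
  \forall y \near x, tail 0 y = \sum_(0 <= j < N) s y ^+ j * f j y + s y ^+ N * tail N y.
Proof.
move=> Vx sx; have := near_zero N Vx sx; apply: filterS => y [Vy H].
pose M := maxn N.+1 (Num.bound `|s y|^-1).
have z n j : (n <= N)%N -> (M <= j)%N -> term n j y = 0.
  move=> nN; rewrite geq_max => /andP[Nj bj].
  have [sy|sy] := eqVneq (s y) 0; first by apply: term_zero => //; exact: leq_ltn_trans nN Nj.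
  have sy0 : 0 < `|s y| by rewrite normr_gt0.
  apply: (@term_bound n _ y `|s y| sy0 (lexx _) _ j bj).
  by rewrite archi_boundP// invr_ge0.
have NM : (N <= M)%N by rewrite leq_max leqnSn.
rewrite (@tailE 0 M)//; last by move=> j; exact: z.
rewrite (tail_split (leq0n N) NM H); congr (_ + _).
  by rewrite /partial; apply: eq_bigr => j _; rewrite subn0.
rewrite (@tailE N M)//; last by move=> j; exact: z.
rewrite mulr_sumr !big_nat; apply: eq_bigr => j /andP[Nj _].
by rewrite /term /borel_term subn0 -{1}(subnKC Nj) exprD -!mulrA.
Qed.

End BorelSum.

Lemma compact_cball (R : realType) (d : nat) (x0 : 'rV[R]_d) (r : R) : compact [set y : 'rV[R]_d | `|y - x0| <= r].
Proof.
set K := [set y : 'rV[R]_d | _].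
apply: bounded_closed_compact.
  exists (`|x0| + r); split=> [|M M1 y /= yK]; first exact: num_real.
  apply: le_trans (ltW M1); rewrite -{1}(subrK x0 y) addrC.
  by apply: (le_trans (ler_normD _ _)); rewrite lerD2l.
rewrite (_ : K = (fun y : 'rV[R]_d => `|y - x0|) @^-1` [set z | z <= r])//.
apply: closed_comp; last exact: closed_le.
move=> y _; apply: continuous_comp; last exact: norm_continuous.
by apply: continuousB; [exact: id|exact: cst_continuous].
Qed.

Lemma borel (R : realType) (d : nat) (O : set 'rV[R]_d) (s : 'rV[R]_d -> R)
    (f : nat -> 'rV[R]_d -> R) x0 :
  open O -> O x0 -> smooth_on O s -> (forall j, smooth_on O (f j)) ->
  exists V u, [/\ open V, V x0, V `<=` O, smooth_on V u &
    forall N x, V x -> s x = 0 -> exists W h, [/\ open W, W x, smooth_on W h &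
      forall y, W y -> u y = \sum_(0 <= j < N) s y ^+ j * f j y + s y ^+ N * h y]].
Proof.
move=> oO Ox0 ss sf.
have /nbhs_ballP[r /= r0 xr] := open_nbhs_nbhs (conj oO Ox0).
pose K := [set y : 'rV[R]_d | `|y - x0| <= r / 2].
have KO : K `<=` O.
  by move=> y Ky; apply: xr; rewrite ball_row distrC; apply: le_lt_trans Ky _; rewrite ltr_pdivrMr// ltr_pMr// ltr1n.
have cK : compact K by exact: compact_cball.
(* For fixed [j] only finitely many pairs [(N, a)] satisfy the size condition, so the sum of their
   constants serves for all of them. *)
have H j : exists C : R, 0 <= C /\ forall (N : nat) (a : seq 'I_d), (size a + N + 3 <= j)%N ->
    forall e x, 0 < e -> e <= 1 -> K x ->
    `|pderivs a (borel_term s (f j) (j - N) 0 e) x| <= C * e * s x ^+ 2.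
  have Q (p : 'I_j.+1 * j.-bseq 'I_d) : exists C : R, 0 <= C /\
    ((size p.2 + p.1 + 3 <= j)%N -> forall e x, 0 < e -> e <= 1 -> K x ->
    `|pderivs p.2 (borel_term s (f j) (j - p.1) 0 e) x| <= C * e * s x ^+ 2).
    have [h|h] := leqP (size p.2 + p.1 + 3) j; last by exists 0; split.
    have [|C C0 HC] := @borel_estimate R d O K s (f j) (j - p.1) 0 p.2 oO KO cK ss (sf j).
      by lia.
    by exists C; split.
  have [C HC] := choice Q.
  exists (\sum_p C p); split; first by apply: sumr_ge0 => p _; case: (HC p).
  move=> N a aN e x e0 e1 Kx.
  have Nj : (N < j.+1)%N by lia.
  have aj : (size a <= j)%N by lia.
  have [C0 HCp] := HC (Ordinal Nj, Bseq aj).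
  apply: (le_trans (HCp aN e x e0 e1 Kx)).
  rewrite ler_wpM2r ?sqr_ge0// ler_wpM2r ?(ltW e0)//.
  rewrite (bigD1 (Ordinal Nj, Bseq aj))//= lerDl sumr_ge0// => p _.
  by case: (HC p).
have [C HC] := choice H.
(* The first bound makes the sum locally finite off the zero set, the second turns the estimate of
   the [j]-th term into [2^-1 ^+ j * s ^+ 2]. The added 1 avoids a division by zero. *)
pose eps j := Num.min j.+1%:R^-1 (2^-1 ^+ j / (C j + 1)).
have C1 j : 0 < C j + 1 by rewrite ltr_wpDl//; case: (HC j).
have h2 j : 0 < 2^-1 ^+ j :> R by rewrite exprn_gt0.
have eps0 j : 0 < eps j by rewrite lt_min invr_gt0 ltr0n /= divr_gt0.
have epsle j : eps j <= j.+1%:R^-1 by rewrite ge_min lexx.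
pose V := ball x0 (r / 2).
have VK : V `<=` K by move=> y; rewrite /V ball_row distrC => /ltW.
have oV : open V by apply: ball_open; rewrite divr_gt0.
have VO : V `<=` O by move=> y /VK/KO.
have ssV := smooth_onW VO ss; have sfV j := smooth_onW VO (sf j).
have est j N (a : seq 'I_d) x : (size a + N + 3 <= j)%N -> V x ->
  `|pderivs a (term s f eps N j) x| <= 2^-1 ^+ j * s x ^+ 2.
  move=> aj Vx; have [C0 HCj] := HC j.
  apply: (le_trans (HCj N a aj (eps j) x (eps0 j) _ (VK x Vx))).
    apply: (le_trans (epsle j)); rewrite invf_le1 ?ltr0n//.
    by rewrite ler1n.
  rewrite ler_wpM2r ?sqr_ge0//.
  apply: (@le_trans _ _ ((C j + 1) * eps j)).
    by rewrite ler_wpM2r ?(ltW (eps0 j))// lerDl.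
  by rewrite mulrC -ler_pdivlMr// ge_min lexx orbT.
exists V, (tail s f eps 0); split=> //.
- by apply: ballxx; rewrite divr_gt0.
- exact: smooth_tail.
move=> N x Vx sx.
have E := tail_expand f oV ssV eps0 epsle N Vx sx.
have /nbhs_ballP[r' /= r'0 xr'] : nbhs x (V `&` [set y | tail s f eps 0 y =
   \sum_(0 <= j < N) s y ^+ j * f j y + s y ^+ N * tail s f eps N y]).
  by apply: filterI => //; exact: open_nbhs_nbhs.
exists (ball x r'), (tail s f eps N); split.
- exact: ball_open.
- exact: ballxx.
- by apply: (@smooth_onW _ _ V) => [y /xr'[]//|]; exact: smooth_tail.
by move=> y /xr'[].
Qed.

(** * Curvature under changes of coordinates *)

Section SmoothMatrix.
Variables (R : realType) (d : nat).
Implicit Types (O : set 'rV[R]_d) (x y : 'rV[R]_d).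

Definition smooth_mx (m n : nat) O (A : 'rV[R]_d -> 'M[R]_(m, n)) :=
  forall i j, smooth_on O (fun x => A x i j).

Lemma smooth_det n O (A : 'rV[R]_d -> 'M[R]_n) : open O -> smooth_mx O A ->
  smooth_on O (fun x => \det (A x)).
Proof.
move=> oO sA; apply: smooth_on_sum => // s _; apply: smooth_onM => //.
  exact: smooth_on_cst.
exact: smooth_on_prod.
Qed.

Lemma smooth_invmx n O (A : 'rV[R]_d -> 'M[R]_n) : open O -> smooth_mx O A ->
  (forall x, O x -> A x \in unitmx) -> smooth_mx O (fun x => invmx (A x)).
Proof.
move=> oO sA uA i j.
have s1 : smooth_on O (fun x => (\det (A x))^-1 * cofactor (A x) j i).
  apply: smooth_onM => //.
    apply: smooth_onV => //; first exact: smooth_det.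
    by move=> x Ox; have := uA x Ox; rewrite unitmxE unitfE.
  apply: smooth_onM => //; first exact: smooth_on_cst.
  apply: smooth_det => // a b; under eq_fun do rewrite !mxE; exact: sA.
apply: smooth_on_eq s1 => // x; rewrite inE => Ox.
by rewrite /invmx uA// !mxE.
Qed.

End SmoothMatrix.

Lemma mx_row_sum (R : realType) (m n p : nat) (A : 'M[R]_(m, n)) (B : 'M[R]_(n, p)) i j :
  (A *m B) i j = \sum_k A i k * B k j.
Proof. by rewrite mxE. Qed.

Lemma posdef_unitmx (R : realType) (n : nat) (A : 'M[R]_n) :
  (forall v : 'rV[R]_n, v != 0 -> 0 < (v *m A *m v^T) 0 0) -> A \in unitmx.
Proof.
move=> pA; rewrite -row_free_unit -kermx_eq0; apply: contraT => /rowV0Pn[v /sub_kermxP vA v0].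
by have := pA v v0; rewrite vA mul0mx mxE ltxx.
Qed.

(** * Regularity and symmetry of the Christoffel symbols *)

Section Metric.
Variables (R : realType) (d : nat) (O : set 'rV[R]_d) (G : 'rV[R]_d -> 'M[R]_d).
Hypotheses (oO : open O) (sG : smooth_mx O G)
  (uG : forall x, O x -> G x \in unitmx) (symG : forall x, O x -> (G x)^T = G x).
Implicit Types (i j k l : 'I_d) (u : 'rV[R]_d -> R) (x y : 'rV[R]_d).

Lemma metric_symE i j x : O x -> G x i j = G x j i.
Proof. by move=> Ox; rewrite -{1}(symG Ox) mxE. Qed.

Lemma smooth_christoffel k i j : smooth_on O (christoffel G k i j).
Proof.
apply: smooth_onM => //; first exact: smooth_on_cst.
apply: smooth_on_sum => // l _; apply: smooth_onM => //.
  exact: smooth_invmx.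
by apply: smooth_onB => //; [apply: smooth_onD => //|]; exact: smooth_on_pderiv.
Qed.

Lemma smooth_ricci i j : smooth_on O (ricci G i j).
Proof.
apply: smooth_onD => //.
  apply: smooth_on_sum => // k _; apply: smooth_onB => //; apply: smooth_on_pderiv;
    exact: smooth_christoffel.
apply: smooth_on_sum => // k _; apply: smooth_on_sum => // l _.
by apply: smooth_onB => //; apply: smooth_onM => //; exact: smooth_christoffel.
Qed.

Lemma smooth_scalar_curvature : smooth_on O (scalar_curvature G).
Proof.
apply: smooth_on_sum => // i _; apply: smooth_on_sum => // j _.
by apply: smooth_onM => //; [exact: smooth_invmx|exact: smooth_ricci].
Qed.

Lemma smooth_grad_sqnorm u : smooth_on O u -> smooth_on O (grad_sqnorm G u).
Proof.
move=> su; apply: smooth_on_sum => // i _; apply: smooth_on_sum => // j _.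
apply: smooth_onM => //; first exact: smooth_invmx.
by apply: smooth_onM => //; exact: smooth_on_pderiv.
Qed.

Lemma smooth_laplacian u : smooth_on O u -> smooth_on O (laplacian G u).
Proof.
move=> su; apply: smooth_on_sum => // i _; apply: smooth_on_sum => // j _.
apply: smooth_onM => //; first exact: smooth_invmx.
apply: smooth_onB => //; first by apply: smooth_on_pderiv; exact: smooth_on_pderiv.
apply: smooth_on_sum => // k _; apply: smooth_onM => //; first exact: smooth_christoffel.
exact: smooth_on_pderiv.
Qed.

Lemma smooth_S_curvature u : smooth_on O u -> smooth_on O (S_curvature G u).
Proof.
move=> su; apply: smooth_onB => //; first exact: smooth_grad_sqnorm.
apply: smooth_onM => //; first by apply: smooth_onM => //; exact: smooth_on_cst.
apply: smooth_onD => //; first exact: smooth_laplacian.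
apply: smooth_onM => //; apply: smooth_onM => //; first exact: smooth_scalar_curvature.
exact: smooth_on_cst.
Qed.

Lemma pderiv_metric_sym l i j x : O x ->
  pderiv l (fun y => G y i j) x = pderiv l (fun y => G y j i) x.
Proof.
move=> Ox; apply: (pderiv_eq oO); rewrite ?inE// => y; rewrite inE => Oy.
exact: metric_symE.
Qed.

Lemma christoffel_sym k i j x : O x -> christoffel G k i j x = christoffel G k j i x.
Proof.
move=> Ox; rewrite /christoffel; congr (_ * _); apply: eq_bigr => l _; congr (_ * _).
by rewrite [in LHS](pderiv_metric_sym l i j Ox) [X in X - _]addrC.
Qed.

(** The Christoffel symbols of the first kind. *)
Definition lowered i j l x : R := 2^-1 * (pderiv i (fun y => G y j l) x +
  pderiv j (fun y => G y i l) x - pderiv l (fun y => G y i j) x).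

Lemma christoffelE k i j x : O x ->
  christoffel G k i j x = \sum_l lowered i j l x * invmx (G x) l k.
Proof.
move=> Ox; rewrite /christoffel mulr_sumr; apply: eq_bigr => l _.
have -> : invmx (G x) l k = invmx (G x) k l.
  by rewrite -{1}(symG Ox) -trmx_inv mxE.
by rewrite /lowered; ring.
Qed.

Lemma christoffel_lower i j l x : O x ->
  \sum_k christoffel G k i j x * G x k l = lowered i j l x.
Proof.
move=> Ox; pose v : 'rV[R]_d := \row_l lowered i j l x.
have E k : christoffel G k i j x = (v *m invmx (G x)) 0 k.
  by rewrite christoffelE// mxE; apply: eq_bigr => m _; rewrite mxE.
under eq_bigr do rewrite E.
by rewrite -mx_row_sum -mulmxA mulVmx ?uG// mulmx1 mxE.
Qed.

(** The metric is parallel for its Levi-Civita connection. *)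
Lemma metric_compat k i j x : O x -> pderiv k (fun y => G y i j) x =
  \sum_m (christoffel G m k i x * G x m j + christoffel G m k j x * G x m i).
Proof.
move=> Ox; rewrite big_split/= !christoffel_lower// /lowered.
rewrite (pderiv_metric_sym k j i Ox) (pderiv_metric_sym i k j Ox).
by rewrite (pderiv_metric_sym j k i Ox) (pderiv_metric_sym i j k Ox)
  (pderiv_metric_sym j i k Ox); field.
Qed.

End Metric.

(** * Connection and curvature in matrix form *)

Section MatrixDerivative.
Variables (R : realType) (d : nat).
Implicit Types (O : set 'rV[R]_d) (i j k l : 'I_d) (x y : 'rV[R]_d).

Definition pdm (m n : nat) l (A : 'rV[R]_d -> 'M[R]_(m, n)) x : 'M[R]_(m, n) :=
  \matrix_(i, j) pderiv l (fun y => A y i j) x.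

Lemma pdm_eq (m n : nat) O l (A B : 'rV[R]_d -> 'M[R]_(m, n)) x : open O -> O x ->
  (forall y, O y -> A y = B y) -> pdm l A x = pdm l B x.
Proof.
move=> oO Ox AB; apply/matrixP => i j; rewrite !mxE.
by apply: (pderiv_eq oO); rewrite ?inE// => y; rewrite inE => Oy; rewrite AB.
Qed.

Lemma pdmM (m n p : nat) l (A : 'rV[R]_d -> 'M[R]_(m, n)) (B : 'rV[R]_d -> 'M[R]_(n, p)) x :
  (forall a b, differentiable (fun y => A y a b) x) ->
  (forall a b, differentiable (fun y => B y a b) x) ->
  pdm l (fun y => A y *m B y) x = pdm l A x *m B x + A x *m pdm l B x.
Proof.
move=> dA dB; apply/matrixP => i j; rewrite !mxE.
rewrite -big_split /=; under eq_fun do rewrite mxE.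
rewrite pderiv_bigsum; last by move=> k _; exact: differentiableM.
by apply: eq_bigr => k _; rewrite pderivM// !mxE.
Qed.

Lemma pdmB (m n : nat) l (A B : 'rV[R]_d -> 'M[R]_(m, n)) x :
  (forall a b, differentiable (fun y => A y a b) x) ->
  (forall a b, differentiable (fun y => B y a b) x) ->
  pdm l (fun y => A y - B y) x = pdm l A x - pdm l B x.
Proof.
move=> dA dB; apply/matrixP => i j; rewrite !mxE.
by rewrite -pderivB//; congr pderiv; apply/funext => y; rewrite !mxE.
Qed.

Lemma mx_addE (m n : nat) (A B : 'M[R]_(m, n)) a b : (A + B) a b = A a b + B a b.
Proof. by rewrite mxE. Qed.

Lemma mx_subE (m n : nat) (A B : 'M[R]_(m, n)) a b : (A - B) a b = A a b - B a b.
Proof. by rewrite !mxE. Qed.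

Lemma mx_oppE (m n : nat) (A : 'M[R]_(m, n)) a b : (- A) a b = - A a b.
Proof. by rewrite mxE. Qed.

Lemma pdm_pdm (m n : nat) l i (A : 'rV[R]_d -> 'M[R]_(m, n)) x a b :
  pdm l (pdm i A) x a b = pderiv l (pderiv i (fun y => A y a b)) x.
Proof. by rewrite mxE; congr pderiv; apply/funext => y; rewrite mxE. Qed.

Lemma mx_scaleE (m n : nat) c (A : 'M[R]_(m, n)) a b : (c *: A) a b = c * A a b.
Proof. by rewrite mxE. Qed.

(** The two sides of the hypothesis are the second derivatives of the Jacobian [J] in either order,
    computed from the law d_i J = g_i J - J T_i. The matrix [K] is common to both sides and drops
    out; what remains relates the curvatures of the two connections. *)
Lemma integrability_algebra (dg dg' g g' J T T' K D D' : 'M[R]_d) :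
  dg *m J + g *m (g' *m J - J *m T') - ((g' *m J - J *m T') *m T + J *m (K + D)) =
  dg' *m J + g' *m (g *m J - J *m T) - ((g *m J - J *m T) *m T' + J *m (K + D')) ->
  (dg - dg' + (g *m g' - g' *m g)) *m J = J *m (D - D' + (T *m T' - T' *m T)).
Proof.
move=> E; apply/matrixP => a b; move: E => /(congr1 (fun M : 'M[R]_d => M a b)).
rewrite !(mulmxDl, mulmxDr, mulNmx, mulmxN) !mulmxA !(mx_addE, mx_oppE); lra.
Qed.

Lemma contract_tr (A B : 'M[R]_d) : \sum_i \sum_j A i j * B i j = \tr (A *m B^T).
Proof. by rewrite /mxtrace; apply: eq_bigr => i _; rewrite mxE; apply: eq_bigr => j _; rewrite !mxE. Qed.

(** The contraction is a trace, in which the factors [J] cancel after a cyclic permutation. *)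
Lemma contract_congr (G H J X : 'M[R]_d) : J \in unitmx -> H \in unitmx ->
  G = J *m H *m J^T ->
  \sum_i \sum_j invmx G i j * (J *m X *m J^T) i j = \sum_i \sum_j invmx H i j * X i j.
Proof.
move=> uJ uH ->; rewrite !contract_tr !trmx_mul trmxK.
have uJT : J^T \in unitmx by rewrite unitmx_tr.
have -> : invmx (J *m H *m J^T) = invmx J^T *m invmx H *m invmx J.
  have uP : J *m H *m J^T \in unitmx by rewrite !unitmx_mul uJ uH.
  apply: (can_inj (mulKmx uP)); rewrite mulmxV// !mulmxA mulmxK// mulmxK//.
  by rewrite mulmxV.
by rewrite !mulmxA mulmxKV// -!mulmxA mxtrace_mulC !mulmxA mulmxK.
Qed.

Definition gm (G : 'rV[R]_d -> 'M[R]_d) i x : 'M[R]_d := \matrix_(j, k) christoffel G k j i x.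

Lemma gmE G i j k x : gm G i x j k = christoffel G k j i x.
Proof. by rewrite mxE. Qed.

(** The Riemann tensor as the obstruction to integrating the system d_i X = [gm G i] X, which fixes
    the order of the factors in the commutator. *)
Definition riem G l i x : 'M[R]_d :=
  pdm l (gm G i) x - pdm i (gm G l) x + (gm G i x *m gm G l x - gm G l x *m gm G i x).

Definition ricci_mx (G : 'rV[R]_d -> 'M[R]_d) x : 'M[R]_d := \matrix_(i, j) ricci G i j x.

Definition hess_mx (G : 'rV[R]_d -> 'M[R]_d) u x : 'M[R]_d := \matrix_(i, j) hessian G u i j x.

Lemma ricci_riem O (G : 'rV[R]_d -> 'M[R]_d) i j x : open O -> 
  (forall x, O x -> (G x)^T = G x) -> O x ->
  ricci G i j x = \sum_k riem G k j x i k.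
Proof.
move=> oO symG Ox; rewrite /ricci -big_split; apply: eq_bigr => k _ /=.
have -> : riem G k j x i k = (pdm k (gm G j) x i k - pdm j (gm G k) x i k) +
    ((gm G j x *m gm G k x) i k - (gm G k x *m gm G j x) i k).
  by rewrite /riem mx_addE !mx_subE.
have pE a b c e : pdm a (gm G b) x c e = pderiv a (christoffel G e c b) x.
  by rewrite mxE; congr pderiv; apply/funext => y; rewrite gmE.
congr (_ + _); first by congr (_ - _); apply/esym; exact: pE.
rewrite sumrB; congr (_ - _); rewrite mx_row_sum; apply: eq_bigr => l _; rewrite 2!gmE mulrC.
  by rewrite (christoffel_sym oO symG k k l Ox).
by rewrite (christoffel_sym oO symG k j l Ox).
Qed.

End MatrixDerivative.

(** * Transformation of the curvature under a change of coordinates *)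

Section CoordinateChange.
Variables (R : realType) (d : nat) (O O' : set 'rV[R]_d).
Variables (G H : 'rV[R]_d -> 'M[R]_d) (phi : 'rV[R]_d -> 'rV[R]_d).
Hypotheses (oO : open O) (oO' : open O') (sphi : smooth_map_on O phi)
  (phiO : forall x, O x -> O' (phi x)).
Hypotheses (sG : smooth_mx O G) (uG : forall x, O x -> G x \in unitmx)
  (symG : forall x, O x -> (G x)^T = G x).
Hypotheses (sH : smooth_mx O' H) (uH : forall x, O' x -> H x \in unitmx)
  (symH : forall x, O' x -> (H x)^T = H x).
Implicit Types (i j k l a b c e : 'I_d) (u : 'rV[R]_d -> R) (x y : 'rV[R]_d).

Definition jac x : 'M[R]_d := \matrix_(i, j) pderiv i (fun y => phi y 0 j) x.

Hypothesis GH : forall x, O x -> G x = jac x *m H (phi x) *m (jac x)^T.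

Lemma smooth_jac : smooth_mx O jac.
Proof. by move=> i j; under eq_fun do rewrite mxE; exact: smooth_on_pderiv. Qed.

Lemma jac_unit x : O x -> jac x \in unitmx.
Proof.
move=> Ox; have := uG Ox; rewrite (GH Ox) !unitmx_mul => /andP[/andP[]] //.
Qed.

Lemma pderiv_jac_sym i j c x : O x ->
  pderiv i (fun y => jac y j c) x = pderiv j (fun y => jac y i c) x.
Proof.
move=> Ox; under [in LHS]eq_fun do rewrite mxE; under [in RHS]eq_fun do rewrite mxE.
exact: (pderivC _ _ oO).
Qed.

Lemma phi_diff x : O x -> forall j, differentiable (fun y => phi y 0 j) x.
Proof. by move=> Ox j; exact: (smooth_on_diff (sphi j)). Qed.

Lemma pderiv_pull i (f : 'rV[R]_d -> R) x : O x -> smooth_on O' f ->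
  pderiv i (fun y => f (phi y)) x = \sum_a jac x i a * pderiv a f (phi x).
Proof.
move=> Ox sf; rewrite (pderiv_chain _ (phi_diff Ox)); last exact: (smooth_on_diff sf (phiO Ox)).
by apply: eq_bigr => a _; rewrite mxE.
Qed.

Lemma smooth_pull (f : 'rV[R]_d -> R) : smooth_on O' f -> smooth_on O (fun y => f (phi y)).
Proof. by move=> sf; exact: smooth_on_comp sf phiO. Qed.

(** In the derivative of J H J^T, [T] collects the terms where a Jacobian is differentiated and [D]
    those where [H] is. *)
Let T i j l x := \sum_a \sum_b pderiv i (fun y => jac y j a) x * H (phi x) a b * jac x l b.

Let D i j l x := \sum_a \sum_b \sum_c
  jac x i a * jac x j b * jac x l c * pderiv a (fun y => H y b c) (phi x).

Lemma pderiv_pullback i j l x : O x ->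
  pderiv i (fun y => G y j l) x = T i j l x + T i l j x + D i j l x.
Proof.
move=> Ox.
have E y : O y -> G y j l = \sum_a \sum_b jac y j a * H (phi y) a b * jac y l b.
  move=> Oy; rewrite (GH Oy) mxE; under eq_bigr do rewrite mxE mulr_suml.
  by rewrite exchange_big; apply: eq_bigr => a _; apply: eq_bigr => b _; rewrite !mxE.
rewrite (pderiv_eq oO (g := fun y => \sum_a \sum_b jac y j a * H (phi y) a b * jac y l b)); last 2 first.
- by move=> y; rewrite inE; exact: E.
- by rewrite inE.
have dJ p q : differentiable (fun y => jac y p q) x by exact: (smooth_on_diff (smooth_jac p q)).
have dH p q : differentiable (fun y => H (phi y) p q) x.
  exact: (smooth_on_diff (smooth_pull (sH p q))).
have dJH p q r : differentiable (fun y => jac y p q * H (phi y) q r) x by exact: differentiableM.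
rewrite pderiv_bigsum; last first.
  by move=> a _; apply: differentiable_bigsum => b _; exact: differentiableM.
rewrite /T /D.
have -> : \sum_a \sum_b pderiv i (fun y => jac y l a) x * H (phi x) a b * jac x j b =
   \sum_a \sum_b pderiv i (fun y => jac y l b) x * H (phi x) a b * jac x j a.
  rewrite exchange_big; apply: eq_bigr => a _; apply: eq_bigr => b _.
  by rewrite (metric_symE symH b a (phiO Ox)).
rewrite [\sum_a \sum_b \sum_c _](_ : _ = \sum_b \sum_c \sum_a
  jac x i a * jac x j b * jac x l c * pderiv a (fun y => H y b c) (phi x)); last first.
  by rewrite exchange_big; apply: eq_bigr => b _; rewrite exchange_big.
rewrite -!big_split; apply: eq_bigr => a _ /=.
rewrite pderiv_bigsum; last by move=> b _; exact: differentiableM.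
rewrite -!big_split; apply: eq_bigr => b _ /=.
rewrite pderivM// pderivM// (pderiv_pull i Ox (sH a b)).
rewrite mulrDl mulr_sumr mulr_suml.
rewrite [\sum_c jac x i c * _ * _ * _](_ : _ =
   \sum_c jac x j a * (jac x i c * pderiv c (fun y => H y a b) (phi x)) * jac x l b); last first.
  by apply: eq_bigr => c _; ring.
ring.
Qed.

Lemma lowered_pullback i j l x : O x ->
  lowered G i j l x = \sum_e (pderiv i (fun y => jac y j e) x +
     \sum_a \sum_b jac x i a * jac x j b * christoffel H e a b (phi x)) *
     (H (phi x) *m (jac x)^T) e l.
Proof.
move=> Ox; have Ox' := phiO Ox.
rewrite /lowered !pderiv_pullback//.
(* [T] contains second derivatives of [phi], symmetric in the first two indices. In the cyclic
   combination defining [lowered] everything but [T i j l] therefore cancels. *)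
have Ts p q r : T p q r x = T q p r x.
  by rewrite /T; apply: eq_bigr => a _; apply: eq_bigr => b _; rewrite pderiv_jac_sym.
rewrite (Ts j i l) (Ts l i j) (Ts l j i).
have -> : 2^-1 * (T i j l x + T i l j x + D i j l x + (T i j l x + T j l i x + D j i l x)
    - (T i l j x + T j l i x + D l i j x)) =
  T i j l x + 2^-1 * (D i j l x + D j i l x - D l i j x) by field.
under [in RHS]eq_bigr do rewrite mulrDl.
rewrite big_split; congr (_ + _) => /=.
  rewrite /T; apply: eq_bigr => a _; rewrite mx_row_sum mulr_sumr; apply: eq_bigr => b _.
  by rewrite [_^T _ _]mxE mulrA.
have D2 : D j i l x = \sum_a \sum_b \sum_c
    jac x i a * jac x j b * jac x l c * pderiv b (fun y => H y a c) (phi x).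
  rewrite /D exchange_big; apply: eq_bigr => a _; apply: eq_bigr => b _.
  by apply: eq_bigr => c _; ring.
have D3 : D l i j x = \sum_a \sum_b \sum_c
    jac x i a * jac x j b * jac x l c * pderiv c (fun y => H y a b) (phi x).
  rewrite /D exchange_big; apply: eq_bigr => a _; rewrite exchange_big; apply: eq_bigr => b _.
  by apply: eq_bigr => c _; ring.
rewrite D2 D3 /D.
transitivity (\sum_a \sum_b \sum_c jac x i a * jac x j b * jac x l c * lowered H a b c (phi x)).
  rewrite -big_split -sumrB mulr_sumr; apply: eq_bigr => a _ /=.
  rewrite -big_split -sumrB mulr_sumr; apply: eq_bigr => b _ /=.
  rewrite -big_split -sumrB mulr_sumr; apply: eq_bigr => c _ /=.
  by rewrite /lowered; ring.
under [in RHS]eq_bigr do rewrite mulr_suml.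
rewrite [in RHS]exchange_big; apply: eq_bigr => a _ /=.
under [in RHS]eq_bigr do rewrite mulr_suml.
rewrite [in RHS]exchange_big; apply: eq_bigr => b _ /=.
under eq_bigr do rewrite -(christoffel_lower uH symH a b _ Ox') mulr_sumr.
rewrite exchange_big; apply: eq_bigr => e _ /=.
rewrite mx_row_sum mulr_sumr; apply: eq_bigr => c _.
by rewrite [_^T _ _]mxE; ring.
Qed.

(** The classical transformation law, solved for the second derivatives of [phi]: in this form it is
    a first order system for the Jacobian, whose integrability can be exploited. *)
Lemma christoffel_pullback i j c x : O x ->
  pderiv i (fun y => jac y j c) x = \sum_k christoffel G k i j x * jac x k c -
     \sum_a \sum_b jac x i a * jac x j b * christoffel H c a b (phi x).
Proof.
move=> Ox; apply/eqP; rewrite -subr_eq opprK; apply/eqP.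
pose X : 'rV[R]_d := \row_e (pderiv i (fun y => jac y j e) x +
     \sum_a \sum_b jac x i a * jac x j b * christoffel H e a b (phi x)).
rewrite -[LHS](_ : X 0 c = _); last by rewrite mxE.
have E k : christoffel G k i j x = (X *m (H (phi x) *m (jac x)^T) *m invmx (G x)) 0 k.
  rewrite (christoffelE symG)// mxE; apply: eq_bigr => l _; congr (_ * _).
  by rewrite (lowered_pullback _ _ _ Ox) [RHS]mx_row_sum; apply: eq_bigr => e _; rewrite [X 0 e]mxE.
under eq_bigr do rewrite E.
rewrite -mx_row_sum; congr (_ _ _).
have -> : H (phi x) *m (jac x)^T = invmx (jac x) *m G x.
  by rewrite (GH Ox) -mulmxA mulKmx// jac_unit.
by rewrite -!mulmxA mulKVmx ?uG// ?mulVmx ?mulmx1// jac_unit.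
Qed.

Lemma smooth_gm_G i : smooth_mx O (gm G i).
Proof. by move=> j k; under eq_fun do rewrite mxE; exact: smooth_christoffel. Qed.

Lemma smooth_gm_H i : smooth_mx O' (gm H i).
Proof. by move=> j k; under eq_fun do rewrite mxE; exact: smooth_christoffel. Qed.

(** [TT] is the pulled back connection of [H]. Its derivative splits into [KK], which is symmetric
    in [l] and [i], and [DT], where the connection itself is differentiated. *)
Let TT i y : 'M[R]_d := \sum_a jac y i a *: gm H a (phi y).

Let KK l i x : 'M[R]_d := \sum_a pderiv l (fun y => jac y i a) x *: gm H a (phi x).

Let DT l i x : 'M[R]_d := \sum_a \sum_b (jac x i a * jac x l b) *: pdm b (gm H a) (phi x).

Lemma pdm_jac i x : O x -> pdm i jac x = gm G i x *m jac x - jac x *m TT i x.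
Proof.
move=> Ox; apply/matrixP => j c; rewrite mx_subE 2!mx_row_sum mxE (christoffel_pullback _ _ _ Ox).
congr (_ - _).
  by apply: eq_bigr => k _; rewrite [gm G i x j k]mxE (christoffel_sym oO symG k i j Ox).
rewrite exchange_big; apply: eq_bigr => b _ /=.
rewrite summxE mulr_sumr; apply: eq_bigr => a _.
by rewrite !mxE (christoffel_sym oO' symH c a b (phiO Ox)); ring.
Qed.

Lemma diff_jac x p q : O x -> differentiable (fun y => jac y p q) x.
Proof. by move=> Ox; exact: (smooth_on_diff (smooth_jac p q)). Qed.

Lemma smooth_TT i : smooth_mx O (TT i).
Proof.
move=> p q; under eq_fun do rewrite summxE; apply: smooth_on_sum => // a _.
under eq_fun do rewrite mxE; apply: smooth_onM => //; first exact: smooth_jac.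
exact: (smooth_pull (smooth_gm_H a p q)).
Qed.

Lemma pdm_TT l i x : O x -> pdm l (TT i) x = KK l i x + DT l i x.
Proof.
move=> Ox; rewrite /KK /DT -big_split; apply/matrixP => p q; rewrite summxE mxE.
under eq_fun do rewrite summxE.
have dg a : differentiable (fun y => gm H a (phi y) p q) x.
  exact: (smooth_on_diff (smooth_pull (smooth_gm_H a p q))).
have dj a : differentiable (fun y => jac y i a) x by exact: diff_jac.
rewrite (_ : (fun y => _) = fun y => \sum_a jac y i a * gm H a (phi y) p q); last first.
  by apply/funext => y; apply: eq_bigr => a _; rewrite mxE.
rewrite pderiv_bigsum; last by move=> a _; exact: differentiableM.
apply: eq_bigr => a _; rewrite pderivM// mx_addE summxE mx_scaleE.
rewrite (pderiv_pull l Ox (smooth_gm_H a p q)); congr (_ + _).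
by rewrite mulr_sumr; apply: eq_bigr => b _; rewrite !mxE mulrA.
Qed.

Lemma pdm_pdm_jac l i x : O x ->
  pdm l (pdm i jac) x = pdm l (gm G i) x *m jac x + gm G i x *m (gm G l x *m jac x - jac x *m TT l x)
    - ((gm G l x *m jac x - jac x *m TT l x) *m TT i x + jac x *m (KK l i x + DT l i x)).
Proof.
move=> Ox; rewrite (pdm_eq l oO Ox (pdm_jac i)).
have dg p q : differentiable (fun y => gm G i y p q) x by exact: (smooth_on_diff (smooth_gm_G i p q)).
have dj p q : differentiable (fun y => jac y p q) x by exact: diff_jac.
have dT p q : differentiable (fun y => TT i y p q) x by exact: (smooth_on_diff (smooth_TT i p q)).
have dM (A B : 'rV[R]_d -> 'M[R]_d) : (forall p q, differentiable (fun y => A y p q) x) ->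
    (forall p q, differentiable (fun y => B y p q) x) ->
    forall p q, differentiable (fun y => (A y *m B y) p q) x.
  move=> dA dB p q; under eq_fun do rewrite mxE.
  by apply: differentiable_bigsum => k _; exact: differentiableM.
by rewrite pdmB; [|exact: dM..]; rewrite !pdmM// pdm_TT// !pdm_jac.
Qed.

Lemma pdm_pdm_jac_sym l i x : O x -> pdm l (pdm i jac) x = pdm i (pdm l jac) x.
Proof.
move=> Ox; apply/matrixP => p q; rewrite [LHS]pdm_pdm [RHS]pdm_pdm.
exact: (pderivC _ _ oO (smooth_jac p q) Ox).
Qed.

Lemma riem_pullback l i x : O x ->
  riem G l i x *m jac x = jac x *m \sum_a \sum_b (jac x i a * jac x l b) *: riem H b a (phi x).
Proof.
move=> Ox; have := pdm_pdm_jac_sym l i Ox; rewrite !pdm_pdm_jac//.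
have -> : KK i l x = KK l i x.
  by rewrite /KK; apply: eq_bigr => a _; rewrite (pderiv_jac_sym i l a Ox).
move/integrability_algebra; rewrite /riem => ->; congr (_ *m _).
have E1 : DT i l x = \sum_a \sum_b (jac x i a * jac x l b) *: pdm a (gm H b) (phi x).
  rewrite /DT [LHS]exchange_big /=; apply: eq_bigr => a _; apply: eq_bigr => b _.
  by rewrite [jac x l b * _]mulrC.
have E2 : TT i x *m TT l x =
    \sum_a \sum_b (jac x i a * jac x l b) *: (gm H a (phi x) *m gm H b (phi x)).
  rewrite /TT mulmx_suml; apply: eq_bigr => a _; rewrite mulmx_sumr; apply: eq_bigr => b _.
  by rewrite -scalemxAl -scalemxAr scalerA.
have E3 : TT l x *m TT i x =
    \sum_a \sum_b (jac x i a * jac x l b) *: (gm H b (phi x) *m gm H a (phi x)).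
  rewrite [RHS]exchange_big /TT mulmx_suml; apply: eq_bigr => b _.
  rewrite mulmx_sumr; apply: eq_bigr => a _.
  by rewrite -scalemxAl -scalemxAr scalerA mulrC.
rewrite E1 E2 E3 /DT -!sumrB -big_split; apply: eq_bigr => a _ /=.
rewrite -!sumrB -big_split; apply: eq_bigr => b _ /=.
by rewrite !(scalerDr, scalerN).
Qed.

Lemma ricci_pullback x : O x ->
  ricci_mx G x = jac x *m ricci_mx H (phi x) *m (jac x)^T.
Proof.
move=> Ox; have uJ := jac_unit Ox; apply/matrixP => i j; rewrite mxE (ricci_riem i j oO symG Ox).
pose W k : 'M[R]_d := \sum_a \sum_b (jac x j a * jac x k b) *: riem H b a (phi x).
have E k : riem G k j x i k = \sum_c \sum_a \sum_b \sum_e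
    jac x i c * jac x j a * riem H b a (phi x) c e * (invmx (jac x) e k * jac x k b).
  have -> : riem G k j x = jac x *m W k *m invmx (jac x) by rewrite -riem_pullback// mulmxK.
  rewrite -mulmxA mx_row_sum; apply: eq_bigr => c _.
  rewrite mx_row_sum; under eq_bigr do rewrite /W summxE mulr_suml.
  rewrite exchange_big mulr_sumr; apply: eq_bigr => a _.
  under eq_bigr do rewrite summxE mulr_suml.
  rewrite exchange_big mulr_sumr; apply: eq_bigr => b _.
  rewrite mulr_sumr; apply: eq_bigr => e _; rewrite mx_scaleE; ring.
under eq_bigr do rewrite E.
rewrite -mulmxA mx_row_sum exchange_big; apply: eq_bigr => c _ /=.
rewrite mx_row_sum mulr_sumr exchange_big; apply: eq_bigr => a _ /=.
rewrite [ricci_mx _ _ _ _]mxE (ricci_riem c a oO' symH (phiO Ox)).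
rewrite mulr_suml mulr_sumr exchange_big; apply: eq_bigr => b _ /=.
(* The contracted index carries the product of the inverse Jacobian with the Jacobian, so only
   [e = b] survives. *)
rewrite exchange_big /= (bigD1 b)//= [X in _ + X]big1 ?addr0; last first.
  by move=> e eb; rewrite -mulr_sumr -mx_row_sum mulVmx// [1%:M e b]mxE (negbTE eb) mulr0.
by rewrite -mulr_sumr -mx_row_sum mulVmx// [1%:M b b]mxE eqxx mulr1 [_^T a j]mxE; ring.
Qed.

Lemma scalar_curvature_pullback x : O x -> scalar_curvature G x = scalar_curvature H (phi x).
Proof.
move=> Ox; have := contract_congr (ricci_mx H (phi x)) (jac_unit Ox) (uH (phiO Ox)) (GH Ox).
rewrite -ricci_pullback// /scalar_curvature => E.
transitivity (\sum_i \sum_j invmx (G x) i j * ricci_mx G x i j).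
  by apply: eq_bigr => i _; apply: eq_bigr => j _; rewrite mxE.
by rewrite E; apply: eq_bigr => i _; apply: eq_bigr => j _; rewrite mxE.
Qed.

Lemma hess_pullback u x : smooth_on O' u -> O x ->
  hess_mx G (fun y => u (phi y)) x = jac x *m hess_mx H u (phi x) *m (jac x)^T.
Proof.
move=> su Ox; apply/matrixP => i j; rewrite mxE /hessian.
rewrite (pderiv_eq oO (g := fun y => \sum_a jac y j a * pderiv a u (phi y))); last 2 first.
- by move=> y; rewrite inE => Oy; exact: pderiv_pull.
- by rewrite inE.
have su' a := smooth_on_pderiv a su.
have dj p q : differentiable (fun y => jac y p q) x by exact: diff_jac.
have du a : differentiable (fun y => pderiv a u (phi y)) x.
  exact: (smooth_on_diff (smooth_pull (su' a))).
rewrite pderiv_bigsum; last by move=> a _; exact: differentiableM.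
under eq_bigr do rewrite pderivM// (christoffel_pullback _ _ _ Ox) (pderiv_pull i Ox (su' _)) mulrBl addrAC.
rewrite sumrB big_split /=.
have -> : \sum_a (\sum_k christoffel G k i j x * jac x k a) * pderiv a u (phi x) =
   \sum_k christoffel G k i j x * pderiv k (fun y => u (phi y)) x.
  under eq_bigr do rewrite mulr_suml.
  rewrite exchange_big; apply: eq_bigr => k _ /=.
  by rewrite (pderiv_pull k Ox su) mulr_sumr; apply: eq_bigr => a _; rewrite mulrA.
set A := \sum_k _; set B := \sum_a _; set C := \sum_a _.
have -> : A + B - C - A = B - C by ring.
have -> : C = \sum_a \sum_c \sum_e
    jac x i c * jac x j a * (christoffel H e c a (phi x) * pderiv e u (phi x)).
  rewrite /C; under eq_bigr do rewrite mulr_suml.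
  rewrite exchange_big; under [in RHS]eq_bigr do rewrite exchange_big.
  rewrite [RHS]exchange_big /= exchange_big /=; apply: eq_bigr => e _.
  rewrite exchange_big; apply: eq_bigr => c _.
  by rewrite mulr_suml; apply: eq_bigr => a _; ring.
rewrite mx_row_sum -sumrB; apply: eq_bigr => a _.
rewrite mx_row_sum mulr_sumr mulr_suml -sumrB; apply: eq_bigr => c _.
rewrite [_^T a j]mxE [hess_mx _ _ _ _ _]mxE /hessian -mulr_sumr; ring.
Qed.

Lemma laplacian_pullback u x : smooth_on O' u -> O x ->
  laplacian G (fun y => u (phi y)) x = laplacian H u (phi x).
Proof.
move=> su Ox; have := contract_congr (hess_mx H u (phi x)) (jac_unit Ox) (uH (phiO Ox)) (GH Ox).
rewrite -hess_pullback// /laplacian => E.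
transitivity (\sum_i \sum_j invmx (G x) i j * hess_mx G (fun y => u (phi y)) x i j).
  by apply: eq_bigr => i _; apply: eq_bigr => j _; rewrite [hess_mx _ _ _ _ _]mxE.
by rewrite E; apply: eq_bigr => i _; apply: eq_bigr => j _; rewrite [hess_mx _ _ _ _ _]mxE.
Qed.

Lemma grad_sqnorm_pullback u x : smooth_on O' u -> O x ->
  grad_sqnorm G (fun y => u (phi y)) x = grad_sqnorm H u (phi x).
Proof.
move=> su Ox.
pose X : 'M[R]_d := \matrix_(a, b) (pderiv a u (phi x) * pderiv b u (phi x)).
have := contract_congr X (jac_unit Ox) (uH (phiO Ox)) (GH Ox).
rewrite /grad_sqnorm => E.
transitivity (\sum_i \sum_j invmx (G x) i j * (jac x *m X *m (jac x)^T) i j); last first.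
  by rewrite E; apply: eq_bigr => i _; apply: eq_bigr => j _; rewrite [X i j]mxE.
apply: eq_bigr => i _; apply: eq_bigr => j _; congr (_ * _).
rewrite !(pderiv_pull _ Ox su) mx_row_sum mulr_sumr; apply: eq_bigr => b _.
rewrite mx_row_sum !mulr_suml; apply: eq_bigr => a _.
by rewrite [_^T b j]mxE [X a b]mxE; ring.
Qed.

Lemma S_curvature_pullback u x : smooth_on O' u -> O x ->
  S_curvature G (fun y => u (phi y)) x = S_curvature H u (phi x).
Proof.
move=> su Ox; rewrite /S_curvature (laplacian_pullback su Ox) (grad_sqnorm_pullback su Ox).
by rewrite (scalar_curvature_pullback Ox).
Qed.

End CoordinateChange.

(** * Conformal invariance of S *)

Section SumAlgebra.
Variables (R : realType) (d : nat).
Implicit Types (F A B C V : 'I_d -> R) (i j : 'I_d).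

Lemma sum_rescaled F A B C V (p a b q : R) : p != 0 ->
  \sum_l p * (F l + (a * A l + b * B l - C l * q)) * (p^-1 * V l) =
  \sum_l F l * V l + (a * (\sum_l A l * V l) + b * (\sum_l B l * V l) - q * \sum_l C l * V l).
Proof.
move=> p0; rewrite (mulr_sumr _ _ _ a) (mulr_sumr _ _ _ b) (mulr_sumr _ _ _ q).
rewrite -big_split -sumrB -big_split; apply: eq_bigr => l _ /=.
by field.
Qed.

End SumAlgebra.

(** * Index algebra of the difference of two conformally related connections *)

Section ConformalAlgebra.
(** In the application, at one point, [q] is the metric, [o] the differential of [ln w], [v] its
    gradient, [sq] its squared length, [g] the Christoffel symbols and [c] the difference tensor of
    the two connections. *)
Variables (R : realType) (d : nat) (q : 'I_d -> 'I_d -> R) (o v : 'I_d -> R).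
Variables (g c : 'I_d -> 'I_d -> 'I_d -> R) (sq : R).
Hypotheses (qs : forall i j, q i j = q j i) (gs : forall k i j, g k i j = g k j i).
Hypothesis low : forall i, \sum_k q i k * v k = o i.
Hypothesis cE : forall k i j, c k i j = (i == k)%:R * o j + (j == k)%:R * o i - q i j * v k.
Hypothesis sqE : sq = \sum_k o k * v k.
Implicit Types (i j k l : 'I_d).

Lemma delta_suml (F : 'I_d -> R) j : \sum_i (i == j)%:R * F i = F j.
Proof.
rewrite (bigD1 j)//= eqxx mul1r big1 ?addr0// => i /negbTE ->; exact: mul0r.
Qed.

Lemma delta_sumr (F : 'I_d -> R) j : \sum_i (j == i)%:R * F i = F j.
Proof. by under eq_bigr do rewrite eq_sym; exact: delta_suml. Qed.

Lemma delta_sum_pair (A B C V : 'I_d -> R) (p : R) i j :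
  \sum_k ((i == k)%:R * A k + (j == k)%:R * B k - (C k + p * V k)) =
  A i + B j - \sum_k C k - p * \sum_k V k.
Proof.
rewrite sumrB big_split /= !delta_sumr (big_split _ _ _ C) /= -mulr_sumr; ring.
Qed.

Lemma conformal_tr j : \sum_k c k k j = d%:R * o j.
Proof.
under eq_bigr do rewrite cE eqxx mul1r.
rewrite sumrB big_split /= delta_sumr sumr_const card_ord -mulr_natl.
have -> : \sum_k q k j * v k = o j by rewrite -low; apply: eq_bigr => k _; rewrite qs.
by ring.
Qed.

Lemma conformal_csym k i j : c k i j = c k j i.
Proof. by rewrite !cE (qs i j); ring. Qed.

Variables (i j : 'I_d).

Let E3 : \sum_k \sum_l g k k l * c l i j =
   (\sum_k g k k i) * o j + (\sum_k g k k j) * o i - q i j * \sum_k \sum_l g k k l * v l.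
Proof.
rewrite !mulr_suml mulr_sumr -big_split -sumrB; apply: eq_bigr => k _ /=.
rewrite -(delta_sumr (fun l => g k k l * o j)) -(delta_sumr (fun l => g k k l * o i)).
by rewrite mulr_sumr -big_split -sumrB; apply: eq_bigr => l _ /=; rewrite cE; ring.
Qed.

Let E4 : \sum_k \sum_l c k k l * (g l i j + c l i j) =
   d%:R * (\sum_l g l i j * o l) + d%:R * (2 * (o i * o j) - q i j * sq).
Proof.
rewrite exchange_big /=.
under eq_bigr do rewrite -mulr_suml conformal_tr.
have -> : 2 * (o i * o j) = \sum_l (i == l)%:R * (o l * o j) + \sum_l (j == l)%:R * (o l * o i).
  by rewrite !delta_sumr; ring.
rewrite sqE mulr_sumr -big_split -sumrB !mulr_sumr -big_split; apply: eq_bigr => l _ /=.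
by rewrite cE; ring.
Qed.

Let E5 : \sum_k \sum_l g k j l * c l i k =
   \sum_k g k i j * o k + (\sum_k g k k j) * o i - \sum_k \sum_l g k j l * v l * q i k.
Proof.
rewrite mulr_suml.
have -> : \sum_k g k i j * o k = \sum_k \sum_l (i == l)%:R * (g k j l * o k).
  by apply: eq_bigr => k _; rewrite delta_sumr gs.
have -> : \sum_k g k k j * o i = \sum_k \sum_l (k == l)%:R * (g k j l * o i).
  by apply: eq_bigr => k _; rewrite delta_sumr gs.
rewrite -big_split -sumrB; apply: eq_bigr => k _ /=.
by rewrite -big_split -sumrB; apply: eq_bigr => l _ /=; rewrite cE; ring.
Qed.

Let E6 : \sum_k \sum_l c k j l * g l i k =
   \sum_k g k i j * o k + (\sum_k g k k i) * o j - \sum_k \sum_l g k i l * v l * q j k.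
Proof.
rewrite exchange_big mulr_suml.
have -> : \sum_k g k i j * o k = \sum_k \sum_l (j == l)%:R * (g k i l * o k).
  by apply: eq_bigr => k _; rewrite delta_sumr.
have -> : \sum_k g k k i * o j = \sum_k \sum_l (k == l)%:R * (g k i l * o j).
  by apply: eq_bigr => k _; rewrite delta_sumr gs.
rewrite -big_split -sumrB; apply: eq_bigr => l _ /=.
by rewrite -big_split -sumrB; apply: eq_bigr => k _ /=; rewrite cE; ring.
Qed.

Let inner k : \sum_l c k j l * c l i k =
    (j == k)%:R * (\sum_l o l * c l i k) + o j * c k i k - v k * \sum_l q j l * c l i k.
Proof.
rewrite -(delta_suml (fun l => o j * c l i k)).
rewrite !mulr_sumr -big_split -sumrB; apply: eq_bigr => l _ /=; rewrite [c k j l]cE.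
by move: (c l i k) => z; ring.
Qed.

Let s1 k : \sum_l o l * c l i k = 2 * (o i * o k) - q i k * sq.
Proof.
have -> : 2 * (o i * o k) = \sum_l (i == l)%:R * (o l * o k) + \sum_l (k == l)%:R * (o l * o i).
  by rewrite !delta_sumr; ring.
by rewrite sqE mulr_sumr -big_split -sumrB; apply: eq_bigr => l _ /=; rewrite cE; ring.
Qed.

Let s2 k : \sum_l q j l * c l i k = q i j * o k + q j k * o i - q i k * o j.
Proof.
rewrite -(low j) mulr_sumr (qs i j).
rewrite -(delta_sumr (fun l => q j l * o k)) -(delta_sumr (fun l => q j l * o i)).
by rewrite -big_split -sumrB; apply: eq_bigr => l _ /=; rewrite cE; ring.
Qed.

Let E7 : \sum_k \sum_l c k j l * c l i k = (d%:R + 2) * (o i * o j) - 2 * (q i j * sq).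
Proof.
under eq_bigr do rewrite inner s1 s2.
rewrite sumrB big_split /= delta_sumr -mulr_sumr.
have -> : \sum_k c k i k = d%:R * o i.
  by rewrite -conformal_tr; apply: eq_bigr => k _; exact: conformal_csym.
have -> : \sum_k v k * (q i j * o k + q j k * o i - q i k * o j) =
   q i j * sq + (\sum_k q j k * v k) * o i - (\sum_k q i k * v k) * o j.
  by rewrite sqE mulr_sumr !mulr_suml -big_split -sumrB; apply: eq_bigr => k _ /=; ring.
by rewrite !low; ring.
Qed.

(** The quadratic part of the Ricci formula for [g + c], minus that for [g]. The last two sums are
    not tensorial; in [ricci_conformal] they cancel against the derivatives of the metric contained
    in the derivatives of [c]. *)
Lemma conformal_contraction :
  \sum_k \sum_l g k k l * c l i j + \sum_k \sum_l c k k l * (g l i j + c l i j)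
     - \sum_k \sum_l g k j l * c l i k - \sum_k \sum_l c k j l * (g l i k + c l i k) =
  (d%:R - 2) * (\sum_k g k i j * o k) + (d%:R - 2) * (o i * o j) - (d%:R - 2) * sq * q i j
  - q i j * (\sum_k \sum_l g k k l * v l)
  + (\sum_k \sum_l g k j l * v l * q i k + \sum_k \sum_l g k i l * v l * q j k).
Proof.
have -> : \sum_k \sum_l c k j l * (g l i k + c l i k) =
    \sum_k \sum_l c k j l * g l i k + \sum_k \sum_l c k j l * c l i k.
  rewrite -big_split; apply: eq_bigr => k _ /=.
  by rewrite -big_split; apply: eq_bigr => l _ /=; rewrite mulrDr.
rewrite E3 E4 E5 E6 E7.
set a2 := \sum_k g k i j * o k; set a4 := \sum_k \sum_l g k k l * v l.
set a5 := \sum_k g k k j; set a6 := \sum_k g k k i.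
set a7 := \sum_k \sum_l g k j l * v l * q i k; set a8 := \sum_k \sum_l g k i l * v l * q j k.
clearbody a2 a4 a5 a6 a7 a8; ring.
Qed.

End ConformalAlgebra.

(** * Curvature and S under a rescaling of the metric *)

Section ConformalChange.
Variables (R : realType) (d : nat) (O : set 'rV[R]_d).
Variables (G : 'rV[R]_d -> 'M[R]_d) (w : 'rV[R]_d -> R).
Hypotheses (oO : open O) (sG : smooth_mx O G)
  (uG : forall x, O x -> G x \in unitmx) (symG : forall x, O x -> (G x)^T = G x).
Hypotheses (sw : smooth_on O w) (w0 : forall x, O x -> 0 < w x).
Implicit Types (i j k l m : 'I_d) (u : 'rV[R]_d -> R) (x y : 'rV[R]_d).

Let H x := w x ^+ 2 *: G x.

(* The differential of [ln w] and its gradient. *)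
Let om i x := pderiv i w x / w x.
Let up k x := \sum_l invmx (G x) k l * om l x.

Let sH : smooth_mx O H.
Proof.
by move=> i j; under eq_fun do rewrite mx_scaleE; apply: smooth_onM => //; exact: smooth_onX.
Qed.

Let w_neq0 x : O x -> w x != 0. Proof. by move=> Ox; rewrite gt_eqF// w0. Qed.

Let uH x : O x -> H x \in unitmx.
Proof.
by move=> Ox; rewrite /H unitmxZ ?uG// unitfE expf_neq0// w_neq0.
Qed.

Let symH x : O x -> (H x)^T = H x.
Proof. by move=> Ox; rewrite /H linearZ /= symG. Qed.

Let invH x i j : O x -> invmx (H x) i j = w x ^- 2 * invmx (G x) i j.
Proof.
move=> Ox; rewrite /H invmxZ ?mx_scaleE//.
by rewrite unitmxZ ?uG// unitfE expf_neq0// w_neq0.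
Qed.

Let smooth_om i : smooth_on O (om i).
Proof.
exact: (smooth_on_div oO (smooth_on_pderiv i sw) sw w_neq0).
Qed.

Let smooth_up k : smooth_on O (up k).
Proof.
apply: (smooth_on_sum _ oO) => l _.
exact: (smooth_onM oO (smooth_invmx oO sG uG k l) (smooth_om l)).
Qed.

Let lower_up l x : O x -> \sum_k up k x * G x k l = om l x.
Proof.
move=> Ox; pose v : 'rV[R]_d := \row_i om i x.
have E k : up k x = (v *m invmx (G x)) 0 k.
  rewrite mxE; apply: eq_bigr => i _; rewrite mxE mulrC; congr (_ * _).
  by rewrite -{1}(symG Ox) -trmx_inv mxE.
under eq_bigr do rewrite E.
by rewrite -mx_row_sum -mulmxA mulVmx ?uG// mulmx1 mxE.
Qed.

Lemma christoffel_conformal k i j x : O x ->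
  christoffel H k i j x = christoffel G k i j x +
    ((i == k)%:R * om j x + (j == k)%:R * om i x - G x i j * up k x).
Proof.
move=> Ox; have dw := smooth_on_diff sw Ox.
have dG a b : differentiable (fun y => G y a b) x by exact: (smooth_on_diff (sG a b)).
have pH l a b : pderiv l (fun y => H y a b) x =
    w x ^+ 2 * pderiv l (fun y => G y a b) x + 2 * w x ^+ 2 * om l x * G x a b.
  under eq_fun do rewrite mx_scaleE.
  rewrite pderivM//; last exact: differentiable_exp.
  rewrite pderivX// /om /= expr1; field; exact: w_neq0.
have E l : lowered H i j l x = w x ^+ 2 * (lowered G i j l x +
    (om i x * G x j l + om j x * G x i l - om l x * G x i j)).
  rewrite /lowered (pH i j l) (pH j i l) (pH l i j).
  move: (pderiv i _ x) (pderiv j _ x) (pderiv l _ x) (om i x) (om j x) (om l x) (w x) => *.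
  by field.
rewrite (christoffelE symH)// (christoffelE symG)//.
under eq_bigr do rewrite E invH//.
have w2 : w x ^+ 2 != 0 by rewrite expf_neq0// w_neq0.
rewrite (sum_rescaled (lowered G i j ^~ x) (G x j) (G x i) (om ^~ x) (fun l => invmx (G x) l k) (om i x) (om j x) (G x i j) w2).
rewrite -!mx_row_sum mulmxV ?uG// ![1%:M _ _]mxE.
have -> : \sum_l om l x * invmx (G x) l k = up k x.
  apply: eq_bigr => l _; rewrite mulrC; congr (_ * _).
  by rewrite -{1}(symG Ox) -trmx_inv mxE.
by ring.
Qed.

Let C k i j x := (i == k)%:R * om j x + (j == k)%:R * om i x - G x i j * up k x.

(** For the function [ln w]: the divergence of its gradient, then its covariant Hessian, then the
    squared length of its differential. *)
Let div_up x := \sum_k (pderiv k (up k) x + \sum_l christoffel G k k l x * up l x).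
Let hom i j x := pderiv i (om j) x - \sum_k christoffel G k i j x * om k x.
Let sq x := \sum_k om k x * up k x.

Let om_sym i j x : O x -> pderiv i (om j) x = pderiv j (om i) x.
Proof.
move=> Ox; have dw := smooth_on_diff sw Ox.
have dp a : differentiable (pderiv a w) x by exact: (smooth_on_diff (smooth_on_pderiv a sw)).
have dV : differentiable (fun y => (w y)^-1) x by apply: differentiableV => //; exact: w_neq0.
rewrite /om (pderivM i (dp j) dV) (pderivM j (dp i) dV).
rewrite (pderivV i dw (w_neq0 Ox)) (pderivV j dw (w_neq0 Ox)) (pderivC i j oO sw Ox); ring.
Qed.

Section At.
Variables (i j : 'I_d) (x : 'rV[R]_d).
Hypothesis Ox : O x.

Let so a : differentiable (om a) x.
Proof. exact: (smooth_on_diff (smooth_om a) Ox). Qed.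

Let su a : differentiable (up a) x.
Proof. exact: (smooth_on_diff (smooth_up a) Ox). Qed.

Let dG a b : differentiable (fun y => G y a b) x.
Proof. exact: (smooth_on_diff (sG a b) Ox). Qed.

Let sC a b c : smooth_on O (C a b c).
Proof.
apply: (smooth_onB oO); last exact: (smooth_onM oO (sG b c) (smooth_up a)).
by apply: (smooth_onD oO); apply: (smooth_onM oO) => //; exact: smooth_on_cst.
Qed.

Let sGa a b c : smooth_on O (christoffel G a b c).
Proof. exact: smooth_christoffel. Qed.

Let pC l a b c : pderiv l (christoffel H a b c) x =
    pderiv l (christoffel G a b c) x + pderiv l (C a b c) x.
Proof.
rewrite (pderiv_eq oO (g := fun y => christoffel G a b c y + C a b c y)) ?inE//; last first.
  by move=> y; rewrite inE => Oy; exact: christoffel_conformal.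
by rewrite pderivD//; [exact: (smooth_on_diff (sGa a b c))|exact: (smooth_on_diff (sC a b c))].
Qed.

Let pCE l a b c : pderiv l (C a b c) x = (b == a)%:R * pderiv l (om c) x
    + (c == a)%:R * pderiv l (om b) x
    - (pderiv l (fun y => G y b c) x * up a x + G x b c * pderiv l (up a) x).
Proof.
have d1 b' c' : differentiable (fun y => (b' == a)%:R * om c' y) x.
  by apply: differentiableM => //; exact: differentiable_cst.
rewrite /C pderivB//; last 2 first.
- by apply: differentiableD.
- by apply: differentiableM.
by rewrite pderivD// !pderivZ// pderivM.
Qed.

Let g a b c := christoffel G a b c x.
Let cc a b c := C a b c x.

Let cH a b c : christoffel H a b c x = g a b c + cc a b c.
Proof. exact: christoffel_conformal. Qed.

Let low b : \sum_k G x b k * up k x = om b x.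
Proof.
by rewrite -(lower_up b Ox); apply: eq_bigr => k _; rewrite mulrC (metric_symE symG b k Ox).
Qed.

Let E0 : ricci H i j x = ricci G i j x
   + (\sum_k pderiv k (C k i j) x - \sum_k pderiv j (C k i k) x)
   + (\sum_k \sum_l g k k l * cc l i j + \sum_k \sum_l cc k k l * (g l i j + cc l i j)
     - \sum_k \sum_l g k j l * cc l i k - \sum_k \sum_l cc k j l * (g l i k + cc l i k)).
Proof.
have [r [EG EH]] : exists r : 'I_d -> R, ricci G i j x = \sum_k r k /\
    ricci H i j x = \sum_k (r k + (pderiv k (C k i j) x - pderiv j (C k i k) x)
     + (\sum_l g k k l * cc l i j + \sum_l cc k k l * (g l i j + cc l i j)
     - \sum_l g k j l * cc l i k - \sum_l cc k j l * (g l i k + cc l i k))).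
  eexists; split; first by rewrite /ricci -big_split.
  rewrite /ricci -big_split; apply: eq_bigr => k _ /=.
  rewrite (pC k k i j) (pC j k i k).
  have -> : \sum_l (christoffel H k k l x * christoffel H l i j x -
      christoffel H k j l x * christoffel H l i k x) =
    \sum_l (g k k l * g l i j - g k j l * g l i k) +
    (\sum_l g k k l * cc l i j + \sum_l cc k k l * (g l i j + cc l i j)
     - \sum_l g k j l * cc l i k - \sum_l cc k j l * (g l i k + cc l i k)).
    rewrite -big_split -sumrB -sumrB -big_split /=; apply: eq_bigr => l _.
    rewrite (cH k k l) (cH l i j) (cH k j l) (cH l i k).
    move: (g k k l) (g l i j) (g k j l) (g l i k) (cc k k l) (cc l i j) (cc k j l) (cc l i k) => *.
    by ring.
  move: (\sum_l _) (\sum_l _ + _ - _ - _) (pderiv k _ x) (pderiv j _ x) (pderiv k _ x) (pderiv j _ x) => *.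
  by ring.
by rewrite EH EG big_split /= big_split /= sumrB; congr (_ + _); rewrite sumrB sumrB big_split.
Qed.

Let E1 : \sum_k pderiv k (C k i j) x = pderiv i (om j) x + pderiv j (om i) x
   - \sum_k pderiv k (fun y => G y i j) x * up k x - G x i j * \sum_k pderiv k (up k) x.
Proof.
under eq_bigr do rewrite pCE.
exact: (delta_sum_pair (fun k => pderiv k (om j) x) (fun k => pderiv k (om i) x)
  (fun k => pderiv k (fun y => G y i j) x * up k x) (fun k => pderiv k (up k) x)).
Qed.

Let E2 : \sum_k pderiv j (C k i k) x = d%:R * pderiv j (om i) x.
Proof.
(* The trace of [C] is [d] times [om i] at every point of [O], so the identity is proved before
   differentiating. *)
transitivity (pderiv j (fun y => \sum_k C k i k y) x).
  by rewrite pderiv_bigsum// => k _; exact: (smooth_on_diff (sC k i k)).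
rewrite -pderivZ//; apply: (pderiv_eq oO); rewrite ?inE// => y; rewrite inE => Oy /=.
have lowy b : \sum_k G y b k * up k y = om b y.
  by rewrite -(lower_up b Oy); apply: eq_bigr => k _; rewrite mulrC (metric_symE symG b k Oy).
have qsy a b : G y a b = G y b a by exact: (metric_symE symG).
rewrite -(conformal_tr qsy lowy (c := fun a b e => C a b e y))//.
by apply: eq_bigr => k _; apply: (conformal_csym qsy (o := om ^~ y) (v := up ^~ y) (c := fun a b e => C a b e y)).
Qed.

Let E8 : \sum_k pderiv k (fun y => G y i j) x * up k x =
    \sum_k \sum_l g k j l * up l x * G x i k + \sum_k \sum_l g k i l * up l x * G x j k.
Proof.
rewrite [X in _ = X + _]exchange_big [X in _ = _ + X]exchange_big -big_split /=.
apply: eq_bigr => l _; rewrite (metric_compat oO uG symG l i j Ox) mulr_suml -big_split /=.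
apply: eq_bigr => k _; 
rewrite (metric_symE symG j k Ox) (metric_symE symG i k Ox) -/(g k l i) -/(g k l j).
have -> : g k j l = g k l j by exact: (christoffel_sym oO symG).
have -> : g k i l = g k l i by exact: (christoffel_sym oO symG).
by move: (g k l i) (g k l j) (up l x) (G x k i) (G x k j) => *; ring.
Qed.

Lemma ricci_conformal :
  ricci H i j x = ricci G i j x - (d%:R - 2) * hom i j x + (d%:R - 2) * (om i x * om j x)
   - (d%:R - 2) * sq x * G x i j - G x i j * div_up x.
Proof.
have gs a b e : g a b e = g a e b by exact: (christoffel_sym oO symG).
have qs a b : G x a b = G x b a by exact: (metric_symE symG).
rewrite E0 E1 E2 (conformal_contraction qs gs low (c := cc) (sq := sq x))// E8.
rewrite /hom /div_up big_split /= (om_sym j i Ox).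
have -> : \sum_k christoffel G k i j x * om k x = \sum_k g k i j * om k x by [].
have -> : \sum_k \sum_l christoffel G k k l x * up l x = \sum_k \sum_l g k k l * up l x by [].
move: (pderiv i (om j) x) (\sum_k g k i j * om k x) (\sum_k pderiv k (up k) x)
  (\sum_k \sum_l g k k l * up l x) (\sum_k \sum_l g k j l * up l x * G x i k)
  (\sum_k \sum_l g k i l * up l x * G x j k) (ricci G i j x) (sq x) (om i x) (om j x) (G x i j) => *.
by ring.
Qed.

End At.

Section AtPoint.
Variable x : 'rV[R]_d.
Hypothesis Ox : O x.

Let so a : differentiable (om a) x.
Proof. exact: (smooth_on_diff (smooth_om a) Ox). Qed.

Let su a : differentiable (up a) x.
Proof. exact: (smooth_on_diff (smooth_up a) Ox). Qed.

Let dG a b : differentiable (fun y => G y a b) x.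
Proof. exact: (smooth_on_diff (sG a b) Ox). Qed.

(** Lowering an index commutes with covariant differentiation by [metric_compat]. Consequently the
    trace of the Hessian is the divergence of the gradient, which is [ctr_hom]. *)
Let hom_lower i j : hom i j x =
  \sum_k (pderiv i (up k) x + \sum_m christoffel G k i m x * up m x) * G x k j.
Proof.
rewrite /hom.
have -> : pderiv i (om j) x = \sum_k (pderiv i (up k) x * G x k j +
    up k x * pderiv i (fun y => G y k j) x).
  rewrite (pderiv_eq oO (g := fun y => \sum_k up k y * G y k j)) ?inE//; last first.
    by move=> y; rewrite inE => Oy; rewrite lower_up.
  rewrite pderiv_bigsum; last by move=> k _; apply: differentiableM.
  by apply: eq_bigr => k _; rewrite pderivM.
pose g a b e := christoffel G a b e x; pose gx a b := G x a b.
have E k : pderiv i (fun y => G y k j) x = \sum_m (g m i k * gx m j + g m i j * gx m k).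
  exact: (metric_compat oO uG symG i k j Ox).
have -> : \sum_k (pderiv i (up k) x * G x k j + up k x * pderiv i (fun y => G y k j) x) =
    \sum_k pderiv i (up k) x * gx k j + \sum_k \sum_m up k x * (g m i k * gx m j)
    + \sum_k \sum_m up k x * (g m i j * gx m k).
  rewrite -!big_split; apply: eq_bigr => k _ /=; rewrite E -addrA; congr (_ + _).
  by rewrite -big_split mulr_sumr; apply: eq_bigr => m _ /=; rewrite mulrDr.
have -> : \sum_k \sum_m up k x * (g m i j * gx m k) = \sum_m g m i j * om m x.
  rewrite exchange_big; apply: eq_bigr => m _ /=; rewrite -(lower_up m Ox) mulr_sumr.
  by apply: eq_bigr => k _; rewrite [G x k m](metric_symE symG k m Ox) mulrCA.
rewrite exchange_big /= addrK -big_split; apply: eq_bigr => k _ /=.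
rewrite mulrDl mulr_suml; congr (_ + _); apply: eq_bigr => m _.
by rewrite mulrCA mulrA.
Qed.

Let ctr (A : 'I_d -> 'I_d -> R) := \sum_i \sum_j invmx (G x) i j * A i j.

Let ctr_eq A B : (forall i j, A i j = B i j) -> ctr A = ctr B.
Proof. by move=> AB; apply: eq_bigr => i _; apply: eq_bigr => j _; rewrite AB. Qed.

Let ctrD A B : ctr (fun i j => A i j + B i j) = ctr A + ctr B.
Proof.
rewrite /ctr -big_split; apply: eq_bigr => i _ /=.
by rewrite -big_split; apply: eq_bigr => j _ /=; rewrite mulrDr.
Qed.

Let ctrZ c A : ctr (fun i j => c * A i j) = c * ctr A.
Proof.
rewrite /ctr mulr_sumr; apply: eq_bigr => i _ /=.
by rewrite mulr_sumr; apply: eq_bigr => j _ /=; rewrite mulrCA.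
Qed.

Let ctr_metric : ctr (fun i j => G x i j) = d%:R.
Proof.
rewrite /ctr contract_tr symG// mulVmx ?uG// mxtrace1//.
Qed.

Let ctr_hom : ctr (fun i j => hom i j x) = div_up x.
Proof.
pose D : 'M[R]_d := \matrix_(i, k) (pderiv i (up k) x + \sum_m christoffel G k i m x * up m x).
rewrite (ctr_eq (B := fun i j => (D *m G x) i j)); last first.
  by move=> i j; rewrite hom_lower mxE; apply: eq_bigr => k _; rewrite mxE.
rewrite /ctr contract_tr trmx_mul symG// mulKmx ?uG// mxtrace_tr.
by apply: eq_bigr => i _; rewrite mxE.
Qed.

Let ctr_om (F : 'I_d -> R) : ctr (fun i j => F i * om j x) = \sum_i F i * up i x.
Proof.
rewrite /ctr; apply: eq_bigr => i _; rewrite mulr_sumr; apply: eq_bigr => j _.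
by rewrite mulrCA.
Qed.

Let ctr_sym A : ctr (fun i j => A j i) = ctr A.
Proof.
rewrite /ctr exchange_big; apply: eq_bigr => i _; apply: eq_bigr => j _ /=.
by rewrite -{1}(symG Ox) -trmx_inv mxE.
Qed.

Let ctrH (A : 'I_d -> 'I_d -> R) :
  \sum_i \sum_j invmx (H x) i j * A i j = w x ^- 2 * ctr A.
Proof.
rewrite -ctrZ; apply: eq_bigr => i _; apply: eq_bigr => j _.
by rewrite invH// mulrAC mulrC.
Qed.

Let ric_x : scalar_curvature H x = w x ^- 2 * (scalar_curvature G x
  - 2 * (d%:R - 1) * div_up x - (d%:R - 1) * (d%:R - 2) * sq x).
Proof.
rewrite /scalar_curvature ctrH; congr (_ * _).
rewrite (ctr_eq (B := fun i j => ricci G i j x + (- (d%:R - 2) * hom i j x +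
  ((d%:R - 2) * (om i x * om j x) + (- (d%:R - 2) * sq x - div_up x) * G x i j)))); last first.
  move=> i j; rewrite ricci_conformal//.
  by move: (ricci _ _ _ _) (hom _ _ _) (om _ _) (om _ _) (sq _) (G x _ _) (div_up _) => *; ring.
rewrite (ctrD (fun i j => ricci G i j x)) (ctrD (fun i j => - (d%:R - 2) * hom i j x)).
rewrite (ctrD (fun i j => (d%:R - 2) * (om i x * om j x))).
rewrite (ctrZ _ (fun i j => hom i j x)) (ctrZ _ (fun i j => om i x * om j x)) (ctrZ _ (fun i j => G x i j)).
rewrite ctr_metric ctr_hom ctr_om -/(sq x) /ctr.
move: (\sum_i \sum_j _) (div_up x) (sq x) (d%:R : R) => *; ring.
Qed.

Variable u : 'rV[R]_d -> R.
Hypothesis smu : smooth_on O u.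

Let v y := w y * u y.
Let p := \sum_i pderiv i u x * up i x.

Let du y : O y -> differentiable u y. Proof. exact: smooth_on_diff. Qed.
Let dw y : O y -> differentiable w y. Proof. exact: smooth_on_diff. Qed.
Let dpu i y : O y -> differentiable (pderiv i u) y.
Proof. exact: (smooth_on_diff (smooth_on_pderiv i smu)). Qed.

Let pv i y : O y -> pderiv i v y = w y * (pderiv i u y + u y * om i y).
Proof.
move=> Oy; rewrite /v (pderivM i (dw Oy) (du Oy)) /om.
by move: (w_neq0 Oy); move: (w y) (u y) (pderiv i w y) (pderiv i u y) => *; field.
Qed.

Let ppv i j : pderiv i (pderiv j v) x = w x * (om i x * (pderiv j u x + u x * om j x)
  + pderiv i (pderiv j u) x + pderiv i u x * om j x + u x * pderiv i (om j) x).
Proof.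
rewrite (pderiv_eq oO (g := fun y => w y * (pderiv j u y + u y * om j y))) ?inE//; last first.
  by move=> y; rewrite inE => Oy; exact: pv.
have d1 : differentiable (fun y => u y * om j y) x by apply: differentiableM => //; exact: du.
have d2 := dpu j Ox.
rewrite (pderivM i (dw Ox) (differentiableD d2 d1)) (pderivD i d2 d1) (pderivM i (du Ox) (so j)).
have -> : (pderiv j u + (fun y => u y * om j y)) x = pderiv j u x + u x * om j x by [].
have -> : pderiv i w x = w x * om i x by rewrite /om mulrC mulfVK// w_neq0.
move: (w x) (om i x) (om j x) (u x) (pderiv j u x) (pderiv i u x) (pderiv i (pderiv j u) x) (pderiv i (om j) x) => *.
by ring.
Qed.

Let hess_x i j : hessian H v i j x = w x * (hessian G u i j x + u x * hom i j x
  - u x * (om i x * om j x) + G x i j * (p + u x * sq x)).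
Proof.
rewrite /hessian ppv.
have -> : \sum_k christoffel H k i j x * pderiv k v x = w x * (
    \sum_k christoffel G k i j x * pderiv k u x + u x * \sum_k christoffel G k i j x * om k x
   + (pderiv i u x * om j x + pderiv j u x * om i x + 2 * (u x * (om i x * om j x))
   - G x i j * (p + u x * sq x))).
  have -> : pderiv i u x * om j x + pderiv j u x * om i x + 2 * (u x * (om i x * om j x)) =
    \sum_k (i == k)%:R * (om j x * (pderiv k u x + u x * om k x))
    + \sum_k (j == k)%:R * (om i x * (pderiv k u x + u x * om k x)).
    by rewrite 2!delta_sumr; move: (pderiv i u x) (pderiv j u x) (om i x) (om j x) (u x) => *; ring.
  have -> : G x i j * (p + u x * sq x) = \sum_k G x i j * (pderiv k u x * up k x + u x * (om k x * up k x)).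
    by rewrite -mulr_sumr big_split /= -mulr_sumr.
  rewrite (mulr_sumr _ _ _ (u x)) -big_split -big_split -sumrB -big_split mulr_sumr.
  apply: eq_bigr => k _ /=.
  rewrite (christoffel_conformal k i j Ox) (pv k Ox).
  move: (w x) (om i x) (om j x) (om k x) (up k x) (u x) (pderiv k u x) (G x i j) (christoffel G k i j x) => *.
  by ring.
rewrite /hom.
move: (w x) (om i x) (om j x) (u x) (pderiv j u x) (pderiv i u x) (pderiv i (pderiv j u) x) (pderiv i (om j) x) (p) (sq x) (G x i j) (\sum_k _) (\sum_k _) => *.
by ring.
Qed.

Let lap_x : laplacian H v x = (w x)^-1 * (laplacian G u x + u x * div_up x
  + (d%:R - 1) * u x * sq x + d%:R * p).
Proof.
rewrite /laplacian ctrH (ctr_eq hess_x) (ctrZ (w x) (fun i j => hessian G u i j x + u x * hom i j x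
  - u x * (om i x * om j x) + G x i j * (p + u x * sq x))).
rewrite (ctr_eq (B := fun i j => hessian G u i j x + (u x * hom i j x
  + (- u x * (om i x * om j x) + (p + u x * sq x) * G x i j)))); last first.
  move=> i j; move: (hessian _ _ _ _ _) (hom _ _ _) (om _ _) (om _ _) (sq _) (G x _ _) (u x) => *.
  by ring.
rewrite (ctrD (fun i j => hessian G u i j x)) (ctrD (fun i j => u x * hom i j x)).
rewrite (ctrD (fun i j => - u x * (om i x * om j x))).
rewrite (ctrZ _ (fun i j => hom i j x)) (ctrZ _ (fun i j => om i x * om j x)) (ctrZ _ (fun i j => G x i j)).
rewrite ctr_metric ctr_hom ctr_om -/(sq x) /ctr; move: (w_neq0 Ox).
move: (\sum_i \sum_j _) (div_up x) (sq x) (d%:R : R) (w x) (u x) p => *; field=> //.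
Qed.

Let grad_x : grad_sqnorm H v x = grad_sqnorm G u x + 2 * u x * p + u x ^+ 2 * sq x.
Proof.
rewrite /grad_sqnorm ctrH.
rewrite (ctr_eq (B := fun i j => w x ^+ 2 * (pderiv i u x * pderiv j u x +
  (u x * (pderiv i u x * om j x) + (u x * (pderiv j u x * om i x) + u x ^+ 2 * (om i x * om j x)))))); last first.
  move=> i j; rewrite (pv i Ox) (pv j Ox).
  by move: (w x) (om i x) (om j x) (u x) (pderiv i u x) (pderiv j u x) => *; ring.
have -> : ctr (fun i j => w x ^+ 2 * (pderiv i u x * pderiv j u x +
    (u x * (pderiv i u x * om j x) + (u x * (pderiv j u x * om i x) + u x ^+ 2 * (om i x * om j x))))) =
    w x ^+ 2 * (ctr (fun i j => pderiv i u x * pderiv j u x) + (u x * p + (u x * p + u x ^+ 2 * sq x))).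
  etransitivity; [exact: ctrZ|congr (_ * _)].
  etransitivity; [exact: ctrD|congr (_ + _)].
  etransitivity; [exact: ctrD|congr (_ + _)].
    by etransitivity; [exact: ctrZ|congr (_ * _); exact: ctr_om].
  etransitivity; [exact: ctrD|congr (_ + _)].
    etransitivity; [exact: ctrZ|congr (_ * _)].
    by etransitivity; [exact: (ctr_sym (fun i j => pderiv i u x * om j x))|exact: ctr_om].
  by etransitivity; [exact: ctrZ|congr (_ * _); exact: ctr_om].
rewrite -/(ctr (fun i j => pderiv i u x * pderiv j u x)); move: (w_neq0 Ox).
move: (ctr _) (sq x) (w x) (u x) p => *; field => //.
Qed.

(** The factors 2/d and 1/(2(d-1)) are adjusted to three cancellations: [p] between the gradient and
    the Laplacian, [div_up] between the Laplacian and the scalar curvature, and [sq] among all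
    three. *)
Lemma S_curvature_conformal : (1 < d)%N ->
  S_curvature (fun y => w y ^+ 2 *: G y) (fun y => w y * u y) x = S_curvature G u x.
Proof.
move=> d1; rewrite /S_curvature -/H -/v grad_x lap_x ric_x /v.
have d0 : d%:R != 0 :> R by rewrite pnatr_eq0 -lt0n (ltn_trans _ d1).
have dd : d%:R - 1 != 0 :> R by rewrite subr_eq0 pnatr_eq1 gtn_eqF.
move: (w_neq0 Ox) d0 dd.
move: (grad_sqnorm G u x) (laplacian G u x) (scalar_curvature G x) (div_up x) (sq x) p (u x) (w x) (d%:R : R).
by move=> gr la sc dv s p' u' w' n w0' n0 n1; field; apply/and3P.
Qed.

End AtPoint.

End ConformalChange.

(** * Perturbing a defining function *)

Section Contraction.
Variables (R : realType) (d : nat).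
Implicit Types (N : 'M[R]_d) (A B : 'I_d -> 'I_d -> R) (a b : 'I_d -> R).

Definition contract N A : R := \sum_i \sum_j N i j * A i j.

Lemma contract_eq N A B : (forall i j, A i j = B i j) -> contract N A = contract N B.
Proof. by move=> AB; apply: eq_bigr => i _; apply: eq_bigr => j _; rewrite AB. Qed.

Lemma contractD N A B : contract N (fun i j => A i j + B i j) = contract N A + contract N B.
Proof.
rewrite /contract -big_split; apply: eq_bigr => i _ /=.
by rewrite -big_split; apply: eq_bigr => j _ /=; rewrite mulrDr.
Qed.

Lemma contractZ N c A : contract N (fun i j => c * A i j) = c * contract N A.
Proof.
rewrite /contract mulr_sumr; apply: eq_bigr => i _ /=.
by rewrite mulr_sumr; apply: eq_bigr => j _ /=; rewrite mulrCA.
Qed.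

Lemma contract_trmx N A : N^T = N -> contract N (fun i j => A j i) = contract N A.
Proof.
move=> NT; rewrite /contract exchange_big; apply: eq_bigr => i _; apply: eq_bigr => j _ /=.
by rewrite -[in LHS]NT mxE.
Qed.

Lemma contract_sqD N a b : N^T = N ->
  contract N (fun i j => (a i + b i) * (a j + b j)) =
  contract N (fun i j => a i * a j) + 2 * contract N (fun i j => a i * b j)
  + contract N (fun i j => b i * b j).
Proof.
move=> NT.
rewrite (@contract_eq N _ (fun i j => (a i * a j + a i * b j) + (b i * a j + b i * b j))); last first.
  by move=> i j; ring.
rewrite (contractD N (fun i j => a i * a j + a i * b j)) (contractD N (fun i j => a i * a j)).
rewrite (contractD N (fun i j => b i * a j)) -(contract_trmx (fun i j => b i * a j) NT).
rewrite (contract_eq N (A := fun i j => b j * a i) (B := fun i j => a i * b j)).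
  by ring.
by move=> i j; rewrite mulrC.
Qed.

End Contraction.

(** * The effect on S of adding a multiple of a power of the defining function *)

Section Step.
Variables (R : realType) (d : nat) (O : set 'rV[R]_d) (G : 'rV[R]_d -> 'M[R]_d).
Hypotheses (oO : open O) (sG : smooth_mx O G)
  (uG : forall x, O x -> G x \in unitmx) (symG : forall x, O x -> (G x)^T = G x).
Implicit Types (i j k l : 'I_d) (u v w f e s h : 'rV[R]_d -> R) (x y : 'rV[R]_d).

Let invG_sym x : O x -> (invmx (G x))^T = invmx (G x).
Proof. by move=> Ox; rewrite trmx_inv symG. Qed.

Let smooth_contract (A : 'I_d -> 'I_d -> 'rV[R]_d -> R) :
  (forall i j, smooth_on O (A i j)) ->
  smooth_on O (fun x => contract (invmx (G x)) (fun i j => A i j x)).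
Proof.
move=> sA; apply: (smooth_on_sum _ oO) => i _; apply: (smooth_on_sum _ oO) => j _.
by apply: (smooth_onM oO); first exact: smooth_invmx.
Qed.

Let grad_dot u v x := contract (invmx (G x)) (fun i j => pderiv i u x * pderiv j v x).

Let smooth_grad_dot u v : smooth_on O u -> smooth_on O v -> smooth_on O (grad_dot u v).
Proof.
move=> su sv; apply: (smooth_contract (A := fun i j x => pderiv i u x * pderiv j v x)) => i j.
by apply: (smooth_onM oO); exact: smooth_on_pderiv.
Qed.

Let grad_sqnormD u v x : smooth_on O u -> smooth_on O v -> O x ->
  grad_sqnorm G (fun y => u y + v y) x =
  grad_sqnorm G u x + 2 * grad_dot u v x + grad_sqnorm G v x.
Proof.
move=> su sv Ox; rewrite /grad_sqnorm.
rewrite -[LHS]/(contract _ (fun i j => pderiv i (fun y => u y + v y) x * pderiv j (fun y => u y + v y) x)).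
rewrite -(contract_sqD (fun i => pderiv i u x) (fun i => pderiv i v x) (invG_sym Ox)).
apply: contract_eq => i j; have du := smooth_on_diff su Ox; have dv := smooth_on_diff sv Ox.
by rewrite !pderivD.
Qed.

Let laplacianD u v x : smooth_on O u -> smooth_on O v -> O x ->
  laplacian G (fun y => u y + v y) x = laplacian G u x + laplacian G v x.
Proof.
move=> su sv Ox; rewrite -[LHS]/(contract (invmx (G x)) (fun i j => hessian G (fun y => u y + v y) i j x)).
rewrite -[RHS](contractD (invmx (G x)) (fun i j => hessian G u i j x) (fun i j => hessian G v i j x)).
apply: contract_eq => i j; rewrite /hessian.
have pD k y : O y -> pderiv k (fun y => u y + v y) y = pderiv k u y + pderiv k v y.
  by move=> Oy; rewrite pderivD//; [exact: (smooth_on_diff su)|exact: (smooth_on_diff sv)].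
rewrite (pderiv_eq oO (g := fun y => pderiv j u y + pderiv j v y)) ?inE//; last first.
  by move=> y; rewrite inE => Oy; exact: pD.
rewrite pderivD; last 2 first.
- exact: (smooth_on_diff (smooth_on_pderiv j su)).
- exact: (smooth_on_diff (smooth_on_pderiv j sv)).
have -> : \sum_k christoffel G k i j x * pderiv k (fun y => u y + v y) x =
  \sum_k christoffel G k i j x * pderiv k u x + \sum_k christoffel G k i j x * pderiv k v x.
  by rewrite -big_split; apply: eq_bigr => k _ /=; rewrite pD// mulrDr.
move: (\sum_k _) (\sum_k _) (pderiv i (pderiv j u) x) (pderiv i (pderiv j v) x) => *.
by ring.
Qed.

Let kappa x := scalar_curvature G x / (2 * (d%:R - 1)).

Let smooth_kappa : smooth_on O kappa.
Proof.
by apply: (smooth_onM oO); [exact: smooth_scalar_curvature|exact: smooth_on_cst].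
Qed.

Section Perturbation.
Variables (s f e : 'rV[R]_d -> R) (m : nat).
Hypotheses (ss : smooth_on O s) (sf : smooth_on O f) (se : smooth_on O e).

Let w y := s y ^+ m.+2 * f y.
Let v y := s y + s y ^+ 2 * e y.
Let c : R := m.+2%:R.
Let c' : R := m.+1%:R.
(** [a] and [b] are what remains after extracting powers of [s]: the gradient of [w] is [s ^+ m.+1]
    times [a], and that of [v] is the gradient of [s] plus [s] times [b]. *)
Let a i y := c * pderiv i s y * f y + s y * pderiv i f y.
Let b i y := 2 * pderiv i s y * e y + s y * pderiv i e y.

Let sa i : smooth_on O (a i).
Proof.
apply: (smooth_onD oO); apply: (smooth_onM oO) => //; try exact: smooth_on_pderiv.
by apply: (smooth_onM oO); [exact: smooth_on_cst|exact: smooth_on_pderiv].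
Qed.

Let sb i : smooth_on O (b i).
Proof.
apply: (smooth_onD oO); apply: (smooth_onM oO) => //; try exact: smooth_on_pderiv.
by apply: (smooth_onM oO); [exact: smooth_on_cst|exact: smooth_on_pderiv].
Qed.

Let sw : smooth_on O w.
Proof. by apply: (smooth_onM oO) => //; exact: smooth_onX. Qed.

Let sv : smooth_on O v.
Proof. by apply: (smooth_onD oO) => //; apply: (smooth_onM oO) => //; exact: smooth_onX. Qed.

Let pw i x : O x -> pderiv i w x = s x ^+ m.+1 * a i x.
Proof. by move=> Ox; exact: (pderiv_pow_mul m.+1 i ss sf Ox). Qed.

Let ppw i j x : O x -> pderiv i (pderiv j w) x =
  s x ^+ m * (c' * pderiv i s x * a j x + s x * pderiv i (a j) x).
Proof.
move=> Ox; rewrite (pderiv_eq oO (g := fun y => s y ^+ m.+1 * a j y)) ?inE//; last first.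
  by move=> y; rewrite inE => Oy; exact: pw.
exact: (pderiv_pow_mul m i ss (sa j) Ox).
Qed.

Let pv i x : O x -> pderiv i v x = pderiv i s x + s x * b i x.
Proof.
move=> Ox; have sse : smooth_on O (fun y => s y ^+ 2 * e y).
  by apply: (smooth_onM oO) => //; exact: smooth_onX.
rewrite /v pderivD; [|exact: (smooth_on_diff ss)|exact: (smooth_on_diff sse)].
by rewrite (pderiv_pow_mul 1 i ss se Ox) expr1.
Qed.

Let r i j y := c' * pderiv i s y * pderiv j f y + pderiv i (a j) y
  - \sum_k christoffel G k i j y * a k y.

Let sr i j : smooth_on O (r i j).
Proof.
apply: (smooth_onB oO).
  apply: (smooth_onD oO); last exact: smooth_on_pderiv.
  apply: (smooth_onM oO); last exact: smooth_on_pderiv.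
  by apply: (smooth_onM oO); [exact: smooth_on_cst|exact: smooth_on_pderiv].
by apply: (smooth_on_sum _ oO) => k _; apply: (smooth_onM oO) => //; exact: smooth_christoffel.
Qed.

Let lap_w x : O x -> laplacian G w x = s x ^+ m * (c' * c * f x * grad_sqnorm G s x
  + s x * contract (invmx (G x)) (fun i j => r i j x)).
Proof.
move=> Ox; rewrite /grad_sqnorm.
rewrite -/(contract (invmx (G x)) (fun i j => pderiv i s x * pderiv j s x)) -!contractZ.
rewrite -contractD -contractZ; apply: contract_eq => i j.
rewrite /hessian ppw//.
have -> : \sum_k christoffel G k i j x * pderiv k w x =
    s x ^+ m * (s x * \sum_k christoffel G k i j x * a k x).
  rewrite mulr_sumr mulr_sumr; apply: eq_bigr => k _; rewrite pw// exprS.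
  by move: (s x) (a k x) (christoffel _ _ _ _ _) => *; ring.
rewrite /r {1}/a; move: (\sum_k _) (pderiv i (a j) x) (pderiv i s x) (pderiv j s x) (pderiv j f x) (s x) (f x) => *.
ring.
Qed.

Let q i j y := pderiv i s y * pderiv j f y + c * f y * (b i y * pderiv j s y)
  + s y * (b i y * pderiv j f y).

Let sq i j : smooth_on O (q i j).
Proof.
by do ?[done|exact: smooth_on_cst|exact: smooth_onX|apply: (smooth_onD oO)|apply: (smooth_onM oO)] => //; try exact: smooth_on_pderiv;
  exact: smooth_on_cst.
Qed.

Let dot_vw x : O x -> grad_dot v w x = s x ^+ m.+1 * (c * f x * grad_sqnorm G s x
  + s x * contract (invmx (G x)) (fun i j => q i j x)).
Proof.
move=> Ox; rewrite /grad_sqnorm /grad_dot.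
rewrite -/(contract (invmx (G x)) (fun i j => pderiv i s x * pderiv j s x)) -!contractZ.
rewrite -contractD -contractZ; apply: contract_eq => i j.
rewrite pv// pw// /a /q.
by move: (b i x) (pderiv i s x) (pderiv j s x) (pderiv j f x) (s x) (f x) => *; ring.
Qed.

Let grad_w x : O x -> grad_sqnorm G w x =
  s x ^+ m.+2 * (s x ^+ m * contract (invmx (G x)) (fun i j => a i x * a j x)).
Proof.
move=> Ox; rewrite -!contractZ; apply: contract_eq => i j.
rewrite !pw// !exprS.
by move: (a i x) (a j x) (s x) => *; ring.
Qed.

(* The leading coefficient vanishes exactly for [m.+2 = d.+1]. *)
Lemma S_curvature_step Q0 : smooth_on O Q0 ->
  (forall x, O x -> grad_sqnorm G s x = 1 + s x * Q0 x) -> (0 < d)%N ->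
  exists2 Q, smooth_on O Q & forall x, O x ->
    S_curvature G (fun y => s y + s y ^+ 2 * e y + s y ^+ m.+2 * f y) x =
    S_curvature G (fun y => s y + s y ^+ 2 * e y) x
    + 2 * m.+2%:R * (d.+1%:R - m.+2%:R) / d%:R * f x * s x ^+ m.+1 + s x ^+ m.+2 * Q x.
Proof.
move=> sQ0 sN d0.
pose A x := contract (invmx (G x)) (fun i j => a i x * a j x).
pose B x := contract (invmx (G x)) (fun i j => q i j x).
pose C x := contract (invmx (G x)) (fun i j => r i j x).
(* Chosen so that the operator Laplacian plus [kappa], applied to [w], gives
   [s ^+ m * (c' * c * f + s * D)]; [L] is the same operator applied to [v]. *)
pose D x := c' * c * f x * Q0 x + C x + kappa x * s x * f x.
pose L x := laplacian G v x + kappa x * v x.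
have sA : smooth_on O A.
  by apply: (smooth_contract (A := fun i j x => a i x * a j x)) => i j; apply: (smooth_onM oO).
have sB : smooth_on O B by exact: (smooth_contract (A := q)).
have sC : smooth_on O C by exact: (smooth_contract (A := r)).
have sL : smooth_on O L.
  by apply: (smooth_onD oO); [exact: smooth_laplacian|exact: smooth_onM].
have sD : smooth_on O D.
  by do ?[done|exact: smooth_on_cst|exact: smooth_onX|apply: (smooth_onD oO)|apply: (smooth_onM oO)] => //; exact: smooth_on_cst.
exists (fun x => 2 * (c * f x * Q0 x) + 2 * B x + s x ^+ m * A x
  - 2 / d%:R * (D x + (e x + s x ^+ m * f x) * (c' * c * f x + s x * D x))
  - 2 / d%:R * (f x * L x)).
  by do ?[done|exact: smooth_on_cst|exact: smooth_onX|apply: (smooth_onD oO)|apply: (smooth_onN oO)|apply: (smooth_onM oO)] => //;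
    try exact: smooth_on_cst; exact: smooth_onX.
move=> x Ox; rewrite -/(v) -/(w).
have E1 := grad_sqnormD sv sw Ox; have E2 := laplacianD sv sw Ox.
rewrite /S_curvature -!/(kappa _) [grad_sqnorm G (fun y => _ + s y ^+ m.+2 * f y) x]E1.
rewrite [laplacian G (fun y => _ + s y ^+ m.+2 * f y) x]E2.
rewrite dot_vw// grad_w// lap_w// sN// -/(A x) -/(B x) -/(C x).
have -> : kappa x * (s x + s x ^+ 2 * e x + s x ^+ m.+2 * f x) =
    kappa x * v x + kappa x * w x by rewrite -mulrDr.
have dE : d%:R != 0 :> R by rewrite pnatr_eq0 -lt0n.
have cE : c = c' + 1 by rewrite /c /c' -[m.+2]addn1 natrD.
rewrite /L /D /w /v -/c -[d.+1%:R]natr1 cE.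
move: (c') (A x) (B x) (C x) (kappa x) (f x) (e x) (s x) (Q0 x) (laplacian G _ x) (grad_sqnorm G _ x) (d%:R : R) dE.
move=> C1 A1 B1 D1 k1 f1 e1 s1 q1 l1 g1 n1 n0; rewrite !exprS.
by move: (s1 ^+ m) => z; field.
Qed.

End Perturbation.

Lemma S_curvature_grad u : smooth_on O u ->
  exists2 q, smooth_on O q & forall x, O x -> S_curvature G u x = grad_sqnorm G u x + u x * q x.
Proof.
move=> su; exists (fun x => - (2 / d%:R * (laplacian G u x + kappa x * u x))).
  apply: (smooth_onN oO); apply: (smooth_onM oO); first exact: smooth_on_cst.
  by apply: (smooth_onD oO); [exact: smooth_laplacian|exact: smooth_onM].
by move=> x _; rewrite /S_curvature -/(kappa x); ring.
Qed.

Lemma grad_sqnorm_mul s h : smooth_on O s -> smooth_on O h ->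
  exists2 q, smooth_on O q & forall x, O x ->
    grad_sqnorm G (fun y => s y * h y) x = h x ^+ 2 * grad_sqnorm G s x + s x * q x.
Proof.
move=> ss sh.
exists (fun x => 2 * h x * grad_dot s h x + s x * grad_dot h h x).
  by do ?[done|exact: smooth_on_cst|exact: smooth_onX|apply: (smooth_onD oO)|apply: (smooth_onM oO)] => //;
    try exact: smooth_on_cst; exact: smooth_grad_dot.
move=> x Ox; have ds := smooth_on_diff ss Ox; have dh := smooth_on_diff sh Ox.
rewrite /grad_sqnorm -[LHS]/(contract (invmx (G x)) (fun i j => pderiv i (fun y => s y * h y) x * pderiv j (fun y => s y * h y) x)).
rewrite (contract_eq _ (B := fun i j => (h x * pderiv i s x + s x * pderiv i h x) * (h x * pderiv j s x + s x * pderiv j h x))); last first.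
  by move=> i j; rewrite !pderivM//; congr (_ * _); ring.
rewrite (contract_sqD (fun i => h x * pderiv i s x) (fun i => s x * pderiv i h x) (invG_sym Ox)).
have cZ a b (A : 'I_d -> R) (B : 'I_d -> R) : contract (invmx (G x)) (fun i j => a * A i * (b * B j)) =
    a * b * contract (invmx (G x)) (fun i j => A i * B j).
  by rewrite -contractZ; apply: contract_eq => i j; ring.
rewrite !cZ /grad_dot -/(contract (invmx (G x)) (fun i j => pderiv i s x * pderiv j s x)).
by move: (contract _ _) (contract _ _) (contract _ _) => *; ring.
Qed.

End Step.

Lemma pow_mul_cancel (R : realType) (d : nat) (O : set 'rV[R]_d) (s f : 'rV[R]_d -> R) m i x :
  open O -> smooth_on O s -> smooth_on O f -> O x -> s x = 0 -> pderiv i s x != 0 ->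
  (forall y, O y -> s y ^+ m * f y = 0) -> f x = 0.
Proof.
move=> oO ss sf Ox sx0 ds sf0.
have := pderivs_pow_mul_top m i oO ss sf Ox sx0.
rewrite (pderivs_eq oO (g := fun=> 0)) ?inE//; last by move=> y; rewrite inE => /sf0.
have -> : pderivs (nseq m i) (fun=> 0 : R) x = 0.
  by case: m {sf0} => // m; exact: pderivs_cst.
move=> /esym/eqP; rewrite !mulf_eq0 expf_eq0 (negbTE ds) andbF orbF => /orP[|/eqP//].
by rewrite pnatr_eq0 => m0; move: (fact_gt0 m); rewrite (eqP m0).
Qed.

(** * Smooth functions on a manifold *)

Section ManifoldCalculus.
Variables (R : realType) (d : nat) (M : topologicalType) (atl : set (chart R d M)).
Hypothesis hM : oriented_manifold atl.
Implicit Types (a b : chart R d M) (U V W : set M) (f g : M -> R) (p q : M).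

Local Notation img a U := (cmap a @` (dom a `&` U)).

(** Membership in the maximal atlas, regardless of orientation: slice charts are only assumed to be
    of this kind. *)
Definition compatible a :=
  is_chart a /\ forall b, atl b -> smooth_transition a b /\ smooth_transition b a.

Lemma atlas_compatible a : atl a -> compatible a.
Proof.
move=> aa; split; first exact: (atlas_chart hM).
by move=> b bb; split; exact: (atlas_smooth hM).
Qed.

Lemma in_img a U p : dom a p -> U p -> img a U (cmap a p).
Proof. by move=> ap Up; exists p. Qed.

Lemma open_img a U : is_chart a -> open U -> open (img a U).
Proof.
move=> ca oU; have oc := chart_open_cod ca.
have -> : img a U = cod a `&` cinv a @^-1` U.
  apply/seteqP; split=> [_ [p [ap Up] <-]|_ [[p ap <-]] /=].
    by split=> /=; [exists p|rewrite (chart_cancel ca)].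
  by rewrite (chart_cancel ca)// => Up; exists p.
have := chart_continuous_inv ca; rewrite continuous_open_subspace// => cc.
rewrite openE => x [cx Ux]; apply: filterI; first exact: open_nbhs_nbhs.
by apply: (cc x); [rewrite inE|exact: open_nbhs_nbhs].
Qed.

Lemma open_preimg a (O : set 'rV[R]_d) : is_chart a -> open O ->
  open (dom a `&` cmap a @^-1` O).
Proof.
move=> ca oO; have oc := chart_open_dom ca.
have := chart_continuous ca; rewrite continuous_open_subspace// => cc.
rewrite openE => x [cx Ux]; apply: filterI; first exact: open_nbhs_nbhs.
by apply: (cc x); [rewrite inE|exact: open_nbhs_nbhs].
Qed.

Lemma transitionE a b p : is_chart a -> dom a p -> transition a b (cmap a p) = cmap b p.
Proof. by move=> ca ap; rewrite /transition /= (chart_cancel ca). Qed.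

Lemma smooth_change_chart a b V f : is_chart a -> is_chart b -> smooth_transition b a ->
  open V -> V `<=` dom a -> smooth_on (img a V) (f \o cinv a) -> smooth_on (img b V) (f \o cinv b).
Proof.
move=> ca cb tba oV Va sf; have oI := open_img cb oV.
apply: (smooth_on_eq (f := fun x => (f \o cinv a) (transition b a x))) => //.
  move=> x; rewrite inE => -[p [bp Vp] <-] /=.
  by rewrite transitionE// (chart_cancel cb)// (chart_cancel ca)//; exact: Va.
apply: (smooth_on_comp oI _ sf).
  move=> j; apply: smooth_onW (tba j) => _ [p [bp Vp] <-]; apply: in_img => //.
  exact: Va.
by move=> _ [p [bp Vp] <-]; rewrite transitionE//; apply: in_img => //; exact: Va.
Qed.

Lemma smooth_fun_of_chart a V f : compatible a -> open V -> V `<=` dom a ->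
  smooth_on (img a V) (f \o cinv a) -> smooth_fun atl V f.
Proof.
move=> [ca ta] oV Va sf b bb.
by apply: (smooth_change_chart ca) sf => //; [exact: (atlas_chart hM)|exact: (ta b bb).2].
Qed.

Lemma smooth_funW U V f : V `<=` U -> smooth_fun atl U f -> smooth_fun atl V f.
Proof.
move=> VU sf a aa; apply: smooth_onW (sf a aa) => _ [p [ap Vp] <-].
by apply: in_img => //; exact: VU.
Qed.

Lemma smooth_in_chart a U f : compatible a -> open U -> smooth_fun atl U f ->
  smooth_on (img a U) (f \o cinv a).
Proof.
move=> [ca ta] oU sf; apply: smooth_on_local => _ [p [ap Up] <-].
have [b bb bp] := atlas_cover hM p; have cb := atlas_chart hM bb.
have oV : open (dom b `&` U) by apply: openI => //; exact: chart_open_dom.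
exists (img a (dom b `&` U)); first by split; [exact: open_img|exact: in_img].
apply: (smooth_change_chart cb ca) => //; first exact: (ta b bb).1.
by apply: smooth_onW (sf b bb) => _ [q [bq [_ Uq]] <-]; exact: in_img.
Qed.

Lemma smooth_fun_cmap a k : compatible a -> smooth_fun atl (dom a) (fun q => cmap a q 0 k).
Proof.
move=> ca; have oa := chart_open_dom ca.1.
apply: (smooth_fun_of_chart ca) => //; have oI := open_img ca.1 oa.
apply: (smooth_on_eq (f := fun x => x 0 k)) => //; last exact: smooth_on_coord.
by move=> x; rewrite inE => -[p [ap _] <-] /=; rewrite (chart_cancel ca.1).
Qed.

Lemma smooth_fun_local U f :
  (forall p, U p -> exists V, [/\ open V, V p & smooth_fun atl V f]) -> smooth_fun atl U f.
Proof.
move=> H a aa; apply: smooth_on_local => _ [p [ap Up] <-].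
have [V [oV Vp sf]] := H p Up.
exists (img a V); last exact: sf.
by split; [exact: (open_img (atlas_chart hM aa))|exact: in_img].
Qed.

Lemma smooth_fun_eq U f g : open U -> (forall p, U p -> f p = g p) ->
  smooth_fun atl U f -> smooth_fun atl U g.
Proof.
move=> oU fg sf a aa; have ca := atlas_chart hM aa.
apply: smooth_on_eq (sf a aa); first exact: open_img.
by move=> x; rewrite inE => -[p [ap Up] <-] /=; rewrite (chart_cancel ca)// fg.
Qed.

Lemma smooth_fun_cst U (k : R) : smooth_fun atl U (fun=> k).
Proof. by move=> a aa; exact: smooth_on_cst. Qed.

Lemma smooth_funD U f g : open U -> smooth_fun atl U f -> smooth_fun atl U g ->
  smooth_fun atl U (fun p => f p + g p).
Proof.
by move=> oU sf sg a aa; apply: (smooth_onD _ (sf a aa) (sg a aa));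
  exact: (open_img (atlas_chart hM aa)).
Qed.

Lemma smooth_funM U f g : open U -> smooth_fun atl U f -> smooth_fun atl U g ->
  smooth_fun atl U (fun p => f p * g p).
Proof.
by move=> oU sf sg a aa; apply: (smooth_onM _ (sf a aa) (sg a aa));
  exact: (open_img (atlas_chart hM aa)).
Qed.

Lemma smooth_funN U f : open U -> smooth_fun atl U f -> smooth_fun atl U (fun p => - f p).
Proof.
by move=> oU sf a aa; apply: (smooth_onN _ (sf a aa)); exact: (open_img (atlas_chart hM aa)).
Qed.

Lemma smooth_funB U f g : open U -> smooth_fun atl U f -> smooth_fun atl U g ->
  smooth_fun atl U (fun p => f p - g p).
Proof. by move=> oU sf sg; apply: smooth_funD => //; exact: smooth_funN. Qed.

Lemma smooth_funX U f n : open U -> smooth_fun atl U f -> smooth_fun atl U (fun p => f p ^+ n).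
Proof.
by move=> oU sf a aa; apply: (smooth_onX n _ (sf a aa)); exact: (open_img (atlas_chart hM aa)).
Qed.

Lemma smooth_funV U f : open U -> smooth_fun atl U f -> (forall p, U p -> f p != 0) ->
  smooth_fun atl U (fun p => (f p)^-1).
Proof.
move=> oU sf f0 a aa; have ca := atlas_chart hM aa.
apply: (smooth_onV (open_img ca oU) (sf a aa)) => _ [p [ap Up] <-] /=.
by rewrite (chart_cancel ca)// f0.
Qed.

Lemma smooth_fun_sqrt U f : open U -> smooth_fun atl U f -> (forall p, U p -> 0 < f p) ->
  smooth_fun atl U (fun p => Num.sqrt (f p)).
Proof.
move=> oU sf f0 a aa; have ca := atlas_chart hM aa.
apply: (smooth_on_sqrt (open_img ca oU) (sf a aa)) => _ [p [ap Up] <-] /=.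
by rewrite (chart_cancel ca)// f0.
Qed.

Lemma smooth_fun_sum (I : Type) (r : seq I) (P : pred I) U (F : I -> M -> R) : open U ->
  (forall i, P i -> smooth_fun atl U (F i)) -> smooth_fun atl U (fun p => \sum_(i <- r | P i) F i p).
Proof.
move=> oU sF a aa; apply: (smooth_on_sum _ (open_img (atlas_chart hM aa) oU) (F := fun i => F i \o cinv a)).
by move=> i Pi; exact: sF.
Qed.

Lemma smooth_fun_prod (I : Type) (r : seq I) (P : pred I) U (F : I -> M -> R) : open U ->
  (forall i, P i -> smooth_fun atl U (F i)) -> smooth_fun atl U (fun p => \prod_(i <- r | P i) F i p).
Proof.
move=> oU sF a aa; apply: (smooth_on_prod _ (open_img (atlas_chart hM aa) oU) (F := fun i => F i \o cinv a)).
by move=> i Pi; exact: sF.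
Qed.

Lemma smooth_fun_continuous U f p : open U -> smooth_fun atl U f -> U p -> {for p, continuous f}.
Proof.
move=> oU sf Up; have [a aa ap] := atlas_cover hM p; have ca := atlas_chart hM aa.
move=> A /= Af; have cf : {for cmap a p, continuous (f \o cinv a)}.
  exact: (differentiable_continuous (smooth_on_diff (sf a aa) (in_img ap Up))).
have := cf A; rewrite /= (chart_cancel ca)// => /(_ Af); rewrite nbhsE => -[V [oV Vp] VA].
have /open_nbhs_nbhs : open_nbhs p (dom a `&` cmap a @^-1` V).
  by split => //; exact: open_preimg.
by apply: filterS => q [aq Vq]; have := VA _ Vq; rewrite /= (chart_cancel ca).
Qed.

Lemma smooth_fun_open U f (A : set R) : open U -> smooth_fun atl U f -> open A ->
  open (U `&` f @^-1` A).
Proof.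
move=> oU sf oA; rewrite openE => p [Up Ap]; apply: filterI; first exact: open_nbhs_nbhs.
by apply: (smooth_fun_continuous oU sf Up); exact: open_nbhs_nbhs.
Qed.

Lemma smooth_fun_open_gt0 U f : open U -> smooth_fun atl U f -> open (U `&` [set p | 0 < f p]).
Proof. by move=> oU sf; apply: (smooth_fun_open oU sf (A := [set x | 0 < x])); exact: open_gt. Qed.

Lemma smooth_fun_open_neq0 U f : open U -> smooth_fun atl U f -> open (U `&` [set p | f p != 0]).
Proof.
move=> oU sf; apply: (smooth_fun_open oU sf (A := [set x | x != 0])).
have -> : [set x : R | x != 0] = [set x | 0 < x] `|` [set x | x < 0].
  apply/seteqP; split=> x /=; first by rewrite neq_lt orbC => /orP.
  by case=> h; [rewrite gt_eqF|rewrite lt_eqF].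
by apply: openU; [exact: open_gt|exact: open_lt].
Qed.

(** A bump in a chart, extended by 0. The extension is smooth because [K] is the image of a compact
    ball, hence closed as [M] is Hausdorff. *)
Lemma manifold_bump p U : open U -> U p -> exists psi K W,
  [/\ smooth_fun atl setT psi, forall q, 0 <= psi q <= 1, closed K /\ K `<=` U,
      forall q, ~ K q -> psi q = 0 & [/\ open W, W p & forall q, W q -> psi q = 1]].
Proof.
move=> oU Up; have [a aa ap] := atlas_cover hM p; have ca := atlas_chart hM aa.
have oI := open_img ca oU.
have /nbhs_ballP[r /= r0 rI] := open_nbhs_nbhs (conj oI (in_img ap Up)).
pose x := cmap a p; have r20 : 0 < r / 2 by rewrite divr_gt0.
pose B := [set y : 'rV[R]_d | `|y - x| <= r / 2].
have BI : B `<=` img a U.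
  move=> y By; apply: rI; rewrite ball_row distrC; apply: le_lt_trans By _.
  by rewrite ltr_pdivrMr// ltr_pMr// ltr1n.
pose psi q := if `[< dom a q >] then bump x (r / 2) (cmap a q) else 0.
pose K := cinv a @` B.
have cK : closed K.
  apply: compact_closed; first exact: (manifold_hausdorff hM).
  apply: continuous_compact; last exact: compact_cball.
  apply: continuous_subspaceW (chart_continuous_inv ca).
  by move=> y /BI[q [aq _] <-]; exists q.
have KU : K `<=` U.
  by move=> _ [y /BI[q [aq Uq] <-] <-]; rewrite (chart_cancel ca).
have Ka : K `<=` dom a.
  by move=> _ [y /BI[q [aq Uq] <-] <-]; rewrite (chart_cancel ca).
have psi0 q : ~ K q -> psi q = 0.
  rewrite /psi; case: asboolP => // aq Kq; apply: bump_out => //.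
  rewrite leNgt; apply/negP => qx; apply: Kq; exists (cmap a q); first exact: ltW.
  exact: (chart_cancel ca).
have spsi : smooth_fun atl setT psi.
  apply: smooth_fun_local => q _; have [Kq|Kq] := pselect (K q); last first.
    exists (~` K); split => //; first exact: closed_openC.
    apply: (smooth_fun_eq (f := fun=> 0)); [exact: closed_openC|by move=> z /psi0|].
    exact: smooth_fun_cst.
  exists (dom a); split; [exact: chart_open_dom|exact: Ka|].
  have oa := chart_open_dom ca.
  apply: (smooth_fun_of_chart (atlas_compatible aa)) => //.
  have oD := open_img ca oa.
  apply: (smooth_on_eq (f := bump x (r / 2))) => //; last exact: smooth_bump.
  move=> y; rewrite inE => -[z [az _] <-] /=.
  by rewrite /psi (chart_cancel ca)//; case: asboolP.
have : nbhs x [set y | bump x (r / 2) y = 1] by exact: bump_in.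
rewrite nbhsE => -[V [oV Vx] V1].
exists psi, K, (dom a `&` cmap a @^-1` V); split => //.
  move=> q; rewrite /psi; case: asboolP => _; last by rewrite lexx ler01.
  by rewrite /bump ramp_ge0 ramp_le1.
split=> //; first exact: open_preimg.
by move=> q [aq Vq]; rewrite /psi; case: asboolP => // _; exact: V1.
Qed.

(** For each basic open set contained in some [W p], one such [p] is selected; a numbering of the
    countable basis lists them. The option type covers numbers without a candidate. *)
Lemma lindelof (S : set M) (W : M -> set M) :
  (forall p, S p -> open (W p) /\ W p p) ->
  exists c : nat -> option M, (forall n p, c n = Some p -> S p) /\
    forall q, S q -> exists n p, c n = Some p /\ W p q.
Proof.
move=> H; have [B cB [Bo Bb]] := manifold_second_countable hM.
have /countable_injP[g gi] := cB.
pose T n p := exists e, [/\ B e, g e = n, S p & e `<=` W p].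
have /choice[c hc] : forall n, exists o, (forall p, o = Some p -> T n p) /\ (o = None -> forall p, ~ T n p).
  move=> n; have [[p Tp]|N] := pselect (exists p, T n p).
    by exists (Some p); split=> // _ [<-].
  by exists None; split=> // _ p Tp; apply: N; exists p.
exists c; split=> [n p /(hc n).1[e []]//|q Sq].
have [oW Wq] := H q Sq.
have [e [Be1 eq] eW] : filter_from [set U | B U /\ U q] id (W q).
  by apply: Bb; exact: open_nbhs_nbhs.
have Tq : T (g e) q by exists e.
case E : (c (g e)) => [p|]; last by case: ((hc _).2 E q).
exists (g e), p; split=> //; have [e' [Be' ge _ eW']] := (hc _).1 _ E.
by apply: eW'; rewrite (gi _ _ _ _ ge)// inE.
Qed.

Lemma open_seq_near q (P : nat -> set M -> Prop) n :
  (forall i V W, W `<=` V -> P i V -> P i W) ->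
  (forall i, (i < n)%N -> exists V, [/\ open V, V q & P i V]) ->
  exists V, [/\ open V, V q & forall i, (i < n)%N -> P i V].
Proof.
move=> PW; elim: n => [_|n IH H]; first by exists setT; split=> //; exact: openT.
have [V [oV Vq PV]] := IH (fun i h => H i (ltnW h)).
have [W [oW Wq PWn]] := H n (ltnSn n).
exists (V `&` W); split=> //; first exact: openI.
move=> i; rewrite ltnS leq_eqVlt => /orP[/eqP ->|/PV]; first by apply: PW PWn => ? [].
by apply: PW => ? [].
Qed.

(** This turns bump functions into a partition of unity without dividing by their sum: the total is
    1 as soon as one of them equals 1. *)
Lemma sum_telescope_cut (F : nat -> R) n :
  \sum_(0 <= i < n) F i * \prod_(0 <= j < i) (1 - F j) = 1 - \prod_(0 <= j < n) (1 - F j).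
Proof.
elim: n => [|n IH]; first by rewrite !big_geq// subrr.
by rewrite big_nat_recr//= IH [in RHS]big_nat_recr//=; ring.
Qed.

(* Gluing with a partition of unity subordinate to a countable subcover. *)
Lemma glue (S : set M) (D : M -> set M) (f : M -> M -> R) :
  (forall p, S p -> [/\ open (D p), D p p & smooth_fun atl (D p) (f p)]) ->
  exists U u, [/\ open U, S `<=` U, smooth_fun atl U u &
   forall q, U q -> exists W (r : seq nat) (c : nat -> M) (psi : nat -> M -> R),
     [/\ open W /\ W `<=` U, W q,
         forall i, i \in r -> [/\ S (c i), W `<=` D (c i), smooth_fun atl W (psi i)
                                & forall z, W z -> 0 <= psi i z],
         forall z, W z -> \sum_(i <- r) psi i z = 1
       & forall z, W z -> u z = \sum_(i <- r) psi i z * f (c i) z]].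
Proof.
move=> H.
have /choice[T hT] : forall p, exists T : (M -> R) * set M * set M, S p ->
    [/\ smooth_fun atl setT T.1.1, forall q, 0 <= T.1.1 q <= 1, closed T.1.2 /\ T.1.2 `<=` D p,
      forall q, ~ T.1.2 q -> T.1.1 q = 0 & [/\ open T.2, T.2 p & forall q, T.2 q -> T.1.1 q = 1]].
  move=> p; have [Sp|Sp] := pselect (S p); last by exists (fun=> 0, set0, set0).
  have [oD Dp _] := H p Sp; have [psi [K [W h]]] := manifold_bump oD Dp.
  by exists (psi, K, W).
have [|c [cS cW]] := @lindelof S (fun p => (T p).2).
  by move=> p /hT[_ _ _ _ []].
pose beta n q := if c n is Some p then (T p).1.1 q else 0.
(* [phi m] vanishes wherever an earlier bump equals 1, that is on an open set, so the sum of all of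
   them is locally finite by construction. *)
pose phi n q := beta n q * \prod_(0 <= j < n) (1 - beta j q).
pose ff n q := if c n is Some p then f p q else 0.
have sbeta n : smooth_fun atl setT (beta n).
  rewrite /beta; case E : (c n) => [p|]; last exact: smooth_fun_cst.
  by have [] := hT _ (cS _ _ E).
have beta01 n q : 0 <= beta n q <= 1.
  rewrite /beta; case E : (c n) => [p|]; last by rewrite lexx ler01.
  by have [] := hT _ (cS _ _ E).
have sphi n : smooth_fun atl setT (phi n).
  apply: smooth_funM => //; first exact: openT.
  apply: smooth_fun_prod => [|i _]; first exact: openT.
  by apply: smooth_funB; [exact: openT|exact: smooth_fun_cst|].
have phi0 n q : 0 <= phi n q.
  apply: mulr_ge0; first by case/andP: (beta01 n q).
  by apply: prodr_ge0 => i _; rewrite subr_ge0; case/andP: (beta01 i q).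
pose U := [set q | exists n p, c n = Some p /\ (T p).2 q].
have oU : open U.
  rewrite openE => q [n [p [cn Tq]]].
  have [_ _ _ _ [oW _ _]] := hT _ (cS _ _ cn).
  have /open_nbhs_nbhs := conj oW Tq.
  by apply: filterS => z Tz; exists n, p.
have phi_far n p q m : c n = Some p -> (T p).2 q -> (n < m)%N -> phi m q = 0.
  move=> cn Tq nm; rewrite /phi (big_cat_nat (n := n.+1)) //= big_nat_recr//=.
  have [_ _ _ _ [_ _ /(_ q Tq) b1]] := hT _ (cS _ _ cn).
  have -> : 1 - beta n q = 0 by rewrite /beta cn b1 subrr.
  by rewrite mulr0 mul0r mulr0.
have /choice[N hN] : forall q, exists n, U q -> exists p, c n = Some p /\ (T p).2 q.
  move=> q; have [[n [p h]]|nU] := pselect (U q); last by exists 0%N.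
  by exists n => _; exists p.
pose u q := \sum_(0 <= i < (N q).+1) phi i q * ff i q.
have uE n p q : c n = Some p -> (T p).2 q -> u q = \sum_(0 <= i < n.+1) phi i q * ff i q.
  move=> cn Tq; have [p' [cN TN]] : exists p', c (N q) = Some p' /\ (T p').2 q.
    by apply: hN; exists n, p.
  have ext k p0 m : c k = Some p0 -> (T p0).2 q -> (k <= m)%N ->
      \sum_(0 <= i < k.+1) phi i q * ff i q = \sum_(0 <= i < m.+1) phi i q * ff i q.
    move=> ck Tk km; rewrite [RHS](@big_cat_nat _ _ _ k.+1)//= [X in _ = _ + X]big1_seq ?addr0//.
    by move=> i /andP[_]; rewrite mem_index_iota => /andP[ki _]; rewrite (phi_far _ _ _ _ ck Tk ki) mul0r.
  rewrite /u; have [le|/ltnW le] := leqP n (N q).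
    by rewrite -(ext _ _ _ cn Tq le).
  by rewrite (ext _ _ _ cN TN le).
have loc q : U q -> exists W (r : seq nat) (c' : nat -> M) (psi : nat -> M -> R),
     [/\ open W /\ W `<=` U, W q,
         forall i, i \in r -> [/\ S (c' i), W `<=` D (c' i), smooth_fun atl W (psi i)
                                & forall z, W z -> 0 <= psi i z],
         forall z, W z -> \sum_(i <- r) psi i z = 1
       & forall z, W z -> u z = \sum_(i <- r) psi i z * f (c' i) z].
  move=> [n [p [cn Tq]]]; have [_ _ _ _ [oT _ b1]] := hT _ (cS _ _ cn).
  (* Near [q] only those indices are kept whose local function is defined at [q]. For the others [q]
     lies off the closed support of the bump, so [phi i] vanishes near [q]. *)
  pose good i := `[< exists2 p, c i = Some p & D p q >].
  pose P i V := if good i then forall p, c i = Some p -> V `<=` D p else forall z, V z -> phi i z = 0.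
  have [|i _|V [oV Vq PV]] := @open_seq_near q P n.+1.
  - by move=> i V W WV; rewrite /P; case: (good i) => h; [move=> p0 /h; exact: subset_trans|move=> z /WV /h].
  - rewrite /P /good; case: asboolP => [[p0 ci Dq]|nD].
      have [oD _ _] := H _ (cS _ _ ci).
      by exists (D p0); split=> // p1; rewrite ci => -[<-].
    case E : (c i) => [p0|]; last first.
      exists setT; split=> //; first exact: openT.
      by move=> z _; rewrite /phi /beta E mul0r.
    have [_ _ [cK KD] K0 _] := hT _ (cS _ _ E).
    exists (~` (T p0).1.2); split.
    + exact: closed_openC.
    + by move=> Kq; apply: nD; exists p0 => //; exact: KD.
    + by move=> z Kz; rewrite /phi /beta E K0// mul0r.
  pose c' i := if c i is Some p then p else q.
  have far i z : (i < n.+1)%N -> V z -> ~~ good i -> phi i z = 0.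
    by move=> /PV + Vz /negbTE gi; rewrite /P gi; apply.
  exists (V `&` (T p).2), [seq i <- index_iota 0 n.+1 | good i], c', phi; split.
  - split; first exact: openI.
    by move=> z [_ Tz]; exists n, p.
  - by [].
  - move=> i; rewrite mem_filter mem_index_iota => /andP[gi /= lin].
    have := gi; rewrite /good => /asboolP[p0 ci Dq]; rewrite /c' ci; split=> //.
    + exact: cS ci.
    + by move=> z [Vz _]; have := PV _ lin; rewrite /P gi => /(_ _ ci); apply.
    + exact: smooth_funW (sphi i).
  - move=> z [Vz Tz]; rewrite big_filter.
    have -> : \sum_(i <- index_iota 0 n.+1 | good i) phi i z = \sum_(0 <= i < n.+1) phi i z.
      rewrite big_mkcond big_nat_cond [RHS]big_nat_cond; apply: eq_bigr => i.
      by rewrite andbT /= => lin; case: ifPn => // ng; rewrite (far i).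
    rewrite sum_telescope_cut big_nat_recr//=.
    by rewrite {2}/beta cn b1// subrr mulr0 subr0.
  - move=> z [Vz Tz]; rewrite (uE _ _ _ cn Tz) big_filter.
    rewrite [RHS]big_mkcond [LHS]big_nat_cond [RHS]big_nat_cond; apply: eq_bigr => i.
    rewrite andbT /= => lin; case: ifPn => [/asboolP[p0 ci _]|ng].
      by rewrite /ff /c' ci.
    by rewrite (far i)// mul0r.
exists U, u; split=> //.
apply: smooth_fun_local => q /loc[W [r [c' [psi [[oW WU] Wq hr _ uW]]]]].
exists W; split=> //.
apply: (smooth_fun_eq oW (f := fun z => \sum_(i <- r | i \in r) psi i z * f (c' i) z)).
  by move=> z Wz; rewrite uW// [RHS]big_seq.
apply: smooth_fun_sum => // i /hr[Sc WD spsi _].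
by apply: smooth_funM => //; apply: smooth_funW WD _; have [] := H _ Sc.
Qed.

Definition regular_at f p := exists a i,
  [/\ atl a, dom a p & pderiv i (f \o cinv a) (cmap a p) != 0].

Lemma regular_change a b U f p i : is_chart a -> is_chart b -> smooth_transition a b ->
  open U -> U p -> dom a p -> dom b p -> smooth_on (img b U) (f \o cinv b) ->
  pderiv i (f \o cinv a) (cmap a p) != 0 ->
  exists j, pderiv j (f \o cinv b) (cmap b p) != 0.
Proof.
move=> ca cb tab oU Up ap bp sf; apply: contraNP => nE; apply/eqP.
have E j : pderiv j (f \o cinv b) (cmap b p) = 0.
  by apply: contrapT => /eqP h; apply: nE; exists j.
have oI : open (img a (dom b)) by apply: open_img => //; exact: chart_open_dom.
rewrite (pderiv_eq oI (g := fun x => (f \o cinv b) (transition a b x))); last 2 first.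
- by move=> x; rewrite inE => -[q [aq bq] <-] /=; rewrite transitionE// (chart_cancel ca)// (chart_cancel cb).
- by rewrite inE; exact: in_img.
rewrite pderiv_chain.
- by apply: big1 => j _; rewrite transitionE// E mulr0.
- by move=> j; apply: (smooth_on_diff (tab j)); exact: in_img.
- by rewrite transitionE//; apply: (smooth_on_diff sf); exact: in_img.
Qed.

Lemma regular_in_chart a U f p : atl a -> open U -> U p -> smooth_fun atl U f -> dom a p ->
  regular_at f p -> exists i, pderiv i (f \o cinv a) (cmap a p) != 0.
Proof.
move=> aa oU Up sf ap [b [i [bb bp fi]]].
have ca := atlas_chart hM aa; have cb := atlas_chart hM bb.
exact: (regular_change cb ca (atlas_smooth hM bb aa) oU Up bp ap (sf a aa) fi).
Qed.

Lemma pow_mul_cancel_fun U s h m p : open U -> U p -> smooth_fun atl U s -> smooth_fun atl U h ->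
  s p = 0 -> regular_at s p -> (forall q, U q -> s q ^+ m * h q = 0) -> h p = 0.
Proof.
move=> oU Up ss sh sp0 [a [i [aa ap si]]] E; have ca := atlas_chart hM aa.
have := @pow_mul_cancel R d (img a U) (s \o cinv a) (h \o cinv a) m i (cmap a p).
rewrite /= (chart_cancel ca)//; apply=> //.
- exact: open_img.
- exact: ss.
- exact: sh.
- exact: in_img.
- by move=> _ [q [aq Uq] <-]; rewrite (chart_cancel ca)// E.
Qed.

(** At a zero of [s] the differential of [t] is [h] times that of [s]. *)
Lemma regular_mul U t s h p : open U -> U p -> smooth_fun atl U s -> smooth_fun atl U h ->
  (forall q, U q -> t q = s q * h q) -> s p = 0 -> regular_at t p -> h p != 0 /\ regular_at s p.
Proof.
move=> oU Up ss sh tE sp0 [a [i [aa ap ti]]]; have ca := atlas_chart hM aa.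
have E : pderiv i (t \o cinv a) (cmap a p) = h p * pderiv i (s \o cinv a) (cmap a p).
  rewrite (pderiv_eq (open_img ca oU) (g := fun x => (s \o cinv a) x * (h \o cinv a) x)); last 2 first.
  - by move=> x; rewrite inE => -[q [aq Uq] <-] /=; rewrite (chart_cancel ca)// tE.
  - by rewrite inE; exact: in_img.
  rewrite pderivM; last 2 first.
  - by apply: (smooth_on_diff (ss a aa)); exact: in_img.
  - by apply: (smooth_on_diff (sh a aa)); exact: in_img.
  by rewrite /= (chart_cancel ca)// sp0 mul0r addr0 mulrC.
move: ti; rewrite E mulf_eq0 negb_or => /andP[h0 s0]; split=> //.
by exists a, i.
Qed.

(* Off the zero set the quotient is forced; on it, it is determined by [pow_mul_cancel_fun]. *)
Lemma divide_pow m U s F : open U -> smooth_fun atl U s -> smooth_fun atl U F ->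
  (forall p, U p -> s p = 0 -> regular_at s p) ->
  (forall p, U p -> s p = 0 -> exists V h, [/\ open V, V p, V `<=` U, smooth_fun atl V h &
     forall q, V q -> F q = s q ^+ m * h q]) ->
  exists2 h, smooth_fun atl U h & forall q, U q -> F q = s q ^+ m * h q.
Proof.
move=> oU ss sF rs loc.
have /choice[T hT] : forall p, exists T : set M * (M -> R), U p ->
    [/\ open T.1, T.1 p, T.1 `<=` U, smooth_fun atl T.1 T.2 &
     forall q, T.1 q -> F q = s q ^+ m * T.2 q].
  move=> p; have [Up|Up] := pselect (U p); last by exists (U, s).
  have [sp0|/eqP sp0] := pselect (s p = 0).
    by have [V [h ?]] := loc p Up sp0; exists (V, h).
  have oV := smooth_fun_open_neq0 oU ss.
  exists (U `&` [set q | s q != 0], fun q => F q / s q ^+ m); split=> //=.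
  - apply: smooth_funM => //; first by apply: smooth_funW sF => q [].
    apply: smooth_funV => //; last by move=> q [_ sq]; rewrite expf_neq0.
    by apply: smooth_funX => //; apply: smooth_funW ss => q [].
  - by move=> q [_ sq]; rewrite mulrC divfK// expf_neq0.
have hE p q : U p -> (T p).1 q -> (T q).2 q = (T p).2 q.
  move=> Up Tpq; have [oV Vp VU sh Fh] := hT p Up.
  have Uq := VU _ Tpq; have [oW Wq WU sk Fk] := hT q Uq.
  have [sq0|/eqP sq0] := pselect (s q = 0); last first.
    by apply: (mulfI (expf_neq0 m sq0)); rewrite -Fh// -Fk.
  have oVW := openI oV oW.
  apply/eqP; rewrite -subr_eq0; apply/eqP.
  apply: (pow_mul_cancel_fun (m := m) oVW (h := fun z => (T q).2 z - (T p).2 z) _ _ _ sq0) => //.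
  - by apply: smooth_funW ss => z [/VU].
  - by apply: smooth_funB => //; [apply: smooth_funW sk => z []|apply: smooth_funW sh => z []].
  - exact: rs.
  - by move=> z [Vz Wz]; rewrite mulrBr -Fh// -Fk// subrr.
exists (fun q => (T q).2 q); last by move=> q Uq; have [_ Tq _ _ ->] := hT q Uq.
apply: smooth_fun_local => p Up; have [oV Vp VU sh Fh] := hT p Up.
exists (T p).1; split=> //; apply: (smooth_fun_eq oV _ sh) => q Tq.
by rewrite (hE p q).
Qed.

(** * Division by a defining function of a hypersurface *)

Variable Sigma : set M.

Lemma slice_compatible phi k : slice_chart atl Sigma phi k -> compatible phi.
Proof. by case=> cp tp _; split=> // b /tp[]. Qed.

Lemma slice_coord_regular phi k p : slice_chart atl Sigma phi k -> dom phi p ->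
  regular_at (fun q => cmap phi q 0 k) p.
Proof.
move=> sl pp; have [cp tp] := slice_compatible sl.
have op := chart_open_dom cp; have oI := open_img cp op.
have [b bb bp] := atlas_cover hM p; have cb := atlas_chart hM bb.
have [||j] := @regular_change phi b (dom phi) (fun q => cmap phi q 0 k) p k cp cb (tp b bb).1 op pp pp bp.
- exact: (smooth_fun_cmap k (conj cp tp)).
- rewrite (pderiv_eq oI (g := fun x => x 0 k)); last 2 first.
  + by move=> x; rewrite inE => -[q [pq _] <-] /=; rewrite (chart_cancel cp).
  + by rewrite inE; exact: in_img.
  by rewrite pderiv_coord eqxx oner_eq0.
- by exists b, j.
Qed.

Lemma slice_divide phi k U F p : slice_chart atl Sigma phi k -> dom phi p -> Sigma p ->
  open U -> U p -> smooth_fun atl U F -> (forall q, U q -> Sigma q -> F q = 0) ->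
  exists V h, [/\ open V, V p, V `<=` U `&` dom phi, smooth_fun atl V h &
    forall q, V q -> F q = cmap phi q 0 k * h q].
Proof.
move=> sl pp Sp oU Up sF F0; have cc := slice_compatible sl; have [cp tp] := cc.
have slE := let: And3 _ _ h := sl in h.
have oI := open_img cp oU.
have [|V [h [oV Vp VI sh Fh]]] := @hadamard_hyperplane R d k (img phi U) (F \o cinv phi) (cmap phi p) oI (in_img pp Up)
   ((slE p pp).1 Sp) (smooth_in_chart cc oU sF).
  by move=> _ [q [pq Uq] <-] q0; rewrite /= (chart_cancel cp)// F0//; apply/slE.
have oW := open_preimg cp oV.
have WU : dom phi `&` cmap phi @^-1` V `<=` U.
  by move=> q [pq /VI[z [pz Uz] E]]; rewrite -(chart_cancel cp pq) -E (chart_cancel cp).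
exists (dom phi `&` cmap phi @^-1` V), (h \o cmap phi); split=> //.
- by move=> q Wq; split; [exact: WU|case: Wq].
- apply: (smooth_fun_of_chart cc) => //.
  apply: (smooth_on_eq (f := h)); first exact: open_img.
    by move=> x; rewrite inE => -[q [pq _] <-] /=; rewrite (chart_cancel cp).
  by apply: smooth_onW sh => _ [q [_ [_ Vq]] <-].
- by move=> q [pq Vq] /=; rewrite -Fh//= (chart_cancel cp).
Qed.

Hypothesis emb : embedded_hypersurface atl Sigma.

(** Both [F] and [s] are multiples of the slice coordinate, and the cofactor of [s] is nonzero at
    [p] by regularity, so the cofactors can be divided. *)
Lemma defining_divide U s F p : open U -> U p -> Sigma p -> smooth_fun atl U s ->
  (forall q, U q -> Sigma q -> s q = 0) -> regular_at s p ->
  smooth_fun atl U F -> (forall q, U q -> Sigma q -> F q = 0) ->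
  exists V h, [/\ open V, V p, V `<=` U, smooth_fun atl V h & forall q, V q -> F q = s q * h q].
Proof.
move=> oU Up Sp ss s0 rs sF F0; have [phi [k [sl pp]]] := emb Sp.
have [V1 [h1 [oV1 V1p V1U sh1 E1]]] := slice_divide sl pp Sp oU Up sF F0.
have [V2 [h2 [oV2 V2p V2U sh2 E2]]] := slice_divide sl pp Sp oU Up ss s0.
have slE := let: And3 _ _ h := sl in h.
have oV := openI oV1 oV2.
have st : smooth_fun atl V2 (fun q => cmap phi q 0 k).
  by apply: smooth_funW (smooth_fun_cmap k (slice_compatible sl)) => q /V2U[].
have [h20 _] := regular_mul oV2 V2p st sh2 E2 ((slE p pp).1 Sp) rs.
have oW := smooth_fun_open_neq0 oV2 sh2.
have oX := openI oV1 oW.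
exists (V1 `&` (V2 `&` [set q | h2 q != 0])), (fun q => h1 q / h2 q); split=> //.
- by move=> q [/V1U[]].
- apply: smooth_funM => //; first by apply: smooth_funW sh1 => q [].
  by apply: smooth_funV => //; [apply: smooth_funW sh2 => q [_ []]|move=> q [_ []]].
- move=> q [V1q [V2q hq]]; rewrite (E1 _ V1q) (E2 _ V2q).
  by rewrite -mulrA [h2 q * _]mulrC divfK.
Qed.

Definition defining U s := [/\ open U, Sigma `<=` U, smooth_fun atl U s,
  forall p, U p -> (s p = 0 <-> Sigma p) & forall p, Sigma p -> regular_at s p].

Lemma defining_regular U s p : defining U s -> U p -> s p = 0 -> regular_at s p.
Proof. by move=> [_ _ _ zs rs] Up /(zs p Up)/rs. Qed.

Lemma defining_divide1 U s F : defining U s -> smooth_fun atl U F ->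
  (forall q, Sigma q -> F q = 0) ->
  exists2 h, smooth_fun atl U h & forall q, U q -> F q = s q * h q.
Proof.
move=> ds sF F0; have [oU SU ss zs rs] := ds.
have [| |h sh E] := @divide_pow 1 U s F oU ss sF.
- by move=> p; exact: defining_regular.
- move=> p Up sp0; have Sp : Sigma p by apply/(zs p Up).
  have [||V [h H]] := @defining_divide U s F p oU Up Sp ss _ (rs p Sp) sF.
  + by move=> q Uq Sq; apply/zs.
  + by move=> q _; exact: F0.
  by exists V, h.
- by exists h => // q Uq; rewrite E.
Qed.

Lemma defining_cancel U s h m p : defining U s -> smooth_fun atl U h -> Sigma p ->
  (forall q, U q -> s q ^+ m * h q = 0) -> h p = 0.
Proof.
move=> [oU SU ss zs rs] sh Sp E.
apply: (pow_mul_cancel_fun oU _ ss sh _ _ E); [exact: SU| |exact: rs].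
by apply/zs => //; exact: SU.
Qed.

Lemma definingW U V s : open V -> Sigma `<=` V -> V `<=` U -> defining U s -> defining V s.
Proof.
move=> oV SV VU [_ _ ss zs rs]; split=> //; first exact: smooth_funW ss.
by move=> p /VU; exact: zs.
Qed.

Lemma convex_sum_gt0 (r : seq nat) (a t : nat -> R) : (forall i, i \in r -> 0 <= a i) ->
  \sum_(i <- r) a i = 1 -> (forall i, i \in r -> 0 < t i) -> 0 < \sum_(i <- r) a i * t i.
Proof.
move=> a0 a1 t0; have /hasP[j jr aj] : has (fun i => a i != 0) r.
  apply/negPn/negP => /hasPn n; move: a1.
  rewrite big_seq big1 => [/eqP|i /n/negPn/eqP//]; by rewrite eq_sym oner_eq0.
rewrite (big_rem j)//= ltr_wpDr//.
  by rewrite big_seq; apply: sumr_ge0 => i /mem_rem ir; rewrite mulr_ge0 ?a0// ltW// t0.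
by rewrite mulr_gt0 ?t0// lt0r aj a0.
Qed.

Lemma open_seq_near_mem q (r : seq nat) (Q : nat -> set M -> Prop) :
  (forall i V W, W `<=` V -> Q i V -> Q i W) ->
  (forall i, i \in r -> exists V, [/\ open V, V q & Q i V]) ->
  exists V, [/\ open V, V q & forall i, i \in r -> Q i V].
Proof.
move=> QW H; have [i V W WV QV ir|i _|V [oV Vq QV]] :=
    @open_seq_near q (fun i V => i \in r -> Q i V) (\max_(i <- r) i).+1.
- exact: QW (QV ir).
- have [ir|ir] := boolP (i \in r); last by exists setT; split=> //; exact: openT.
  by have [V [? ? ?]] := H i ir; exists V.
- exists V; split=> // i ir; apply: QV => //; rewrite ltnS.
  exact: (leq_bigmax_seq (F := id)).
Qed.

(** * Existence of a defining function with prescribed positive side *)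

Variable P : set M.
Hypothesis sideP : positive_side atl Sigma P.

(** Slice coordinates that are positive on [P] are glued. The sign conditions are convex. For the
    differential, near a point of [Sigma] all the coordinates involved are multiples of one of them
    by factors that are positive at that point, so their convex combination is regular there. *)
Lemma exists_defining : exists U s, defining U s /\ forall p, U p -> (0 < s p <-> P p).
Proof.
have /choice[T hT] : forall p, exists T : chart R d M * option 'I_d, Sigma p -> exists k,
    [/\ T.2 = Some k, slice_chart atl Sigma T.1 k, dom T.1 p
      & forall q, dom T.1 q -> (P q <-> 0 < cmap T.1 q 0 k)].
  move=> p; have [Sp|Sp] := pselect (Sigma p).
    by have [phi [k [sl pp hP]]] := sideP Sp; exists (phi, Some k) => _; exists k.
  have [a _ _] := atlas_cover hM p.
  by exists (a, None).
pose t p q := if (T p).2 is Some k then cmap (T p).1 q 0 k else 0.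
have tS p q : Sigma p -> dom (T p).1 q -> (Sigma q <-> t p q = 0).
  move=> /hT[k [Tk [_ _ sl] _ _]] pq; rewrite /t Tk; exact: sl.
have tP p q : Sigma p -> dom (T p).1 q -> (P q <-> 0 < t p q).
  by move=> /hT[k [Tk _ _ sl]] pq; rewrite /t Tk; exact: sl.
have ts p : Sigma p -> smooth_fun atl (dom (T p).1) (t p).
  move=> /hT[k [Tk sl _ _]]; rewrite /t Tk; apply: smooth_fun_cmap; exact: slice_compatible sl.
have [p Sp|U [u [oU SU su loc]]] := @glue Sigma (fun p => dom (T p).1) t.
  have [k [Tk [cp _ _] pp _]] := hT p Sp; split=> //; [exact: chart_open_dom|exact: ts].
have sgn q : U q -> [/\ P q -> 0 < u q, Sigma q -> u q = 0 & ~ P q -> ~ Sigma q -> u q < 0].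
  move=> /loc[W [r [c [psi [[oW WU] Wq hr psi1 uE]]]]].
  have psi0 i : i \in r -> 0 <= psi i q by move=> /hr[_ _ _]; exact.
  have Dq i : i \in r -> Sigma (c i) /\ dom (T (c i)).1 q.
    by move=> /hr[Sc WD _ _]; split=> //; exact: WD.
  rewrite (uE _ Wq); split=> [Pq|Sq|nP nS].
  - apply: (convex_sum_gt0 (a := psi ^~ q) (t := fun i => t (c i) q)) => //.
      exact: psi1.
    by move=> i /Dq[Sc Dc]; apply/tP.
  - rewrite big_seq big1// => i /Dq[Sc Dc]; rewrite (_ : t _ _ = 0) ?mulr0//.
    by apply/tS.
  - rewrite -oppr_gt0 -sumrN.
    under eq_bigr do rewrite -mulrN.
    apply: (convex_sum_gt0 (a := psi ^~ q) (t := fun i => - t (c i) q)) => //.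
      exact: psi1.
    move=> i /Dq[Sc Dc]; rewrite oppr_gt0 lt_neqAle; apply/andP; split.
      by apply/eqP => /tS h; apply: nS; exact: h.
    by rewrite leNgt; apply/negP => /tP h; apply: nP; exact: h.
exists U, u; split; last first.
  move=> q Uq; have [s1 s2 s3] := sgn q Uq; split=> // uq.
  apply: contrapT => nP; have [Sq|nS] := pselect (Sigma q).
    by move: uq; rewrite s2// ltxx.
  by move: uq; rewrite ltNge ltW// s3.
split=> //.
  move=> q Uq; have [s1 s2 s3] := sgn q Uq; split=> // uq; apply: contrapT => nS.
  have [Pq|nP] := pselect (P q); first by move: (s1 Pq); rewrite uq ltxx.
  by move: (s3 nP nS); rewrite uq ltxx.
move=> q Sq; have [W [r [c [psi [[oW WU] Wq hr psi1 uE]]]]] := loc q (SU q Sq).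
have [k [Tk sl qq tkP]] := hT q Sq.
pose D := dom (T q).1 `&` W.
have oD : open D by apply: openI => //; apply: chart_open_dom; case: (sl).
pose Q i V := exists2 h, smooth_fun atl V h & forall z, V z -> t (c i) z = t q z * h z.
have tqE z : t q z = cmap (T q).1 z 0 k by rewrite /t Tk.
have [i V V' VV' [h sh E]|i /hr[Sc WD _ _]|V [oV Vq QV]] := @open_seq_near_mem q r Q.
- by exists h; [exact: smooth_funW sh|move=> z /VV'; exact: E].
- have [||V [h [oV Vq VD sh E]]] := slice_divide sl qq Sq (F := t (c i)) oW Wq.
  + by apply: smooth_funW (ts _ Sc).
  + by move=> z Wz Sz; apply/tS => //; exact: WD.
  by exists V; split=> //; exists h => // z Vz; rewrite tqE E.
have /choice[h hh] : forall i, exists h, i \in r -> smooth_fun atl V h /\ forall z, V z -> t (c i) z = t q z * h z.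
  move=> i; have [/QV[h sh E]|_] := boolP (i \in r); first by exists h.
  by exists (fun=> 0).
pose Y := V `&` D.
have oY : open Y by exact: openI.
have Yq : Y q by [].
have YV : Y `<=` V by move=> z [].
have YW : Y `<=` W by move=> z [_ []].
have st : smooth_fun atl Y (t q) by apply: smooth_funW (ts _ Sq) => z [_ []].
have shY i : i \in r -> smooth_fun atl Y (h i) by move=> /hh[sh _]; exact: smooth_funW sh.
have tq0 : t q q = 0 by apply/(tS q q Sq qq).
have rt : regular_at (t q) q.
  by have := slice_coord_regular sl qq; congr regular_at; apply/funext => z; rewrite tqE.
(* The factor is nonzero by regularity. Where it is negative, [t q] and [t (c i)] have opposite
   signs, which is impossible off [Sigma]; were it negative at [q], [t q ^+ 2 * h i] would vanish
   near [q] and force [h i q = 0]. *)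
have hpos i : i \in r -> 0 < h i q.
  move=> ir; have [Sc WD _ _] := hr i ir; have [_ E] := hh i ir.
  have ri : regular_at (t (c i)) q.
    have [k' [Tk' sl' _ _]] := hT _ Sc.
    have := slice_coord_regular sl' (WD _ Wq); congr regular_at.
    by apply/funext => z; rewrite /t Tk'.
  have [hi0 _] := regular_mul oY Yq st (shY i ir) (fun z Yz => E z (YV z Yz)) tq0 ri.
  rewrite lt_neqAle eq_sym hi0 leNgt /=; apply/negP => hneg; move/eqP: hi0; apply.
  have oN := smooth_fun_open_gt0 oY (smooth_funN oY (shY i ir)).
  apply: (pow_mul_cancel_fun (m := 2) oN _ _ _ tq0 rt).
  - by split=> //=; rewrite oppr_gt0.
  - by apply: smooth_funW st => z [].
  - by apply: smooth_funW (shY i ir) => z [].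
  move=> z [Yz /= hz]; rewrite oppr_gt0 in hz.
  have Ez := E z (YV z Yz); have Dz : dom (T q).1 z by case: Yz => _ [].
  have Dz' := WD z (YW z Yz).
  have [Pz|nP] := pselect (P z).
    have a1 : 0 < t q z by apply/tP.
    have : 0 < t (c i) z by apply/tP.
    by rewrite Ez pmulr_rgt0// ltNge ltW.
  have [Sz|nS] := pselect (Sigma z).
    by rewrite (_ : t q z = 0) ?expr0n ?mul0r//; apply/tS.
  have neg p : Sigma p -> dom (T p).1 z -> t p z < 0.
    move=> Sp Dp; rewrite lt_neqAle leNgt; apply/andP; split.
      by apply/eqP => /tS e; apply: nS; exact: e.
    by apply/negP => /tP e; apply: nP; exact: e.
  have := neg _ Sc Dz'; rewrite Ez nmulr_rlt0 ?neg//.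
  by rewrite ltNge ltW.
pose H z := \sum_(i <- r) psi i z * h i z.
have sH : smooth_fun atl Y H.
  apply: (smooth_fun_eq oY (f := fun z => \sum_(i <- r | i \in r) psi i z * h i z)).
    by move=> z _; rewrite /H [RHS]big_seq.
  apply: smooth_fun_sum => // i ir; apply: smooth_funM => //; last exact: shY.
  by have [_ _ sp _] := hr i ir; exact: smooth_funW sp.
have Hq : 0 < H q.
  apply: (convex_sum_gt0 (a := psi ^~ q) (t := fun i => h i q)) => //.
    by move=> i /hr[_ _ _]; exact.
  exact: psi1.
have oZ := smooth_fun_open_neq0 oY sH.
(* Near [q] the glued function is [t q * H], so the regular function [t q] is a multiple of it, with
   cofactor the inverse of [H]. *)
apply: (regular_mul oZ (t := t q) (h := fun z => (H z)^-1) _ _ _ _ _ rt).2.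
- by split=> //=; rewrite gt_eqF.
- by apply: smooth_funW su => z [/YW/WU].
- by apply: smooth_funV => //; [apply: smooth_funW sH => z []|move=> z []].
- move=> z [Yz /= Hz]; rewrite uE; last exact: YW.
  have -> : \sum_(i <- r) psi i z * t (c i) z = t q z * H z.
    rewrite /H mulr_sumr big_seq [RHS]big_seq; apply: eq_bigr => i ir.
    by rewrite (hh i ir).2; [rewrite mulrCA|exact: YV].
  by rewrite mulfK.
- by have [_ ->] := sgn q (SU q Sq).
Qed.

End ManifoldCalculus.

(** * S on a manifold *)

Section Germs.
Variables (R : realType) (d : nat) (O : set 'rV[R]_d) (G H : 'rV[R]_d -> 'M[R]_d).
Hypotheses (oO : open O) (GH : forall x, O x -> G x = H x).
Implicit Types (i j k : 'I_d) (u v : 'rV[R]_d -> R) (x y : 'rV[R]_d).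

Let cD (a b a' b' : R) : a = a' -> b = b' -> a + b = a' + b'. Proof. by move=> -> ->. Qed.
Let cB (a b a' b' : R) : a = a' -> b = b' -> a - b = a' - b'. Proof. by move=> -> ->. Qed.
Let cM (a b a' b' : R) : a = a' -> b = b' -> a * b = a' * b'. Proof. by move=> -> ->. Qed.

Let pderiv_congr i u v x : (forall y, O y -> u y = v y) -> O x -> pderiv i u x = pderiv i v x.
Proof.
by move=> uv Ox; apply: (pderiv_eq oO); rewrite ?inE// => y; rewrite inE => /uv.
Qed.

Lemma christoffel_congr k i j x : O x -> christoffel G k i j x = christoffel H k i j x.
Proof.
move=> Ox; rewrite /christoffel GH//; congr (_ * _); apply: eq_bigr => l _; congr (_ * _).
congr (_ + _ - _); apply: pderiv_congr => // y Oy; by rewrite GH.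
Qed.

Lemma ricci_congr i j x : O x -> ricci G i j x = ricci H i j x.
Proof.
move=> Ox; have E k a b y : O y -> christoffel G k a b y = christoffel H k a b y.
  exact: christoffel_congr.
apply: cD; apply: eq_bigr => k _.
  by apply: cB; apply: pderiv_congr => // y; exact: E.
by apply: eq_bigr => l _; rewrite !E.
Qed.

Lemma S_curvature_congr u v x : (forall y, O y -> u y = v y) -> O x ->
  S_curvature G u x = S_curvature H v x.
Proof.
move=> uv Ox; have pE i y : O y -> pderiv i u y = pderiv i v y by exact: pderiv_congr.
apply: cB.
  by apply: eq_bigr => i _; apply: eq_bigr => j _; rewrite GH// !pE.
apply: cM; first by rewrite uv.
apply: cD; last first.
  have -> : scalar_curvature G x = scalar_curvature H x.
    by apply: eq_bigr => i _; apply: eq_bigr => j _; rewrite (GH Ox) (ricci_congr i j Ox).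
  by rewrite uv.
apply: eq_bigr => i _; apply: eq_bigr => j _; rewrite (GH Ox); congr (_ * _); apply: cB.
  by apply: pderiv_congr => // y; exact: pE.
by apply: eq_bigr => k _; rewrite pE// christoffel_congr.
Qed.

End Germs.

(** * S as an operator on functions on the manifold *)

Section CurvatureOnManifold.
Variables (R : realType) (d : nat) (M : topologicalType) (atl : set (chart R d M)).
Hypothesis hM : oriented_manifold atl.
Variable g : metric_field R d M.
Hypothesis hg : is_metric atl g.
Implicit Types (a b : chart R d M) (U V W : set M) (f u v s e h : M -> R) (p q : M).

Local Notation img a U := (cmap a @` (dom a `&` U)).

Lemma metric_on_chart a : atl a -> [/\ open (cod a), smooth_mx (cod a) (g a),
  forall x, cod a x -> g a x \in unitmx & forall x, cod a x -> (g a x)^T = g a x].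
Proof.
move=> aa; split.
- exact: chart_open_cod (atlas_chart hM aa).
- by move=> i j; exact: (metric_smooth hg).
- by move=> x cx; apply: posdef_unitmx => v; exact: (metric_posdef hg).
- by move=> x cx; exact: (Defs.metric_sym hg aa cx).
Qed.

Lemma img_cod a U : img a U `<=` cod a.
Proof. by move=> _ [p [ap _] <-]; exists p. Qed.

Let metric_on_img a U : atl a -> open U -> [/\ open (img a U), smooth_mx (img a U) (g a),
  forall x, img a U x -> g a x \in unitmx & forall x, img a U x -> (g a x)^T = g a x].
Proof.
move=> aa oU; have [oc sg ug symg] := metric_on_chart aa; split.
- exact: (open_img (atlas_chart hM aa)).
- by move=> i j; apply: smooth_onW (sg i j); exact: img_cod.
- by move=> x /img_cod; exact: ug.
- by move=> x /img_cod; exact: symg.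
Qed.

Lemma S_curvature_change_chart a b U u p : atl a -> atl b -> open U -> smooth_fun atl U u ->
  U p -> dom a p -> dom b p ->
  S_curvature (g a) (u \o cinv a) (cmap a p) = S_curvature (g b) (u \o cinv b) (cmap b p).
Proof.
move=> aa bb oU su Up ap bp; have ca := atlas_chart hM aa; have cb := atlas_chart hM bb.
have oV : open (dom b `&` U) by apply: openI => //; exact: chart_open_dom.
have [oO sO uO symO] := metric_on_img aa oV.
have [oO' sO' uO' symO'] := metric_on_img bb oU.
pose phi := transition a b.
have sphi : smooth_map_on (img a (dom b `&` U)) phi.
  move=> j; apply: smooth_onW (atlas_smooth hM aa bb j) => _ [q [aq [bq _]] <-].
  by exists q.
have phiO x : img a (dom b `&` U) x -> img b U (phi x).
  by move=> [q [aq [bq Uq]] <-]; rewrite /phi transitionE//; exact: in_img.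
have xO : img a (dom b `&` U) (cmap a p) by exact: in_img.
rewrite -(transitionE b ca ap) -/phi.
rewrite -(S_curvature_pullback oO oO' sphi phiO sO uO symO sO' uO' symO' _ (su b bb) xO).
  apply: (S_curvature_congr oO) => // _ [q [aq [bq Uq]] <-].
  by rewrite /phi transitionE// /= (chart_cancel ca)// (chart_cancel cb).
move=> x xO2; have df : differentiable phi x.
  by apply: differentiable_row => j; exact: (smooth_on_diff (sphi j)).
have [q [aq [bq Uq]] E] := xO2.
rewrite -E in df *; rewrite /phi [transition _ _ _]transitionE// -/phi (metric_tensor hg aa bb aq bq).
have -> : jacobian (transition a b) (cmap a q) = jac phi (cmap a q).
  by apply/matrixP => i j; rewrite jacobianE// mxE.
by [].
Qed.

(** The chart at [p] is an arbitrary choice; [S_funE] shows that it does not matter when [u] is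
    smooth near [p]. *)
Definition S_fun u p : R :=
  let a := s2val (cid2 (atlas_cover hM p)) in S_curvature (g a) (u \o cinv a) (cmap a p).

Lemma S_funE a U u p : atl a -> open U -> smooth_fun atl U u -> U p -> dom a p ->
  S_curvature (g a) (u \o cinv a) (cmap a p) = S_fun u p.
Proof.
move=> aa oU su Up ap; rewrite /S_fun; case: cid2 => b bb bp /=.
exact: (S_curvature_change_chart aa bb oU).
Qed.

Lemma S_fun_congr U u v p : open U -> (forall q, U q -> u q = v q) -> U p -> S_fun u p = S_fun v p.
Proof.
move=> oU uv Up; rewrite /S_fun; case: cid2 => b bb bp /=; have cb := atlas_chart hM bb.
apply: (S_curvature_congr (open_img cb oU)) => //; last exact: in_img.
by move=> _ [q [bq Uq] <-]; rewrite /= (chart_cancel cb)// uv.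
Qed.

Lemma smooth_S_fun U u : open U -> smooth_fun atl U u -> smooth_fun atl U (S_fun u).
Proof.
move=> oU su a aa; have [oI sI uI symI] := metric_on_img aa oU.
apply: (smooth_on_eq oI (f := S_curvature (g a) (u \o cinv a))); last exact: (smooth_S_curvature oI sI uI (su a aa)).
move=> x; rewrite inE => -[q [aq Uq] <-] /=.
by rewrite (chart_cancel (atlas_chart hM aa))// (S_funE aa oU).
Qed.

(** The remainders [Q] come from coordinate formulas and are not claimed to agree between charts;
    the uniqueness contained in [divide_pow] makes them one function. *)
Lemma divide_in_charts m U s F : open U -> smooth_fun atl U s -> smooth_fun atl U F ->
  (forall p, U p -> s p = 0 -> regular_at atl s p) ->
  (forall a, atl a -> exists2 Q, smooth_on (img a U) Q & forall p, dom a p -> U p ->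
     F p = s p ^+ m * Q (cmap a p)) ->
  exists2 h, smooth_fun atl U h & forall q, U q -> F q = s q ^+ m * h q.
Proof.
move=> oU ss sF rs loc; apply: (divide_pow hM) => // p Up _.
have [a aa ap] := atlas_cover hM p; have ca := atlas_chart hM aa.
have [Q sQ E] := loc a aa; have oV : open (dom a `&` U) by apply: openI => //; exact: chart_open_dom.
exists (dom a `&` U), (Q \o cmap a); split=> //; last by move=> q [aq Uq]; exact: E.
apply: (smooth_fun_of_chart hM (atlas_compatible hM aa)) => //.
apply: (smooth_on_eq (f := Q)); first exact: open_img.
  by move=> x; rewrite inE => -[q [aq _] <-] /=; rewrite (chart_cancel ca).
by apply: smooth_onW sQ => _ [q [aq [_ Uq]] <-]; exact: in_img.
Qed.

Lemma S_fun_mul U s h : open U -> smooth_fun atl U s -> smooth_fun atl U h ->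
  (forall p, U p -> s p = 0 -> regular_at atl s p) ->
  exists2 q, smooth_fun atl U q & forall p, U p ->
    S_fun (fun z => s z * h z) p = h p ^+ 2 * S_fun s p + s p * q p.
Proof.
move=> oU ss sh rs; have ssh : smooth_fun atl U (fun z => s z * h z) by exact: smooth_funM.
have [| |q sq E] := @divide_in_charts 1 U s (fun p => S_fun (fun z => s z * h z) p - h p ^+ 2 * S_fun s p) oU ss _ rs.
- apply: (smooth_funB hM) => //; first exact: smooth_S_fun.
  by apply: (smooth_funM hM) => //; [exact: (smooth_funX hM)|exact: smooth_S_fun].
- move=> a aa; have ca := atlas_chart hM aa; have [oI sI uI symI] := metric_on_img aa oU.
  have [q1 sq1 E1] := S_curvature_grad oI sI uI (ss a aa).
  have [q2 sq2 E2] := S_curvature_grad oI sI uI (ssh a aa).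
  have [q3 sq3 E3] := grad_sqnorm_mul oI sI uI symI (ss a aa) (sh a aa).
  exists (fun x => q3 x + h (cinv a x) * q2 x - h (cinv a x) ^+ 2 * q1 x).
    apply: (smooth_onB oI); last by apply: (smooth_onM oI) => //; exact: (smooth_onX 2 oI (sh a aa)).
    by apply: (smooth_onD oI) => //; apply: (smooth_onM oI) => //; exact: (sh a aa).
  move=> p ap Up; have Ix : img a U (cmap a p) by exact: in_img.
  rewrite -(S_funE aa oU ssh Up ap) -(S_funE aa oU ss Up ap) E2// E1//.
  have -> : grad_sqnorm (g a) ((fun z => s z * h z) \o cinv a) (cmap a p) =
    grad_sqnorm (g a) (fun y => (s \o cinv a) y * (h \o cinv a) y) (cmap a p) by [].
  rewrite E3// /= (chart_cancel ca)//; ring.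
exists q => // p Up; have := E p Up; rewrite expr1 => <-; ring.
Qed.

Hypothesis d0 : (0 < d)%N.

(** The coefficient 2k(d+1-k)/d for [k = m.+2], which builds in k >= 2 and keeps the exponents k-1
    and k-2 free of truncated subtraction. *)
Definition step_coef (m : nat) : R := 2 * m.+2%:R * (d.+1%:R - m.+2%:R) / d%:R.

Lemma S_fun_step U s e f (q0 : M -> R) m : open U -> smooth_fun atl U s -> smooth_fun atl U e ->
  smooth_fun atl U f -> smooth_fun atl U q0 ->
  (forall p, U p -> s p = 0 -> regular_at atl s p) ->
  (forall p, U p -> S_fun s p = 1 + s p * q0 p) ->
  exists2 Q, smooth_fun atl U Q & forall p, U p ->
    S_fun (fun z => s z + s z ^+ 2 * e z + s z ^+ m.+2 * f z) p =
    S_fun (fun z => s z + s z ^+ 2 * e z) p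
    + step_coef m * f p * s p ^+ m.+1 + s p ^+ m.+2 * Q p.
Proof.
move=> oU ss se sf sq rs Ss.
have sv : smooth_fun atl U (fun z => s z + s z ^+ 2 * e z).
  by apply: (smooth_funD hM) => //; apply: (smooth_funM hM) => //; exact: (smooth_funX hM).
have sw : smooth_fun atl U (fun z => s z + s z ^+ 2 * e z + s z ^+ m.+2 * f z).
  by apply: (smooth_funD hM) => //; apply: (smooth_funM hM) => //; exact: (smooth_funX hM).
have [| |q sq' E] := @divide_in_charts m.+2 U s
    (fun p => S_fun (fun z => s z + s z ^+ 2 * e z + s z ^+ m.+2 * f z) p
      - S_fun (fun z => s z + s z ^+ 2 * e z) p - step_coef m * f p * s p ^+ m.+1) oU ss _ rs.
- apply: (smooth_funB hM) => //; first by apply: (smooth_funB hM) => //; exact: smooth_S_fun.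
  apply: (smooth_funM hM) => //; last exact: (smooth_funX hM).
  by apply: (smooth_funM hM) => //; exact: smooth_fun_cst.
- move=> a aa; have ca := atlas_chart hM aa; have [oI sI uI symI] := metric_on_img aa oU.
  have [q1 sq1 E1] := S_curvature_grad oI sI uI (ss a aa).
  have sQ0 : smooth_on (img a U) (fun x => q0 (cinv a x) - q1 x).
    by apply: (smooth_onB oI) => //; exact: (sq a aa).
  have [|Q sQ E2] := S_curvature_step oI sI uI symI m (ss a aa) (sf a aa) (se a aa) sQ0 _ d0.
    move=> _ [p [ap Up] <-]; have := E1 _ (in_img ap Up); rewrite (S_funE aa oU ss Up ap) (Ss _ Up).
    by rewrite /= (chart_cancel ca)// => E1'; move: E1' => /eqP; rewrite -subr_eq => /eqP <-; ring.
  exists Q => // p ap Up; have := E2 _ (in_img ap Up).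
  rewrite /= (chart_cancel ca)//.
  have -> : S_curvature (g a) (fun y => s (cinv a y) + s (cinv a y) ^+ 2 * e (cinv a y)
    + s (cinv a y) ^+ m.+2 * f (cinv a y)) (cmap a p) = S_fun (fun z => s z + s z ^+ 2 * e z + s z ^+ m.+2 * f z) p.
    exact: (S_funE aa oU sw Up ap).
  have -> : S_curvature (g a) (fun y => s (cinv a y) + s (cinv a y) ^+ 2 * e (cinv a y)) (cmap a p)
     = S_fun (fun z => s z + s z ^+ 2 * e z) p by exact: (S_funE aa oU sv Up ap).
  by move=> ->; rewrite /step_coef; ring.
exists q => // p Up; have := E p Up => <-; ring.
Qed.

End CurvatureOnManifold.

Section ConformalOnManifold.
Variables (R : realType) (d : nat) (M : topologicalType) (atl : set (chart R d M)).
Hypothesis hM : oriented_manifold atl.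

Lemma S_curvature_conformal_fun (g h : metric_field R d M) Omega U u a p :
  is_metric atl g -> conformal_change atl Omega g h ->
  (1 < d)%N -> open U -> smooth_fun atl U u -> atl a -> dom a p -> U p ->
  S_curvature (h a) ((fun q => Omega q * u q) \o cinv a) (cmap a p) =
  S_curvature (g a) (u \o cinv a) (cmap a p).
Proof.
move=> hg [sO O0 hE] d1 oU su aa ap Up; have ca := atlas_chart hM aa.
have [oc sg ug symg] := metric_on_chart hM hg aa.
have oI := open_img ca oU; have IW : cmap a @` (dom a `&` U) `<=` cod a by exact: img_cod.
have sO' : smooth_on (cmap a @` (dom a `&` U)) (Omega \o cinv a).
  by apply: smooth_onW (sO a aa) => _ [q [aq _] <-]; exact: in_img.
rewrite -(S_curvature_conformal oI _ _ _ sO' _ (in_img ap Up) (su a aa) d1).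
- apply: (S_curvature_congr oI) => //; last exact: in_img.
  by move=> _ [q [aq Uq] <-]; rewrite /= (chart_cancel ca)// hE.
- by move=> i j; exact: smooth_onW (sg i j).
- by move=> x /IW; exact: ug.
- by move=> x /IW; exact: symg.
- by move=> x _; exact: O0.
Qed.

End ConformalOnManifold.

Lemma posdef_inv_gt0 (R : realType) (n : nat) (A : 'M[R]_n) (v : 'rV[R]_n) : A^T = A ->
  (forall v : 'rV[R]_n, v != 0 -> 0 < (v *m A *m v^T) 0 0) -> v != 0 ->
  0 < (v *m invmx A *m v^T) 0 0.
Proof.
move=> AT pA v0; have uA := posdef_unitmx pA.
have -> : v *m invmx A *m v^T = (v *m invmx A) *m A *m (v *m invmx A)^T.
  by rewrite trmx_mul trmx_inv AT mulmxKV// !mulmxA.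
apply: pA; apply: contra v0 => /eqP v0.
by rewrite -[v](mulmxKV uA) v0 mul0mx.
Qed.

(** * The equation in a fixed scale *)

Section Problem.
Variables (R : realType) (d : nat) (M : topologicalType) (atl : set (chart R d M)).
Hypothesis hM : oriented_manifold atl.
Variable g : metric_field R d M.
Hypotheses (hg : is_metric atl g) (hd : (2 <= d)%N).
Variable Sigma : set M.
Hypothesis emb : embedded_hypersurface atl Sigma.
Variable P : set M.
Implicit Types (a b : chart R d M) (U V W : set M) (f u v s e h q A : M -> R) (p z : M).

Local Notation img a U := (cmap a @` (dom a `&` U)).
Local Notation Sf := (S_fun hM g).

Let d0 : (0 < d)%N. Proof. exact: ltn_trans hd. Qed.

Let dR : d%:R != 0 :> R. Proof. by rewrite pnatr_eq0 -lt0n. Qed.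

Lemma step_coef_eq0 m : (step_coef R d m == 0) = (m.+1 == d).
Proof.
rewrite /step_coef !mulf_eq0 invr_eq0 (negbTE dR) orbF !pnatr_eq0 /=.
by rewrite subr_eq0 eqr_nat eqSS eq_sym.
Qed.

Definition oriented_defining U s := defining atl Sigma U s /\ forall p, U p -> (0 < s p <-> P p).

(** On [Sigma] only the gradient term of S remains, and the inverse metric is positive definite. *)
Lemma S_fun_gt0 U s p : defining atl Sigma U s -> Sigma p -> 0 < Sf s p.
Proof.
move=> [oU SU ss zs rs] Sp; have [a [i [aa ap si]]] := rs p Sp; have Up := SU p Sp.
have ca := atlas_chart hM aa.
rewrite -(S_funE hM hg aa oU ss Up ap) /S_curvature.
have -> : (s \o cinv a) (cmap a p) = 0 by rewrite /= (chart_cancel ca)//; apply/zs.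
rewrite mulr0 mul0r subr0.
pose v : 'rV[R]_d := \row_i pderiv i (s \o cinv a) (cmap a p).
have v0 : v != 0.
  by apply: contra si => /eqP /(congr1 (fun v : 'rV[R]_d => v 0 i)); rewrite !mxE => ->.
have cp : cod a (cmap a p) by exists p.
have := posdef_inv_gt0 (Defs.metric_sym hg aa cp) (fun w => metric_posdef hg aa cp (v := w)) v0.
rewrite mxE (_ : \sum_j _ = grad_sqnorm (g a) (s \o cinv a) (cmap a p))//.
rewrite /grad_sqnorm exchange_big; apply: eq_bigr => j _ /=.
rewrite !mxE mulr_suml; apply: eq_bigr => k _; rewrite !mxE.
by move: (invmx _ _ _) (pderiv _ _ _) (pderiv _ _ _) => *; ring.
Qed.

Lemma oriented_definingW U V s : open V -> Sigma `<=` V -> V `<=` U ->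
  oriented_defining U s -> oriented_defining V s.
Proof.
by move=> oV SV VU [ds sgn]; split; [exact: definingW ds|move=> p /VU; exact: sgn].
Qed.

Lemma oriented_defining_mul U s h : oriented_defining U s -> smooth_fun atl U h ->
  (forall p, U p -> 0 < h p) -> oriented_defining U (fun p => s p * h p).
Proof.
move=> [[oU SU ss zs rs] sgn] sh h0; have ssh := smooth_funM hM oU ss sh.
have h_neq0 p : U p -> h p != 0 by move=> Up; rewrite gt_eqF// h0.
split; last by move=> p Up; rewrite pmulr_lgt0 ?h0//; exact: sgn.
split=> //.
  move=> p Up; rewrite -(zs p Up); split=> [/eqP|->]; last by rewrite mul0r.
  by rewrite mulf_eq0 (negbTE (h_neq0 p Up)) orbF => /eqP.
move=> p Sp; have Up := SU p Sp.
apply: (regular_mul hM oU (t := s) (h := fun z => (h z)^-1) Up ssh _ _ _ (rs p Sp)).2.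
- exact: smooth_funV.
- by move=> z Uz; rewrite mulfK// h_neq0.
- by rewrite (_ : s p = 0) ?mul0r//; apply/zs.
Qed.

(** The perturbed function is [s] times [1 + s * e], a factor equal to 1 on [Sigma]; the
    neighbourhood is shrunk to where it is positive. *)
Lemma oriented_defining_perturb U s e : oriented_defining U s -> smooth_fun atl U e ->
  exists V, [/\ V `<=` U, oriented_defining V s,
    oriented_defining V (fun p => s p + s p ^+ 2 * e p) & forall p, V p -> 0 < 1 + s p * e p].
Proof.
move=> ds se; have [[oU SU ss zs rs] sgn] := ds.
have sh : smooth_fun atl U (fun p => 1 + s p * e p).
  by apply: (smooth_funD hM) => //; [exact: smooth_fun_cst|exact: (smooth_funM hM)].
have oV := smooth_fun_open_gt0 hM oU sh.
pose V := U `&` [set p | 0 < 1 + s p * e p].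
have VU : V `<=` U by move=> p [].
have SV : Sigma `<=` V.
  move=> p Sp; split; first exact: SU.
  by rewrite /= (_ : s p = 0) ?mul0r ?addr0//; apply/zs => //; exact: SU.
exists V; split=> //; [exact: oriented_definingW ds| |by move=> p []].
have -> : (fun p => s p + s p ^+ 2 * e p) = (fun p => s p * (1 + s p * e p)).
  by apply/funext => p; ring.
apply: oriented_defining_mul; first exact: oriented_definingW ds.
  exact: smooth_funW sh.
by move=> p [].
Qed.

Let defining_rs U s : defining atl Sigma U s -> forall p, U p -> s p = 0 -> regular_at atl s p.
Proof. by move=> ds p Up s0; exact: (defining_regular ds Up s0). Qed.

Lemma exists_normalized : positive_side atl Sigma P ->
  exists U s q, [/\ oriented_defining U s, smooth_fun atl U q & forall p, U p -> Sf s p = 1 + s p * q p].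
Proof.
move=> /(exists_defining hM)[U [s ds0]]; have [ds sgn] := ds0; have [oU SU ss zs rs] := ds.
have sS := smooth_S_fun hM hg oU ss.
have oV := smooth_fun_open_gt0 hM oU sS.
pose V := U `&` [set p | 0 < Sf s p].
have VU : V `<=` U by move=> p [].
have SV : Sigma `<=` V by move=> p Sp; split; [exact: SU|exact: (S_fun_gt0 ds)].
have dV : oriented_defining V s by exact: oriented_definingW ds0.
have sq : smooth_fun atl V (fun p => Num.sqrt (Sf s p)).
  by apply: (smooth_fun_sqrt hM) => //; [exact: smooth_funW sS|move=> p []].
have sq0 p : V p -> 0 < Num.sqrt (Sf s p) by move=> [_ /=]; rewrite sqrtr_gt0.
have sh : smooth_fun atl V (fun p => (Num.sqrt (Sf s p))^-1).
  by apply: (smooth_funV hM) => // p Vp; rewrite gt_eqF// sq0.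
have sV : smooth_fun atl V s by exact: smooth_funW ss.
have [q sq' E] := S_fun_mul hM hg oV sV sh (defining_rs dV.1).
exists V, (fun p => s p * (Num.sqrt (Sf s p))^-1), (fun p => q p * Num.sqrt (Sf s p)); split.
- by apply: oriented_defining_mul => // p Vp; rewrite invr_gt0 sq0.
- exact: (smooth_funM hM).
- move=> p Vp; rewrite E// exprVn sqr_sqrtr; last by case: Vp => _ /ltW.
  rewrite mulVf; last by case: Vp => _ /= ?; rewrite gt_eqF.
  by congr (1 + _); move: (gt_eqF (sq0 p Vp)) => /negbT; move: (Num.sqrt _) (s p) (q p) => *; field.
Qed.

(** * Solving the equation order by order *)

Section Improve.
Variables (U : set M) (s q : M -> R).
Hypotheses (ds : defining atl Sigma U s) (sq : smooth_fun atl U q)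
  (Sq : forall p, U p -> Sf s p = 1 + s p * q p).

Let oU : open U. Proof. by case: ds. Qed.
Let ss : smooth_fun atl U s. Proof. by case: ds. Qed.

Lemma S_fun_improve m e A : m.+1 != d -> smooth_fun atl U e -> smooth_fun atl U A ->
  (forall p, U p -> Sf (fun z => s z + s z ^+ 2 * e z) p = 1 + s p ^+ m.+1 * A p) ->
  exists f Q, [/\ smooth_fun atl U f, smooth_fun atl U Q & forall p, U p ->
    Sf (fun z => s z + s z ^+ 2 * (e z + s z ^+ m * f z)) p = 1 + s p ^+ m.+2 * Q p].
Proof.
move=> md se sA E; have c0 : step_coef R d m != 0 by rewrite step_coef_eq0.
(* The function that makes the leading term of the step cancel the remainder [A]. *)
have sf : smooth_fun atl U (fun p => - (step_coef R d m)^-1 * A p).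
  by apply: (smooth_funM hM) => //; exact: smooth_fun_cst.
have [Q sQ EQ] := S_fun_step hg d0 m oU ss se sf sq (defining_rs ds) Sq.
exists (fun p => - (step_coef R d m)^-1 * A p), Q; split=> // p Up.
rewrite -[LHS](S_fun_congr hM g oU (u := fun z => s z + s z ^+ 2 * e z + s z ^+ m.+2 * (- (step_coef R d m)^-1 * A z)))//.
  rewrite EQ// E//; move: c0; move: (step_coef R d m) (A p) (s p ^+ m.+1) (s p ^+ m.+2 * Q p) => *.
  by field.
by move=> z Uz; rewrite (exprD (s z) 2 m); ring.
Qed.

Lemma S_fun_solve k : (1 <= k <= d)%N -> exists e A, [/\ smooth_fun atl U e, smooth_fun atl U A &
  forall p, U p -> Sf (fun z => s z + s z ^+ 2 * e z) p = 1 + s p ^+ k * A p].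
Proof.
case: k => // m; elim: m => [_|m IH /= md].
  exists (fun=> 0), q; split=> // [|p Up]; first exact: smooth_fun_cst.
  rewrite expr1 -Sq//; apply: (S_fun_congr hM g oU) => // z Uz; ring.
have [|e [A [se sA E]]] := IH; first by rewrite /= ltnW.
have [|f [Q [sf sQ EQ]]] := S_fun_improve _ se sA E; first by rewrite ltn_eqF.
exists (fun z => e z + s z ^+ m * f z), Q; split=> //.
by apply: (smooth_funD hM) => //; apply: (smooth_funM hM) => //; exact: (smooth_funX hM).
Qed.

End Improve.

Definition solves U u A := [/\ oriented_defining U u, smooth_fun atl U A &
  forall p, U p -> Sf u p = 1 + u p ^+ d * A p].

Lemma exists_solution : positive_side atl Sigma P -> exists U u A, solves U u A.
Proof.
move=> /exists_normalized[U [s [q [os sq Sq]]]]; have [ds sgn] := os.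
have [|e [A [se sA E]]] := @S_fun_solve U s q ds sq Sq d; first by rewrite d0 leqnn.
have [V [VU oVs oVv V0]] := oriented_defining_perturb os se.
have [[oV _ sV _ _] _] := oVs.
have sh : smooth_fun atl V (fun p => 1 + s p * e p).
  apply: (smooth_funD hM) => //; first exact: smooth_fun_cst.
  by apply: (smooth_funM hM) => //; exact: smooth_funW se.
(* The remainder was relative to powers of [s]; with the new defining function [s * (1 + s * e)] it
   acquires the inverse [d]-th power of the cofactor. *)
exists V, (fun p => s p + s p ^+ 2 * e p), (fun p => A p / (1 + s p * e p) ^+ d); split=> //.
  apply: (smooth_funM hM) => //; first exact: smooth_funW sA.
  apply: (smooth_funV hM) => //; first exact: (smooth_funX hM).
  by move=> p Vp; rewrite expf_neq0// gt_eqF// V0.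
move=> p Vp; rewrite E; last exact: VU.
have -> : s p + s p ^+ 2 * e p = s p * (1 + s p * e p) by ring.
rewrite exprMn mulrACA divff ?mulr1; last by rewrite expf_neq0// gt_eqF// V0.
by [].
Qed.

Lemma solution_unique U u A U' u' A' : solves U u A -> solves U' u' A' ->
  forall p, Sigma p -> A p = A' p.
Proof.
move=> [ou sA E] [ou' sA' E']; have [du sgn] := ou; have [du' sgn'] := ou'.
have [oU SU su zu ru] := du; have [oU' SU' su' zu' ru'] := du'.
have oW := openI oU oU'; set W := U `&` U' in oW.
have SW : Sigma `<=` W by move=> p Sp; split; [exact: SU|exact: SU'].
have WU : W `<=` U by move=> p [].
have WU' : W `<=` U' by move=> p [].
have dW := definingW oW SW WU du; have sW := smooth_funW WU su.
have sAW := smooth_funW WU sA; have sAW' := smooth_funW WU' sA'.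
have u0 p : Sigma p -> u p = 0 by move=> Sp; apply/zu => //; exact: SU.
have u0' p : Sigma p -> u' p = 0 by move=> Sp; apply/zu' => //; exact: SU'.
have [h sh Eh] := defining_divide1 hM emb dW (smooth_funW WU' su') u0'.
have rsW := defining_rs dW.
(* On [Sigma] the two equations give [h ^+ 2 = 1]. The value -1 is excluded by orientation: [h] is
   not negative off [Sigma], so near such a point [u ^+ 2 * h] would vanish. *)
have h1 p : Sigma p -> h p = 1.
  move=> Sp; have Wp := SW p Sp.
  have [q sq Eq] := S_fun_mul hM hg oW sW sh rsW.
  have := Eq p Wp; rewrite -(S_fun_congr hM g oW Eh Wp) (E' p (SU' p Sp)) (E p (SU p Sp)).
  rewrite u0// u0'// !expr0n (gtn_eqF d0) !mul0r !addr0 mulr1 => /esym/eqP.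
  rewrite sqrf_eq1 => /orP[/eqP//|/eqP hp].
  exfalso; have oV := smooth_fun_open_gt0 hM oW (smooth_funN hM oW sh).
  suff : h p = 0 by rewrite hp => /eqP; rewrite oppr_eq0 oner_eq0.
  apply: (pow_mul_cancel_fun hM (m := 2) oV _ _ _ (u0 p Sp) (ru p Sp)).
  - by split=> //=; rewrite hp opprK ltr01.
  - by apply: smooth_funW sW => z [].
  - by apply: smooth_funW sh => z [].
  move=> z [Wz /= hz]; rewrite oppr_gt0 in hz.
  have [Sz|nS] := pselect (Sigma z); first by rewrite u0// expr0n mul0r.
  have uz : u z != 0 by apply/eqP => /(zu z (WU z Wz)).
  have : (0 < u z) = (0 < u' z).
    by apply/idP/idP => [/(sgn z (WU z Wz))|/(sgn' z (WU' z Wz))] Pz;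
      [apply/(sgn' z (WU' z Wz))|apply/(sgn z (WU z Wz))].
  rewrite Eh//; move: uz; rewrite neq_lt => /orP[] uz.
    by rewrite (lt_gtF uz) nmulr_lgt0// uz.
  by rewrite uz pmulr_rgt0// (lt_gtF hz).
have sh1 : smooth_fun atl W (fun p => h p - 1).
  by apply: (smooth_funB hM) => //; exact: smooth_fun_cst.
have [|e se Ee] := defining_divide1 hM emb dW sh1; first by move=> p /h1 ->; rewrite subrr.
have Ee' p : W p -> u' p = u p + u p ^+ 2 * e p.
  by move=> Wp; rewrite Eh// -[h p](subrK 1) Ee//; ring.
(* [u ^+ d * B] is the difference of S at the two solutions. *)
pose B p := h p ^+ d * A' p - A p.
have sB : smooth_fun atl W B.
  by apply: (smooth_funB hM) => //; apply: (smooth_funM hM) => //; exact: (smooth_funX hM).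
have sq : smooth_fun atl W (fun p => u p ^+ d.-1 * A p).
  by apply: (smooth_funM hM) => //; exact: (smooth_funX hM).
have Eu p : W p -> Sf u p = 1 + u p * (u p ^+ d.-1 * A p).
  by move=> Wp; rewrite E; [rewrite mulrA -exprS prednK|exact: WU].
have key m f : smooth_fun atl W f -> (forall p, W p -> e p = u p ^+ m * f p) ->
    exists2 Q, smooth_fun atl W Q & forall p, W p ->
      u p ^+ d * B p = step_coef R d m * f p * u p ^+ m.+1 + u p ^+ m.+2 * Q p.
  move=> sf Ef; have s0 : smooth_fun atl W (fun=> 0) by exact: smooth_fun_cst.
  have [Q sQ EQ] := S_fun_step hg d0 m oW sW s0 sf sq rsW Eu.
  exists Q => // p Wp; have := EQ p Wp.
  rewrite (S_fun_congr hM g oW (v := u') _ Wp); last first.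
    by move=> z Wz; rewrite Ee'// Ef// (exprD (u z) 2 m); ring.
  rewrite (S_fun_congr hM g oW (u := fun z => u z + u z ^+ 2 * 0) (v := u) _ Wp); last by move=> z _; ring.
  rewrite (E' p (WU' p Wp)) (E p (WU p Wp)) Eh// exprMn /B => EE.
  have -> : u p ^+ d * (h p ^+ d * A' p - A p) = (1 + u p ^+ d * h p ^+ d * A' p) - (1 + u p ^+ d * A p) by ring.
  by rewrite EE; ring.
(* If [e = u ^+ m * f] with [m.+1 < d], the difference of S has leading term a nonzero multiple of
   [f * u ^+ m.+1], while it is divisible by the higher power [u ^+ d]; hence [f] vanishes on
   [Sigma] and one more factor [u] splits off. *)
have iter m : (m < d)%N -> exists2 f, smooth_fun atl W f & forall p, W p -> e p = u p ^+ m * f p.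
  elim: m => [_|m IH md]; first by exists e => // p _; rewrite expr0 mul1r.
  have [f sf Ef] := IH (ltnW md); have [Q sQ EQ] := key m f sf Ef.
  have [f' sf' Ef'] : exists2 f', smooth_fun atl W f' & forall p, W p -> f p = u p * f' p.
    apply: (defining_divide1 hM emb dW sf) => p Sp.
    pose X p := step_coef R d m * f p + u p * Q p - u p ^+ (d - m.+1) * B p.
    have sX : smooth_fun atl W X.
      apply: (smooth_funB hM) => //.
        by apply: (smooth_funD hM) => //; apply: (smooth_funM hM) => //; exact: smooth_fun_cst.
      by apply: (smooth_funM hM) => //; exact: (smooth_funX hM).
    have : X p = 0.
      apply: (defining_cancel (m := m.+1) hM dW sX Sp) => z Wz.
      rewrite /X mulrBr [X in _ - X]mulrA -exprD subnKC; last exact: ltnW.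
      by rewrite EQ// (exprS (u z) m.+1); ring.
    rewrite /X u0// mul0r expr0n subn_eq0 leqNgt md mul0r subr0 addr0 => /eqP.
    by rewrite mulf_eq0 step_coef_eq0 (ltn_eqF md) => /eqP.
  by exists f' => // p Wp; rewrite Ef// Ef'// exprSr; ring.
have [|f sf Ef] := iter d.-1; first by rewrite prednK.
have [Q sQ EQ] := key _ f sf Ef; move: EQ.
(* At the critical order the identity reduces to [u ^+ d * B = u ^+ d.+1 * Q], so [B] vanishes on
   [Sigma], where [h] equals 1. *)
have -> : step_coef R d d.-1 = 0 by apply/eqP; rewrite step_coef_eq0 prednK.
rewrite prednK// => EQ p Sp.
have sX : smooth_fun atl W (fun p => B p - u p * Q p).
  by apply: (smooth_funB hM) => //; exact: (smooth_funM hM).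
have := defining_cancel (m := d) hM dW sX Sp.
rewrite u0// mul0r subr0 /B h1// expr1n mul1r => /(_ _)/eqP.
rewrite subr_eq0 => H; apply/esym/eqP; apply: H => z Wz.
by rewrite mulrBr EQ// exprSr; ring.
Qed.

(** Having the prescribed expansion to every order is an affine condition, so it survives gluing
    local Borel sums with weights of sum 1. *)
Lemma manifold_borel U u (f : nat -> M -> R) : defining atl Sigma U u ->
  (forall j, smooth_fun atl U (f j)) ->
  exists V E, [/\ open V, Sigma `<=` V, V `<=` U, smooth_fun atl V E &
    forall N p, Sigma p -> exists W h, [/\ open W, W p, W `<=` V, smooth_fun atl W h &
      forall z, W z -> E z = \sum_(0 <= j < N) u z ^+ j * f j z + u z ^+ N * h z]].
Proof.
move=> [oU SU su zu ru] sf.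
have /choice[T hT] : forall p, exists T : set M * (M -> R), Sigma p ->
    [/\ open T.1, T.1 p, T.1 `<=` U, smooth_fun atl T.1 T.2 &
     forall N z, Sigma z -> T.1 z -> exists W h, [/\ open W, W z, W `<=` T.1, smooth_fun atl W h &
      forall z, W z -> T.2 z = \sum_(0 <= j < N) u z ^+ j * f j z + u z ^+ N * h z]].
  move=> p; have [Sp|nS] := pselect (Sigma p); last by exists (set0, u).
  have [a aa ap] := atlas_cover hM p; have ca := atlas_chart hM aa.
  have oI := open_img ca oU.
  have [V [E [oV Vp VI sE HE]]] := borel oI (in_img ap (SU p Sp)) (su a aa) (fun j => sf j a aa).
  have oD := open_preimg ca oV.
  have DU : dom a `&` cmap a @^-1` V `<=` U.
    by move=> q [aq /VI[z [az Uz] e]]; rewrite -(chart_cancel ca aq) -e (chart_cancel ca).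
  have pull (X : set 'rV[R]_d) (F : 'rV[R]_d -> R) : open X -> smooth_on X F ->
      smooth_fun atl (dom a `&` cmap a @^-1` X) (F \o cmap a).
    move=> oX sF; have oDX := open_preimg ca oX.
    apply: (smooth_fun_of_chart hM (atlas_compatible hM aa)) => //.
    apply: (smooth_on_eq (f := F)); first exact: open_img.
      by move=> x; rewrite inE => -[q [aq _] <-] /=; rewrite (chart_cancel ca).
    by apply: smooth_onW sF => _ [q [_ [_ Xq]] <-].
  exists (dom a `&` cmap a @^-1` V, E \o cmap a) => _; split=> //=; first exact: pull.
  move=> N q Sq [aq Vq]; have [|X [h [oX Xq sh Eh]]] := HE N (cmap a q) Vq.
    by rewrite /= (chart_cancel ca)//; apply/zu => //; exact: DU.
  exists (dom a `&` cmap a @^-1` (V `&` X)), (h \o cmap a); split=> //.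
  - by apply: open_preimg => //; exact: openI.
  - by move=> z [az [Vz _]].
  - by apply: pull; [exact: openI|apply: smooth_onW sh => x []].
  - move=> z [az [_ Xz]] /=; rewrite Eh//= (chart_cancel ca)//.
have [p Sp|Y [E [oY SY sE loc]]] := @glue R d M atl hM Sigma (fun p => (T p).1) (fun p => (T p).2).
  by have [] := hT p Sp.
exists (U `&` Y), E; split.
- exact: openI.
- by move=> p Sp; split; [exact: SU|exact: SY].
- by move=> p [].
- by apply: smooth_funW sE => p [].
move=> N p Sp; have [W [r [c [psi [[oW WY] Wp hr psi1 uE]]]]] := loc p (SY p Sp).
pose Q i V := exists2 h, smooth_fun atl V h & forall z, V z ->
  (T (c i)).2 z = \sum_(0 <= j < N) u z ^+ j * f j z + u z ^+ N * h z.
have [i V V' VV' [h sh e]|i /hr[Sc WD _ _]|V [oV Vp QV]] := @open_seq_near_mem M p r Q.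
- by exists h; [exact: smooth_funW sh|move=> z /VV'; exact: e].
- have [_ _ _ _ H] := hT _ Sc; have [V [h [oV Vp VT sh e]]] := H N p Sp (WD p Wp).
  by exists V; split=> //; exists h.
have /choice[h hh] : forall i, exists h, i \in r -> smooth_fun atl V h /\ forall z, V z ->
    (T (c i)).2 z = \sum_(0 <= j < N) u z ^+ j * f j z + u z ^+ N * h z.
  move=> i; have [/QV[h sh e]|_] := boolP (i \in r); first by exists h.
  by exists (fun=> 0).
have oX : open (V `&` W `&` U) by apply: openI => //; exact: openI.
exists (V `&` W `&` U), (fun z => \sum_(i <- r) psi i z * h i z); split=> //.
- by split=> //; exact: SU.
- by move=> z [[_ /WY]].
- apply: (smooth_fun_eq hM oX (f := fun z => \sum_(i <- r | i \in r) psi i z * h i z)).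
    by move=> z _; rewrite [RHS]big_seq.
  apply: (smooth_fun_sum hM) => // i ir; apply: (smooth_funM hM) => //.
    by have [_ _ sp _] := hr i ir; apply: smooth_funW sp => z [[]].
  by have [sh _] := hh i ir; apply: smooth_funW sh => z [[]].
move=> z [[Vz Wz] _]; rewrite uE//.
rewrite -[X in X + _]mul1r -(psi1 z Wz) mulr_suml mulr_sumr -big_split big_seq [RHS]big_seq.
apply: eq_bigr => i ir /=; have [_ ->//] := hh i ir.
by rewrite mulrDr [psi i z * (u z ^+ N * _)]mulrCA.
Qed.

(** Since [A] vanishes on [Sigma] it has a factor [u], so the remainder has already passed the
    critical order and all further step coefficients are nonzero. The successive corrections are
    then summed by [manifold_borel]. *)
Lemma formal_solution U u A : solves U u A -> (forall p, Sigma p -> A p = 0) ->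
  exists V w, oriented_defining V w /\
    forall N p, Sigma p -> exists W h, [/\ open W, W p, W `<=` V, smooth_fun atl W h &
      forall z, W z -> Sf w z = 1 + w z ^+ N * h z].
Proof.
move=> [ou sA E] A0; have [du sgn] := ou; have [oU SU su zu ru] := du.
have [A1 sA1 EA1] := defining_divide1 hM emb du sA A0.
have sq : smooth_fun atl U (fun p => u p ^+ d.-1 * A p).
  by apply: (smooth_funM hM) => //; exact: (smooth_funX hM).
have Eu p : U p -> Sf u p = 1 + u p * (u p ^+ d.-1 * A p).
  by move=> Up; rewrite E//; rewrite mulrA -exprS prednK.
(* The state after [n] corrections: [X.1] is the accumulated correction and [X.2] the remainder it
   leaves. *)
pose H n (X : (M -> R) * (M -> R)) := [/\ smooth_fun atl U X.1, smooth_fun atl U X.2 &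
  forall p, U p -> Sf (fun z => u z + u z ^+ 2 * X.1 z) p = 1 + u p ^+ (d + n).+1 * X.2 p].
have /choice[F hF] : forall nX : nat * ((M -> R) * (M -> R)), exists Y : (M -> R) * (M -> R),
    H nX.1 nX.2 -> smooth_fun atl U Y.1 /\ H nX.1.+1 (fun z => nX.2.1 z + u z ^+ (d + nX.1) * Y.1 z, Y.2).
  move=> [n [e B]] /=; have [[se sB EB]|nH] := pselect (H n (e, B)); last by exists (e, B).
  have [|f [Q [sf sQ EQ]]] := S_fun_improve du sq Eu (m := d + n) _ se sB EB.
    by rewrite gtn_eqF// ltnS leq_addr.
  exists (f, Q) => _; split=> //; split=> //=; last by rewrite addnS.
  by apply: (smooth_funD hM) => //; apply: (smooth_funM hM) => //; exact: (smooth_funX hM).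
(* The recursion starts with no correction and remainder [A1], because [A = u * A1]. *)
pose X := fix X n := if n is m.+1 then
  ((fun z => (X m).1 z + u z ^+ (d + m) * (F (m, X m)).1 z), (F (m, X m)).2) else ((fun=> 0 : R), A1).
have HX n : H n (X n).
  elim: n => [|n IH]; last by have [] := hF (n, X n) IH.
  split=> //=; first exact: smooth_fun_cst.
  move=> p Up; rewrite (S_fun_congr hM g oU (v := u) _ Up); last by move=> z _; ring.
  by rewrite E// EA1// addn0 exprSr mulrA.
pose f n := (F (n, X n)).1.
have sf n : smooth_fun atl U (f n) by have [] := hF (n, X n) (HX n).
have XE n z : (X n).1 z = \sum_(0 <= j < n) u z ^+ (d + j) * f j z.
  elim: n => [|n IH]; first by rewrite big_geq.
  by rewrite big_nat_recr//= -IH.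
have [Y [B [oY SY YU sB HB]]] := manifold_borel du sf.
have ouY := oriented_definingW oY SY YU ou.
have suY := smooth_funW YU su.
have sudB : smooth_fun atl Y (fun z => u z ^+ d * B z).
  by apply: (smooth_funM hM) => //; exact: (smooth_funX hM).
have [V [VY oVu oVw V0]] := oriented_defining_perturb ouY sudB.
have [[oV SV suV zV rV] _] := oVu.
exists V, (fun p => u p + u p ^+ 2 * (u p ^+ d * B p)); split=> // N p Sp.
have [W [h [oW Wp WY sh Eh]]] := HB N p Sp.
have oX := openI oW oV; set Z := W `&` V in oX.
have ZU : Z `<=` U by move=> z [/WY/YU].
have ZW : Z `<=` W by move=> z [].
have ZV : Z `<=` V by move=> z [].
have [se sB' EX] := HX N.
have rsZ z : Z z -> u z = 0 -> regular_at atl u z by move=> /ZU Uz; exact: (defining_rs du).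
(* Near [p], the full sum differs from its stage [N] by [u ^+ (d + N).+2 * h]; a step of that order
   controls S without using the later corrections. *)
have [Q sQ EQ] := S_fun_step hg d0 (d + N) oX (smooth_funW ZU su) (smooth_funW ZU se)
  (smooth_funW ZW sh) (smooth_funW ZU sq) rsZ (fun z Zz => Eu z (ZU z Zz)).
(* The final function is [u * k] with [k] invertible, which converts powers of [u] into powers of
   [w]. *)
pose k z := 1 + u z * (u z ^+ d * B z).
have sk : smooth_fun atl Z k.
  apply: (smooth_funD hM) => //; first exact: smooth_fun_cst.
  by apply: (smooth_funM hM) => //; [exact: smooth_funW su|apply: smooth_funW sudB => z /ZV/VY].
have k0 z : Z z -> k z != 0 by move=> /ZV/V0; rewrite lt0r => /andP[].
pose h' z := u z ^+ d.+1 * ((X N).2 z + step_coef R d (d + N) * h z + u z * Q z) / k z ^+ N.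
have suZ := smooth_funW ZU su.
have sh' : smooth_fun atl Z h'.
  apply: (smooth_funM hM) => //; last first.
    by apply: (smooth_funV hM) => //; [exact: (smooth_funX hM)|move=> z /k0 kz; rewrite expf_neq0].
  apply: (smooth_funM hM) => //; first exact: (smooth_funX hM).
  apply: (smooth_funD hM) => //; last exact: (smooth_funM hM).
  apply: (smooth_funD hM) => //; first exact: (smooth_funW ZU sB').
  by apply: (smooth_funM hM) => //; [exact: smooth_fun_cst|exact: smooth_funW sh].
exists Z, h'; split=> //; first by split=> //; exact: SV.
move=> z Zz; rewrite (S_fun_congr hM g oX (v := fun z => u z + u z ^+ 2 * (X N).1 z + u z ^+ (d + N).+2 * h z) _ Zz); last first.
  move=> y Zy; rewrite Eh; last exact: ZW.
  rewrite XE mulrDr mulrDr addrA; congr (_ + _ + _).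
    rewrite !mulr_sumr; apply: eq_bigr => j _; rewrite exprD; ring.
  by rewrite (exprD (u y) 2 (d + N)) exprD; ring.
rewrite EQ// EX; last exact: ZU.
have -> : u z + u z ^+ 2 * (u z ^+ d * B z) = u z * k z by rewrite /k; ring.
rewrite /h' exprMn; have := expf_neq0 N (k0 z Zz).
rewrite [u z ^+ (d + N).+2]exprS -[(d + N).+1]addSn [u z ^+ (d.+1 + N)]exprD.
move: (k z ^+ N) (u z ^+ d.+1) (u z ^+ N) (u z) ((X N).2 z) (step_coef R d (d + N)) (h z) (Q z).
by move=> *; field.
Qed.

(** If all derivatives of [w ^+ k * h] vanish on [Sigma], then [k] derivatives in a direction where
    [w] is regular give [h = 0] there, so another factor [w] splits off. After [d.+1] factors the
    remainder of order [d] is [w] times a smooth function. *)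
Lemma formal_remainder V w : oriented_defining V w ->
  (forall a p, atl a -> dom a p -> Sigma p -> forall r : seq 'I_d,
    pderivs r (fun x => S_curvature (g a) (w \o cinv a) x - 1) (cmap a p) = 0) ->
  exists A, solves V w A /\ forall p, Sigma p -> A p = 0.
Proof.
move=> ow flat; have [dw sgn] := ow; have [oV SV sw zw rw] := dw.
have w0 p : Sigma p -> w p = 0 by move=> Sp; apply/zw => //; exact: SV.
have sF : smooth_fun atl V (fun p => Sf w p - 1).
  by apply: (smooth_funB hM) => //; [exact: smooth_S_fun|exact: smooth_fun_cst].
have div k : exists2 h, smooth_fun atl V h & forall p, V p -> Sf w p - 1 = w p ^+ k * h p.
  elim: k => [|k [h sh E]]; first by eexists; [exact: sF|move=> p _; rewrite expr0 mul1r].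
  have [|h' sh' E'] := defining_divide1 hM emb dw sh.
    move=> p Sp; have [a [i [aa ap wi]]] := rw p Sp; have ca := atlas_chart hM aa.
    have oI := open_img ca oV; have Ip := in_img ap (SV p Sp).
    have := pderivs_pow_mul_top k i oI (sw a aa) (sh a aa) Ip.
    rewrite /= (chart_cancel ca)// w0// => /(_ erefl).
    rewrite (pderivs_eq oI (g := fun x => S_curvature (g a) (w \o cinv a) x - 1)) ?inE//; last first.
      move=> x; rewrite inE => -[q [aq Vq] <-].
      by rewrite (S_funE hM hg aa oV sw Vq aq) E//= (chart_cancel ca).
    rewrite flat// => /esym/eqP; rewrite !mulf_eq0 expf_eq0 (negbTE wi) andbF orbF.
    by rewrite pnatr_eq0 => /orP[/eqP f0|/eqP//]; move: (fact_gt0 k); rewrite f0.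
  by exists h' => // p Vp; rewrite E// E'// exprSr mulrA.
have [h sh E] := div d.+1.
exists (fun p => w p * h p); split; last by move=> p /w0 ->; rewrite mul0r.
split=> //; first exact: (smooth_funM hM).
by move=> p Vp; rewrite mulrA -exprSr -E// addrC subrK.
Qed.

End Problem.

(** * Densities *)

Section Densities.
Variables (R : realType) (d : nat) (M : topologicalType) (atl : set (chart R d M)).
Hypotheses (hM : oriented_manifold atl) (hd : (2 <= d)%N).
Implicit Types (a b : chart R d M) (U V W : set M) (u A : M -> R) (g h : metric_field R d M).

Lemma conformal_change_unique g h Omega Omega' p : is_metric atl g ->
  conformal_change atl Omega g h -> conformal_change atl Omega' g h -> Omega p = Omega' p.
Proof.
move=> hg [_ O0 E] [_ O0' E']; have [a aa ap] := atlas_cover hM p.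
pose v : 'rV[R]_d := const_mx 1.
have v0 : v != 0.
  have i0 : 'I_d := Ordinal (ltnW hd).
  by apply/eqP => /(congr1 (fun v : 'rV[R]_d => v 0 i0)); rewrite !mxE => /eqP; rewrite oner_eq0.
have ca : cod a (cmap a p) by exists p.
have pos := metric_posdef hg aa ca v0.
have : Omega p ^+ 2 *: g a (cmap a p) = Omega' p ^+ 2 *: g a (cmap a p) by rewrite -E// E'.
move=> /(congr1 (fun X => (v *m X *m v^T) 0 0)).
rewrite -!scalemxAr -!scalemxAl !mx_scaleE => /(mulIf (lt0r_neq0 pos)) /eqP.
by rewrite eqrXn2 ?ltW// => /eqP.
Qed.

Lemma conformal_change_mul g h k Omega Omega' :
  conformal_change atl Omega g h -> conformal_change atl Omega' h k ->
  conformal_change atl (fun p => Omega' p * Omega p) g k.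
Proof.
move=> [sO O0 E] [sO' O0' E']; split.
- by apply: (smooth_funM hM) => //; exact: openT.
- by move=> p; rewrite mulr_gt0.
- by move=> a p aa ap; rewrite E'// E// scalerA -exprMn.
Qed.

Lemma conformal_change_id g : conformal_change atl (fun=> 1) g g.
Proof.
split=> // [|a p _ _]; first exact: smooth_fun_cst.
by rewrite expr1n scale1r.
Qed.

Variables (c : set (metric_field R d M)) (g0 : metric_field R d M).
Hypotheses (hg0 : is_metric atl g0)
  (cE : c = [set h | is_metric atl h /\ exists Omega, conformal_change atl Omega g0 h]).

(** Conformal factors relative to [g0], chosen simultaneously for all metrics of the class, so that
    a function in the scale [g0] determines a density. *)
Variable Om : metric_field R d M -> M -> R.
Hypothesis hOm : forall h, c h -> conformal_change atl (Om h) g0 h.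

Lemma class_base : c g0.
Proof. by rewrite cE; split=> //; exists (fun=> 1); exact: conformal_change_id. Qed.

Let Om_gt0 h p : c h -> 0 < Om h p. Proof. by case/hOm. Qed.

Let Om_base p : Om g0 p = 1.
Proof.
exact: (conformal_change_unique p hg0 (hOm class_base) (conformal_change_id g0)).
Qed.

Let Om_change g h Omega p : c g -> c h -> conformal_change atl Omega g h ->
  Om h p = Omega p * Om g p.
Proof.
move=> cg ch gh.
exact: (conformal_change_unique p hg0 (hOm ch) (conformal_change_mul (hOm cg) gh)).
Qed.

(* The density of weight [w] represented by the function [u] in the scale [g0]. *)
Definition dens (w : R) u : density R d M := fun h p => Om h p `^ w * u p.

Lemma dens_base w u p : dens w u g0 p = u p.
Proof. by rewrite /dens Om_base powR1 mul1r. Qed.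

Let dens_change w u g h Omega p : c g -> c h -> conformal_change atl Omega g h ->
  dens w u h p = Omega p `^ w * dens w u g p.
Proof.
move=> cg ch gh; rewrite /dens (Om_change p cg ch gh) powRM; first by rewrite mulrA.
  by case: gh => _ /(_ p)/ltW.
by rewrite ltW// Om_gt0.
Qed.

Lemma density_from_base U w (f : density R d M) h p : is_density atl c U w f -> c h -> U p ->
  f h p = Om h p `^ w * f g0 p.
Proof. by move=> [_ H] ch Up; apply: H => //; [exact: class_base|exact: hOm]. Qed.

Let dens1E u h p : c h -> dens 1 u h p = u p * Om h p.
Proof. by move=> ch; rewrite /dens powRr1 1?mulrC// ltW// Om_gt0. Qed.

Let densNE n u h p : c h -> dens (- n%:R) u h p = u p * (Om h p ^+ n)^-1.
Proof. by move=> ch; rewrite /dens powRN powR_mulrn 1?mulrC// ltW// Om_gt0. Qed.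

Let smooth_Om U h : c h -> smooth_fun atl U (Om h).
Proof. by move=> /hOm[sO _ _]; exact: smooth_funW sO. Qed.

Lemma is_density_dens1 U u : open U -> smooth_fun atl U u -> is_density atl c U 1 (dens 1 u).
Proof.
move=> oU su; split=> [h ch|g h Omega cg ch gh p _]; last exact: dens_change.
rewrite (_ : dens 1 u h = fun p => u p * Om h p); last by apply/funext => p; exact: dens1E.
by apply: (smooth_funM hM) => //; exact: smooth_Om.
Qed.

Lemma is_density_densN n U u : open U -> smooth_fun atl U u ->
  is_density atl c U (- n%:R) (dens (- n%:R) u).
Proof.
move=> oU su; split=> [h ch|g h Omega cg ch gh p _]; last exact: dens_change.
rewrite (_ : dens (- n%:R) u h = fun p => u p * (Om h p ^+ n)^-1); last first.
  by apply/funext => p; exact: densNE.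
apply: (smooth_funM hM) => //; apply: (smooth_funV hM) => //.
  by apply: (smooth_funX hM) => //; exact: smooth_Om.
by move=> p _; rewrite expf_neq0// gt_eqF// Om_gt0.
Qed.

Variables (Sigma P : set M).
Hypothesis emb : embedded_hypersurface atl Sigma.

Lemma defining_density_dens U u : oriented_defining atl Sigma P U u ->
  defining_density atl c Sigma P U (dens 1 u).
Proof.
move=> ou; have [[oU SU su _ _] _] := ou.
have H h : c h -> oriented_defining atl Sigma P U (dens 1 u h).
  move=> ch; rewrite (_ : dens 1 u h = fun p => u p * Om h p); last by apply/funext => p; exact: dens1E.
  by apply: (oriented_defining_mul hM ou) => [|p _]; [exact: smooth_Om|exact: Om_gt0].
split=> //; first exact: is_density_dens1.
- by move=> h p ch Up; have [[_ _ _ zs _] _] := H h ch; exact: zs.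
- move=> h a p ch aa ap Sp; have [[_ _ ss _ rs] _] := H h ch.
  exact: (regular_in_chart hM aa oU (SU p Sp) ss ap (rs p Sp)).
- by move=> h p ch Up; have [_] := H h ch; exact.
Qed.

Lemma defining_density_base U sigma : defining_density atl c Sigma P U sigma ->
  oriented_defining atl Sigma P U (sigma g0).
Proof.
have cg := class_base; move=> [oU SU [ssig _] zsig gsig psig]; split=> [|p Up]; last exact: psig.
split=> //; [exact: ssig|by move=> p Up; exact: zsig|move=> p Sp].
by have [a aa ap] := atlas_cover hM p; have [i] := gsig _ _ _ cg aa ap Sp; exists a, i.
Qed.

(** In the scale [h] the density is represented by [Om h * u], exactly the rescaling under which S
    is invariant; hence the equation needs to be studied only in the scale [g0]. *)
Lemma S_density_dens U u h a p : open U -> smooth_fun atl U u -> U p -> c h -> atl a -> dom a p ->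
  S_density (dens 1 u) h a (cmap a p) = S_fun hM g0 u p.
Proof.
move=> oU su Up ch aa ap; rewrite /S_density.
rewrite (_ : dens 1 u h = fun q => Om h q * u q); last first.
  by apply/funext => q; rewrite dens1E// mulrC.
by rewrite (S_curvature_conformal_fun hM hg0 (hOm ch) hd oU su aa ap Up) (S_funE hM hg0 aa oU).
Qed.

Lemma solves_dens U u A : solves hM g0 Sigma P U u A ->
  solves_to_order atl c Sigma P d U (dens 1 u) (dens (- d%:R) A).
Proof.
move=> [ou sA E]; have [[oU SU su _ _] _] := ou; split.
- exact: defining_density_dens.
- exact: is_density_densN.
- move=> h a p ch aa ap Up; rewrite (S_density_dens oU su Up ch aa ap) E//.
  rewrite dens1E// densNE// exprMn mulrACA divff ?mulr1//.
  by rewrite expf_neq0// gt_eqF// Om_gt0.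
Qed.

Lemma solves_base U sigma (A : density R d M) : solves_to_order atl c Sigma P d U sigma A ->
  solves hM g0 Sigma P U (sigma g0) (A g0).
Proof.
have cg := class_base; move=> [dsig [sA _] E]; have os := defining_density_base dsig.
split=> //; first exact: sA.
move=> p Up; have [a aa ap] := atlas_cover hM p; have [[oU _ ss _ _] _] := os.
by rewrite -(S_funE hM hg0 aa oU ss Up ap); exact: E.
Qed.

Lemma obstruction : positive_side atl Sigma P ->
  exists B : density R d M,
    [/\ is_density_along atl c Sigma (- d%:R) B,
        is_obstruction_density atl c Sigma P B
      & (exists U sigma, solves_to_infinite_order atl c Sigma P U sigma) <->
        (forall g p, c g -> Sigma p -> B g p = 0)].
Proof.
move=> /(exists_solution hM hg0 hd)[U [u [A uA]]].
have [[[oU SU su _ _] _] sA _] := uA.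
have [sB cB] := is_density_densN d oU sA.
exists (dens (- d%:R) A); split.
- split=> [h ch p Sp|g h Omega cg ch gh p /SU]; last exact: cB.
  by exists U, (dens (- d%:R) A h); split=> //; [exact: SU|exact: sB].
- split; first by exists U, (dens 1 u), (dens (- d%:R) A); exact: solves_dens.
  move=> V sigma A' s' h p ch Sp; have sb := solves_base s'.
  have [[[_ SV _ _ _] _] _ _] := sb.
  rewrite (density_from_base (solves_remainder s') ch (SV p Sp)).
  by rewrite -(solution_unique hg0 hd emb uA sb Sp).
- split=> [[V [sigma [dsig flat]]] h p ch Sp|B0].
    have os := defining_density_base dsig.
    have [A' [sA' A0]] := formal_remainder hM hg0 emb os (fun a p => flat g0 a p class_base).
    by rewrite /dens (solution_unique hg0 hd emb uA sA' Sp) A0// mulr0.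
  have A0 p : Sigma p -> A p = 0.
    by move=> Sp; have := B0 _ p class_base Sp; rewrite dens_base.
  have [V [w [ow flat]]] := formal_solution hg0 hd emb uA A0.
  have [[oV SV sw zw _] _] := ow.
  exists V, (dens 1 w); split; first exact: defining_density_dens.
  move=> h a p ch aa ap Sp r; have ca := atlas_chart hM aa.
  (* One power more than the number of derivatives in [r], so that all of them vanish on [Sigma]. *)
  have [W [k [oW Wp WV sk E]]] := flat (size r).+1 p Sp.
  have oI := open_img ca oW.
  have swW := smooth_funW WV sw.
  rewrite (pderivs_eq oI (g := fun x => (w \o cinv a) x ^+ (size r).+1 * (k \o cinv a) x)).
  + apply: (pderivs_pow_mul0 oI (swW a aa) (sk a aa) (in_img ap Wp)) => //.
    by rewrite /= (chart_cancel ca)//; apply/zw => //; exact: SV.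
  + move=> x; rewrite inE => -[z [az Wz] <-].
    rewrite (S_density_dens oW swW Wz ch aa az) E//= (chart_cancel ca)//.
    by rewrite addrAC subrr add0r.
  + by rewrite inE; exact: in_img.
Qed.

End Densities.

Theorem theorem1p2 (R : realType) (d : nat) (hd : (3 <= d)%N)
  (M : topologicalType) (atl : set (chart R d M))
  (hM : oriented_manifold atl)
  (c : set (metric_field R d M)) (hc : is_conformal_class atl c)
  (Sigma : set M) (hSigma : embedded_hypersurface atl Sigma)
  (P : set M) (hP : positive_side atl Sigma P) :
  exists B : density R d M,
    [/\ is_density_along atl c Sigma (- d%:R) B,
        is_obstruction_density atl c Sigma P B
      & (exists U sigma, solves_to_infinite_order atl c Sigma P U sigma) <->
        (forall g p, c g -> Sigma p -> B g p = 0)].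
Proof.
have [g0 hg0 cE] := hc.
(* Outside the class the factor is arbitrary; the constant 1 is a placeholder. *)
have /choice[Om hOm] : forall h, exists Omega, c h -> conformal_change atl Omega g0 h.
  move=> h; have [|nc] := pselect (c h); last by exists (fun=> 1) => /nc.
  by rewrite {1}cE => -[_ [w gh]]; exists w.
exact: (obstruction hM (ltnW hd) hg0 cE hOm hSigma hP).
Qed.
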